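(* Let $h$ be a gauge function and $r_h>0$ such that $\int_0^{r_h}\frac{h(2t)}{t}\,dt<\infty$, and put $h_1(t)=\int_0^t\frac{h(2s)}{s}\,ds$ for $0\le t\le r_h$. Let $E\subseteq\Omega_0$ be a $2$-rectifiable set which is $(\Omega_0,L_0,h)$ locally sliding almost minimal at $x\in E$, and put $\Theta(x,r)=r^{-2}\mathcal H^2(E\cap B(x,r))$. \begin{itemize} \item If $x\in L_0$, then $r\mapsto\Theta(x,r)+8h_1(r)$ is nondecreasing on $(0,r_h)$. \item If $x\notin L_0$, then $r\mapsto\Theta(x,r)+8h_1(r)$ is nondecreasing on $(0,\min\{r_h,\mathrm{dist}(x,L_0)\})$. \end{itemize}
   Context: $\Omega_0=\{(x_1,x_2,x_3)\in\mathbb{R}^3:x_3\ge0\}$, $L_0=\partial\Omega_0$; $B(x,r)$ is the open ball. A gauge function is a nondecreasing $h:[0,\infty)\to[0,\infty]$ with $\lim_{t\to0}h(t)=0$. For $E\subseteq\Omega_0$ and $U$ open, a sliding deformation of $E$ in $U$ is a family of maps $\varphi_t:E\to\Omega_0$, $0\le t\le1$, such that: $\varphi_t(x)=x$ for $x\in E\setminus U$ and $\varphi_t(x)\in U$ for $x\in E\cap U$; $\varphi_t(x)\in L_0$ for $x\in E\cap L_0$; $(t,x)\mapsto\varphi_t(x)$ is continuous; $\varphi_1$ is Lipschitz and $\varphi_0=\mathrm{id}_E$. A nonempty $E\subseteq\Omega_0$ is $(\Omega_0,L_0,h)$ locally sliding almost minimal at $x\in E$ if $\mathcal H^2$ restricted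 to $E$ is locally finite and for every sliding deformation $\{\varphi_t\}$ of $E$ in $B(x,r)$, $\mathcal H^2(E\cap B(x,r))\le\mathcal H^2(\varphi_1(E)\cap B(x,r))+h(r)r^2$. *)

(* Defs.v *)
From HB Require Import structures.
From mathcomp Require Export all_boot all_order all_algebra.
From mathcomp Require Export all_classical all_reals all_analysis.
Export Order.TTheory GRing.Theory Num.Theory.
Export numFieldNormedType.Exports.
Set Implicit Arguments.
Unset Strict Implicit.
Unset Printing Implicit Defensive.

Local Open Scope classical_set_scope.
Local Open Scope ring_scope.

(* R^n is 'rV[R]_n. Its library norm and ball are those of the sup norm, so the
   metric notions (balls, diameter, distance) are defined below from the
   Euclidean norm. The two norms are equivalent, hence the library's topology
   and Lipschitz maps are the Euclidean ones. *)
Definition enorm (R : realType) (n : nat) (x : 'rV[R]_n) : R :=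
  Num.sqrt (\sum_(i < n) x 0 i ^+ 2).

Definition eball (R : realType) (n : nat) (x : 'rV[R]_n) (r : R) :
  set 'rV[R]_n := [set y | enorm (y - x) < r].

Definition edistance (R : realType) (n : nat) (x : 'rV[R]_n)
  (A : set 'rV[R]_n) : R := inf [set enorm (x - y) | y in A].

(* 0 is added to the set of distances so that the diameter of set0 is 0. *)
Definition ediameter (R : realType) (n : nat) (A : set 'rV[R]_n) : \bar R :=
  ereal_sup (0%E |` [set (enorm (p.1 - p.2))%:E | p in A `*` A]).

(* Two-dimensional Hausdorff (outer) measure. The constant pi / 4 is the usual
   normalization, making it agree with the Lebesgue measure on planes. *)
Definition hausdorff2_delta (R : realType) (n : nat) (delta : R)
    (A : set 'rV[R]_n) : \bar R :=
  ereal_inf [set (\sum_(0 <= k <oo) (pi / 4)%:E * ediameter (U k) ^+ 2)%E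
    | U in [set U : nat -> set 'rV[R]_n |
            A `<=` \bigcup_k U k /\
            forall k, (ediameter (U k) <= delta%:E)%E]].

Definition hausdorff2 (R : realType) (n : nat) (A : set 'rV[R]_n) : \bar R :=
  ereal_sup [set hausdorff2_delta delta A | delta in [set d : R | 0 < d]].

Definition rectifiable2 (R : realType) (n : nat) (E : set 'rV[R]_n) : Prop :=
  exists f : nat -> 'rV[R]_2 -> 'rV[R]_n,
    (forall i, lipschitz (f i)) /\
    hausdorff2 (E `\` \bigcup_i range (f i)) = 0%E.

Definition Omega0 (R : realType) : set 'rV[R]_3 :=
  [set x | 0 <= x 0 ord_max].

Definition L0 (R : realType) : set 'rV[R]_3 :=
  closure (@Omega0 R) `\` interior (@Omega0 R).

(* The values of a gauge function on negative reals are irrelevant. *)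
Definition gauge_function (R : realType) (h : R -> \bar R) : Prop :=
  [/\ (forall t, 0 <= t -> (0 <= h t)%E),
      (forall s t, 0 <= s -> s <= t -> (h s <= h t)%E) &
      h t @[t --> 0^'+] --> 0%E].

(* phi t y is only meaningful for t in [0, 1] and y in E. *)
Definition sliding_deformation (R : realType) (E U : set 'rV[R]_3)
    (phi : R -> 'rV[R]_3 -> 'rV[R]_3) : Prop :=
  [/\ [/\ (forall t, 0 <= t <= 1 -> forall y, E y -> Omega0 (phi t y)),
          (forall t, 0 <= t <= 1 -> forall y, E y -> ~ U y -> phi t y = y),
          (forall t, 0 <= t <= 1 -> forall y, E y -> U y -> U (phi t y)) &
          (forall t, 0 <= t <= 1 -> forall y, E y -> L0 y -> L0 (phi t y))],
      {within `[0, 1] `*` E,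
         continuous (fun p : R * 'rV[R]_3 => phi p.1 p.2)},
      [lipschitz phi 1 y | y in E] &
      forall y, E y -> phi 0 y = y].

Definition locally_sliding_almost_minimal (R : realType) (h : R -> \bar R)
    (E : set 'rV[R]_3) (x : 'rV[R]_3) : Prop :=
  [/\ E `<=` @Omega0 R,
      E x,
      (forall y, exists2 r : R, 0 < r & (hausdorff2 (E `&` eball y r) < +oo)%E) &
      forall (r : R) (phi : R -> 'rV[R]_3 -> 'rV[R]_3), 0 < r ->
        sliding_deformation E (eball x r) phi ->
        (hausdorff2 (E `&` eball x r) <=
           hausdorff2 ((phi 1%R @` E) `&` eball x r) + h r * (r ^+ 2)%:E)%E].

Definition gauge_integral (R : realType) (h : R -> \bar R) (t : R) : \bar R :=
  (\int[lebesgue_measure]_(s in `]0%R, t[) (h (2 * s)%R * (s^-1)%:E))%E.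

Definition density (R : realType) (E : set 'rV[R]_3) (x : 'rV[R]_3) (r : R) :
  \bar R := ((r ^- 2)%:E * hausdorff2 (E `&` eball x r))%E.

(* Main.v *)
(* For rho < r and 0 < beta < 1, deform E in B(x,r) radially by |y - x| -> g |y - x|,
   where g is linear of slope beta on [0, rho], g^2 is affine in s^2 on [rho, r], and
   g r = r.  Then g g' / s is constant on [rho, r], equal to
   alpha = (r^2 - beta^2 rho^2) / (r^2 - rho^2), and dominates (g / s)^2 there: hence
   the deformation multiplies areas of 2-rectifiable sets by at most alpha on the
   annulus, and by beta^2 on B(x,rho).  It preserves Omega_0 and L_0 when x is in L_0
   or B(x,r) misses L_0.  Almost minimality, with beta -> 0, gives
   Theta(rho) <= Theta(r) + h(r) (r^2 - rho^2) / rho^2.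
   If moreover r <= 2 rho, then h(2s) >= h(r) for s in [rho, r], so the error is at
   most 8 (h_1(r) - h_1(rho)); chaining such steps gives the monotonicity.

   The area bound is proved without the area formula.  By Rademacher's theorem, a
   Lipschitz chart f of the plane is, up to a null set and up to countably many pieces,
   close at small scales to a linear map.  Where that map is injective, a composition
   phi o f which is infinitesimally at most a stretch of f along one direction is
   compared with f through a stretch of the plane, whose effect on H^2 is exact because
   planar H^2 is a multiple of the Lebesgue measure; where it is not, the image is
   H^2-null. *)
From HB Require Import structures.
Require Import Defs.
From mathcomp Require Import ring lra measurable_realfun.
Set Implicit Arguments.
Unset Strict Implicit.
Unset Printing Implicit Defensive.

Local Open Scope classical_set_scope.
Local Open Scope ring_scope.

(** * Euclidean norm and Hausdorff measure *)

(** Sharpness of the constant shapes the proof. A Lipschitz bound on the deformation would charge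
    the square of its largest stretch, whereas [alpha] is the product of a radial stretch
    [alpha / sqrt kappa] and a tangential one [sqrt kappa], where [sqrt kappa] is the ratio g / s.
    As this ratio varies with s, the annulus is cut into shells on which it is nearly constant. On
    all of them [alpha / kappa] is at most [Lam = alpha / beta ^+ 2], so the errors vanish when
    [eta] tends to 0 with [beta] fixed. A positive [beta] keeps the deformation Lipschitz: for
    [beta = 0], g would leave 0 at rho like a square root. In the plane of a chart f the stretched
    direction is the gradient of |f u - x|, which is therefore linearized together with f. The sets
    to be measured are arbitrary subsets of E, so the pieces are made closed: closed sets split
    every set additively for the outer measure. *)

Section Enorm.
Variables (R : realType) (n : nat).
Implicit Types x y z : 'rV[R]_n.

Lemma enorm_ge0 x : 0 <= enorm x.
Proof. exact: sqrtr_ge0. Qed.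

Lemma sqr_enorm x : enorm x ^+ 2 = \sum_(i < n) x 0 i ^+ 2.
Proof. by rewrite sqr_sqrtr// sumr_ge0// => i _; exact: sqr_ge0. Qed.

Lemma enormN x : enorm (- x) = enorm x.
Proof. by congr Num.sqrt; apply: eq_bigr => i _; rewrite mxE sqrrN. Qed.

Lemma enormC x y : enorm (x - y) = enorm (y - x).
Proof. by rewrite -opprB enormN. Qed.

Lemma enormZ a x : enorm (a *: x) = `|a| * enorm x.
Proof.
rewrite /enorm -sqrtr_sqr -sqrtrM ?sqr_ge0// mulr_sumr; congr Num.sqrt.
by apply: eq_bigr => i _; rewrite mxE exprMn.
Qed.

(** Expands the square of the norm of |x|^2 y - d x, with d the inner product, and divides by
    |x|^2. *)
Lemma Cauchy_Schwarz_rV x y :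
  \sum_(i < n) x 0 i * y 0 i <= enorm x * enorm y.
Proof.
set d := \sum_(i < n) _.
have key : d ^+ 2 <= (enorm x * enorm y) ^+ 2.
  have [x0|x0] := eqVneq (enorm x ^+ 2) 0.
    have xi i : x 0 i = 0.
      move: x0; rewrite sqr_enorm => /eqP.
      rewrite psumr_eq0; last by move=> j _; exact: sqr_ge0.
      by move=> /allP /(_ i); rewrite mem_index_enum sqrf_eq0 => /(_ isT)/eqP.
    by rewrite /d big1 ?expr0n ?sqr_ge0// => i _; rewrite xi mul0r.
  have X0 : 0 < enorm x ^+ 2 by rewrite lt_def x0 sqr_ge0.
  have : 0 <= \sum_(i < n) (y 0 i * enorm x ^+ 2 - d * x 0 i) ^+ 2.
    by apply: sumr_ge0 => i _; exact: sqr_ge0.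
  have -> : \sum_(i < n) (y 0 i * enorm x ^+ 2 - d * x 0 i) ^+ 2 =
      enorm x ^+ 2 * (enorm x ^+ 2 * enorm y ^+ 2 - d ^+ 2).
    under eq_bigr => i _.
      rewrite (_ : _ ^+ 2 = (enorm x ^+ 2) ^+ 2 * (y 0 i ^+ 2) -
        (2 * d * enorm x ^+ 2) * (x 0 i * y 0 i) + d ^+ 2 * (x 0 i ^+ 2));
      last by ring.
    over.
    rewrite big_split/= sumrB -!mulr_sumr -!sqr_enorm -/d; ring.
  by rewrite pmulr_rge0// subr_ge0 exprMn.
apply: le_trans (ler_norm _) _.
rewrite -(ler_pXn2r (n := 2))// ?nnegrE ?mulr_ge0 ?enorm_ge0//.
by rewrite -normrX ger0_norm ?sqr_ge0.
Qed.

Lemma sqr_enormB x y : enorm (x - y) ^+ 2 =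
  enorm x ^+ 2 + enorm y ^+ 2 - 2 * \sum_(i < n) x 0 i * y 0 i.
Proof.
rewrite !sqr_enorm mulr_sumr -big_split/= -sumrB; apply: eq_bigr => i _.
by rewrite !mxE; ring.
Qed.

Lemma ler_enormD x y : enorm (x + y) <= enorm x + enorm y.
Proof.
rewrite -(ler_pXn2r (n := 2))// ?nnegrE ?addr_ge0 ?enorm_ge0//.
rewrite -[y in enorm (_ + y)]opprK sqr_enormB enormN.
have := Cauchy_Schwarz_rV x y.
have -> : \sum_(i < n) x 0 i * (- y) 0 i = - \sum_(i < n) x 0 i * y 0 i.
  by rewrite -sumrN; apply: eq_bigr => i _; rewrite mxE mulrN.
have := enorm_ge0 x; have := enorm_ge0 y; nra.
Qed.

Lemma enorm_triangle y x z : enorm (x - z) <= enorm (x - y) + enorm (y - z).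
Proof. by have := ler_enormD (x - y) (y - z); rewrite addrA subrK. Qed.

Lemma ler_dist_enorm x y : `|enorm x - enorm y| <= enorm (x - y).
Proof.
rewrite ler_norml; apply/andP; split.
  have := ler_enormD (y - x) x; rewrite subrK enormC; lra.
by have := ler_enormD (x - y) y; rewrite subrK; lra.
Qed.

Lemma ler_coord_enorm x i : `|x 0 i| <= enorm x.
Proof.
rewrite -sqrtr_sqr ler_wsqrtr// (bigD1 i)//= lerDl.
by rewrite sumr_ge0// => j _; exact: sqr_ge0.
Qed.

Lemma enorm_le_sum x : enorm x <= \sum_(i < n) `|x 0 i|.
Proof.
rewrite -(ler_pXn2r (n := 2))// ?nnegrE ?sumr_ge0 ?enorm_ge0//.
rewrite sqr_enorm.
suff [] : \sum_(i < n) x 0 i ^+ 2 <= (\sum_(i < n) `|x 0 i|) ^+ 2 /\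
  0 <= \sum_(i < n) `|x 0 i| by [].
elim/big_ind2 : _ => [|a b c d [ab b0] [cd d0]|i _].
- by rewrite expr0n.
- by split; [nra|exact: addr_ge0].
- by rewrite -normrX ger0_norm ?sqr_ge0.
Qed.

End Enorm.

Section EnormMx.
Variables (R : realType) (n : nat).
Implicit Types x y : 'rV[R]_n.+1.

Lemma norm_le_enorm x : `|x| <= enorm x.
Proof.
rewrite /Num.norm/= mx_normrE.
by apply: bigmax_le => [|[i j] _]; rewrite ?enorm_ge0// ord1 ler_coord_enorm.
Qed.

Lemma enorm_le_norm x : enorm x <= n.+1%:R * `|x|.
Proof.
apply: le_trans (enorm_le_sum x) _.
apply: (@le_trans _ _ (\sum_(i < n.+1) `|x|)).
  apply: ler_sum => i _; rewrite [leRHS]/Num.norm/= mx_normrE.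
  by rewrite (le_bigmax _ (fun i => `|x i.1 i.2|) (0, i)).
by rewrite sumr_const card_ord mulr_natl.
Qed.

End EnormMx.

Section Ediameter.
Variables (R : realType) (n : nat).
Implicit Types (A B : set 'rV[R]_n) (d : R).
Local Open Scope ereal_scope.

Lemma ediameter_ge0 A : 0 <= ediameter A.
Proof. by apply: ereal_sup_ubound; left. Qed.

Lemma ediameter_le A (d : \bar R) : 0 <= d ->
  (forall x y, A x -> A y -> (enorm (x - y))%:E <= d) -> ediameter A <= d.
Proof.
by move=> d0 Ad; apply: ge_ereal_sup => _ [->//|[[x y]/= [Ax Ay] <-]]; exact: Ad.
Qed.

Lemma le_ediameter_pair A x y : A x -> A y -> (enorm (x - y))%:E <= ediameter A.
Proof. by move=> Ax Ay; apply: ereal_sup_ubound; right; exists (x, y). Qed.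

Lemma le_ediameter A B : A `<=` B -> ediameter A <= ediameter B.
Proof.
move=> AB; apply: ediameter_le; first exact: ediameter_ge0.
by move=> x y /AB Bx /AB By; exact: le_ediameter_pair.
Qed.

Lemma ediameter0 : ediameter (set0 : set 'rV[R]_n) = 0.
Proof.
by apply/eqP; rewrite eq_le ediameter_ge0 andbT; apply: ediameter_le.
Qed.

End Ediameter.

Section Hausdorff_outer.
Variables (R : realType) (n : nat).
Implicit Types (A B : set 'rV[R]_n) (U : nat -> set 'rV[R]_n) (d : R).
Local Open Scope ereal_scope.
Local Notation H2 := (@hausdorff2 R n).

Lemma pi4_ge0 : (0 <= pi / 4 :> R)%R.
Proof. by rewrite divr_ge0// pi_ge0. Qed.

Let cost_ge0 A : 0 <= (pi / 4)%:E * ediameter A ^+ 2.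
Proof. by rewrite mule_ge0 ?lee_fin ?pi4_ge0// expe_ge0// ediameter_ge0. Qed.

Lemma hausdorff2_delta_ge0 d A : 0 <= hausdorff2_delta d A.
Proof.
by apply: le_ereal_inf_tmp => _ [U _ <-]; apply: nneseries_ge0 => k _ _.
Qed.

Lemma le_hausdorff2_delta d A B : A `<=` B ->
  hausdorff2_delta d A <= hausdorff2_delta d B.
Proof.
move=> AB; apply: le_ereal_inf_tmp => _ [U [BU Ud] <-].
by apply: ereal_inf_lbound; exists U => //; split => //; exact: subset_trans BU.
Qed.

Lemma hausdorff2_delta_anti d d' A : (d <= d')%R ->
  hausdorff2_delta d' A <= hausdorff2_delta d A.
Proof.
move=> dd'; apply: le_ereal_inf_tmp => _ [U [AU Ud] <-].
apply: ereal_inf_lbound; exists U => //; split => // k.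
by apply: le_trans (Ud k) _; rewrite lee_fin.
Qed.

Lemma hausdorff2_delta_le d A : (0 < d)%R -> hausdorff2_delta d A <= H2 A.
Proof. by move=> d0; apply: ereal_sup_ubound; exists d. Qed.

Lemma hausdorff2_leP A (z : \bar R) :
  (forall d, (0 < d)%R -> hausdorff2_delta d A <= z) -> H2 A <= z.
Proof. by move=> h; apply: ge_ereal_sup => _ [d d0 <-]; exact: h. Qed.

Lemma hausdorff2_ge0 A : 0 <= H2 A.
Proof.
by apply: le_trans (hausdorff2_delta_ge0 1 A) _; exact: hausdorff2_delta_le.
Qed.

Lemma hausdorff20 : H2 set0 = 0.
Proof.
apply/eqP; rewrite eq_le hausdorff2_ge0 andbT; apply: hausdorff2_leP => d d0.
apply: ereal_inf_lbound; exists (fun=> set0).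
  by split => // k; rewrite ediameter0 lee_fin ltW.
by apply: eseries0 => k _ _; rewrite ediameter0 expe2 !mule0.
Qed.

Lemma le_hausdorff2 A B : A `<=` B -> H2 A <= H2 B.
Proof.
move=> AB; apply: hausdorff2_leP => d d0.
by apply: le_trans (hausdorff2_delta_le _ d0); exact: le_hausdorff2_delta.
Qed.

(** Covers of the [A k] within [e / 2 ^ k.+1] of the infimum are merged into one sequence by a
    bijection of nat with the pairs; the cost of the merged cover is the iterated sum. *)
Lemma hausdorff2_delta_subadditive d : sigma_subadditive (@hausdorff2_delta R n d).
Proof.
move=> A; have [[i ioo]|] := pselect (exists i, hausdorff2_delta d (A i) = +oo).
  rewrite (eseries_pinfty _ _ ioo) ?leey// => k _.
  by rewrite -ltNye (lt_le_trans _ (hausdorff2_delta_ge0 _ _)).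
rewrite -forallNE => Aoo.
apply/lee_addgt0Pr => e e0.
rewrite (le_trans _ (epsilon_trick xpredT _ _))//; last 2 first.
- by move=> k; exact: hausdorff2_delta_ge0.
- exact: ltW.
have [G PG] : {G : nat -> nat -> set 'rV[R]_n & forall k,
    [/\ A k `<=` \bigcup_i G k i, forall i, ediameter (G k i) <= d%:E &
    \sum_(0 <= i <oo) (pi / 4)%:E * ediameter (G k i) ^+ 2 <=
    hausdorff2_delta d (A k) + (e / (2 ^ k.+1)%:R)%:E]}.
  apply: (@choice _ _ (fun k (G : nat -> set 'rV[R]_n) => [/\ A k `<=` \bigcup_i G i, forall i, ediameter (G i) <= d%:E &
    \sum_(0 <= i <oo) (pi / 4)%:E * ediameter (G i) ^+ 2 <=
    hausdorff2_delta d (A k) + (e / (2 ^ k.+1)%:R)%:E])) => k.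
  have en1 : (0 < e / (2 ^ k.+1)%:R)%R by rewrite divr_gt0// ltr0n expn_gt0.
  have fin : hausdorff2_delta d (A k) \is a fin_num.
    by rewrite ge0_fin_numE ?hausdorff2_delta_ge0// ltey; exact/eqP/Aoo.
  have [_ [U [AU Ud] <-] lt] := lb_ereal_inf_adherent en1 fin.
  by exists U; split => //; exact: ltW.
pose c (p : nat * nat) := (pi / 4)%:E * ediameter (G p.1 p.2) ^+ 2.
have c_ge0 p : 0 <= c p by exact: cost_ge0.
apply: (@le_trans _ _ (\esum_(p in setT) c p)).
  have /card_esym/ppcard_eqP[f] := card_nat2.
  apply: ereal_inf_lbound; exists (uncurry G \o f).
    split => [x [k _ Akx]|i]; last first.
      by rewrite /= /uncurry; case: (f i) => a b /=; have [_ + _] := PG a; exact.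
    have [sub _ _] := PG k; have [j _ Gx] := sub _ Akx.
    by exists (f^-1%FUN (k, j)) => //=; rewrite invK ?inE.
  rewrite (reindex_esum setT setT f)// nneseries_esumT//.
  by apply: eq_esum => i _ /=; rewrite /c /uncurry; case: (f i).
rewrite (_ : [set: nat * nat] = setT `*`` (fun=> setT)); last first.
  by apply/seteqP; split.
rewrite -(@esum_esum _ _ _ _ _ (fun i j => c (i, j)))//.
rewrite nneseries_esumT; last first.
  move=> k; rewrite adde_ge0 ?hausdorff2_delta_ge0// lee_fin.
  by rewrite divr_ge0// ltW.
apply: le_esum => k _.
by have [_ _] := PG k; rewrite nneseries_esumT.
Qed.

Lemma hausdorff2_sigma_subadditive : sigma_subadditive H2.
Proof.
move=> A; apply: hausdorff2_leP => d d0.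
apply: le_trans (hausdorff2_delta_subadditive d A) _.
apply: lee_nneseries => [k _ _|k _]; first exact: hausdorff2_delta_ge0.
exact: hausdorff2_delta_le.
Qed.

HB.instance Definition _ := isOuterMeasure.Build R 'rV[R]_n H2
  hausdorff20 hausdorff2_ge0 le_hausdorff2 hausdorff2_sigma_subadditive.

End Hausdorff_outer.

Section Hausdorff_comparison.
Variables (R : realType) (T : Type) (n m : nat).
Variables (p : T -> 'rV[R]_n) (q : T -> 'rV[R]_m).
Local Open Scope ereal_scope.

(** A cover of the image by [q] is pulled back to [K] and pushed forward by [p], which multiplies
    diameters by at most [C]. With two maps on a common domain, the Lipschitz map from the one image
    to the other never has to be named. *)
Lemma hausdorff2_comparison (K : set T) (C : R) : (0 < C)%R ->
  (forall u v, K u -> K v -> enorm (p u - p v) <= C * enorm (q u - q v))%R ->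
  hausdorff2 (p @` K) <= (C ^+ 2)%:E * hausdorff2 (q @` K).
Proof.
move=> C0 pq; apply: hausdorff2_leP => d d0.
apply: (@le_trans _ _ ((C ^+ 2)%:E * hausdorff2_delta (C^-1 * d) (q @` K))); last first.
  by rewrite lee_wpmul2l ?lee_fin ?sqr_ge0// hausdorff2_delta_le// mulr_gt0 ?invr_gt0.
rewrite -lee_pdivrMl ?exprn_gt0//.
apply: le_ereal_inf_tmp => _ [U [KU Ud] <-].
rewrite lee_pdivrMl ?exprn_gt0//.
pose V k := p @` (K `&` q @^-1` U k).
have dV k : ediameter (V k) <= C%:E * ediameter (U k).
  apply: ediameter_le; first by rewrite mule_ge0 ?ediameter_ge0 ?lee_fin ?ltW.
  move=> _ _ [u [Ku Uu] <-] [v [Kv Uv] <-].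
  apply: (@le_trans _ _ (C * enorm (q u - q v))%:E); first by rewrite lee_fin pq.
  rewrite EFinM; apply: lee_wpmul2l; first by rewrite lee_fin ltW.
  by apply: le_ediameter_pair => //; exists u.
apply: (@le_trans _ _ (\sum_(0 <= k <oo) (pi / 4)%:E * ediameter (V k) ^+ 2)).
  apply: ereal_inf_lbound; exists V => //; split.
    by move=> _ [u Ku <-]; have [k _ Uk] := KU _ (imageP q Ku); exists k => //; exists u.
  move=> k; apply: le_trans (dV k) _.
  by rewrite -lee_pdivlMl// -EFinM Ud.
rewrite -nneseriesZl; last first.
  by move=> k _; rewrite mule_ge0 ?lee_fin ?pi4_ge0// expe_ge0// ediameter_ge0.
apply: lee_nneseries => k _.
  by rewrite mule_ge0 ?lee_fin ?pi4_ge0// expe_ge0// ediameter_ge0.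
rewrite [leRHS]muleCA; apply: lee_wpmul2l; first by rewrite lee_fin pi4_ge0.
rewrite !expe2 expr2 EFinM.
rewrite muleACA lee_pmul ?ediameter_ge0//.
Qed.

End Hausdorff_comparison.

Section Enorm_topology.
Variables (R : realType) (n : nat).
Implicit Types (x y : 'rV[R]_n.+1) (A : set 'rV[R]_n.+1).

Lemma nbhs_enormP x A : nbhs x A <->
  exists2 e : R, 0 < e & forall y, enorm (x - y) < e -> A y.
Proof.
split=> [/nbhs_ballP[e /= e0 eA]|[e e0 eA]].
  exists e => // y xy; apply: eA; rewrite -ball_normE /=.
  by apply: le_lt_trans xy; exact: norm_le_enorm.
apply/nbhs_ballP; exists (e / n.+1%:R) => /=; first by rewrite divr_gt0.
move=> y; rewrite -ball_normE /=; rewrite ltr_pdivlMr// mulrC => xy; apply: eA.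
by apply: le_lt_trans xy; exact: enorm_le_norm.
Qed.

Lemma closure_enormP A x : closure A x <->
  forall e, 0 < e -> exists2 y, A y & enorm (x - y) < e.
Proof.
split=> [clA e e0|h B /nbhs_enormP[e e0 eB]].
  have /clA[y [Ay /= xy]] : nbhs x [set y | enorm (x - y) < e].
    by apply/nbhs_enormP; exists e.
  by exists y.
by have [y Ay xy] := h _ e0; exists y; split => //; exact: eB.
Qed.

Lemma ediameter_closure A : (ediameter (closure A) <= ediameter A)%E.
Proof.
apply: ediameter_le => [|x y clx cly]; first exact: ediameter_ge0.
apply/lee_addgt0Pr => e e0; have e2 : 0 < e / 2 by rewrite divr_gt0.
have [x' Ax' xx'] := (closure_enormP A x).1 clx (e / 2) e2.
have [y' Ay' yy'] := (closure_enormP A y).1 cly (e / 2) e2.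
apply: (@le_trans _ _ ((enorm (x' - y'))%:E + e%:E)%E); last first.
  by rewrite leeD2r// le_ediameter_pair.
rewrite -EFinD lee_fin.
have := enorm_triangle x' x y; have := enorm_triangle y' x' y.
rewrite [enorm (y' - y)]enormC; lra.
Qed.

End Enorm_topology.

(** Serves the measurability of closed sets, where layers whose indices have the same parity are
    separated from one another. *)
Lemma sum_even_odd (R : realType) (f : nat -> \bar R) N :
  (\sum_(0 <= j < N.*2) f j =
   \sum_(i < N) f (i.*2 + 0)%N + \sum_(i < N) f (i.*2 + 1)%N)%E.
Proof.
elim: N => [|N IH]; first by rewrite !big_ord0 big_nil adde0.
rewrite doubleS !big_nat_recr//= IH !big_ord_recr/= addn0 addn1 -!addeA.
by congr (_ + _)%E; rewrite addeCA.
Qed.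

(** * Caratheodory measurability of closed sets and Borel hulls *)

Section Caratheodory.
Variables (R : realType) (n : nat).
Implicit Types (A B F X : set 'rV[R]_n.+1).
Local Open Scope ereal_scope.
Local Notation H2 := (@hausdorff2 R n.+1).

(** A set of diameter at most [d < s] cannot meet both [A] and [B], so a cover of the union splits
    into covers of each. *)
Lemma hausdorff2_delta_separated A B (s d : R) : (d < s)%R ->
  (forall x y, A x -> B y -> s <= enorm (x - y))%R ->
  hausdorff2_delta d A + hausdorff2_delta d B <= hausdorff2_delta d (A `|` B).
Proof.
move=> ds sAB; apply: le_ereal_inf_tmp => _ [U [ABU Ud] <-].
pose meets (S : set 'rV[R]_n.+1) k := U k `&` S !=set0.
(* Cover sets that miss [S] become empty, which keeps the indexing and costs 0. *)
pose V S k := if pselect (meets S k) then U k else set0.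
have VS S k : V S k `<=` U k by rewrite /V; case: pselect => [?|?]; [exact: subset_refl|exact: sub0set].
have cov S : S `<=` A `|` B -> hausdorff2_delta d S <=
    \sum_(0 <= k <oo) (pi / 4)%:E * ediameter (V S k) ^+ 2.
  move=> SAB; apply: ereal_inf_lbound; exists (V S) => //; split.
    move=> x Sx; have [k _ Uk] := ABU _ (SAB _ Sx); exists k => //.
    by rewrite /V; case: pselect => // -[]; exists x.
  by move=> k; apply: le_trans (Ud k); exact: le_ediameter.
have c0 (S : set 'rV[R]_n.+1) : 0 <= (pi / 4)%:E * ediameter S ^+ 2.
  by rewrite mule_ge0 ?lee_fin ?pi4_ge0// expe_ge0// ediameter_ge0.
apply: le_trans (leeD (cov A (@subsetUl _ A B)) (cov B (@subsetUr _ A B))) _.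
rewrite -nneseriesD//.
apply: lee_nneseries => [k _ _|k _]; first by rewrite adde_ge0.
have z : (pi / 4)%:E * ediameter (set0 : set 'rV[R]_n.+1) ^+ 2 = 0.
  by rewrite ediameter0 expe2 !mule0.
rewrite /V; case: pselect => [[x [Ux Ax]]|?]; last first.
  by rewrite z add0e; case: pselect => [?|?] //; rewrite z.
case: pselect => [[y [Uy By]]|?]; last by rewrite z adde0.
exfalso; have := Ud k; apply/negP; rewrite -ltNge.
apply: lt_le_trans (le_ediameter_pair Ux Uy).
by rewrite lte_fin (lt_le_trans ds)// sAB.
Qed.

Lemma hausdorff2_separated A B (s : R) : (0 < s)%R ->
  (forall x y, A x -> B y -> s <= enorm (x - y))%R ->
  H2 A + H2 B <= H2 (A `|` B).
Proof.
move=> s0 sAB.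
have [->|] := eqVneq (H2 (A `|` B)) +oo; first by rewrite leey.
rewrite -ltey => fin.
(* Two independent scales, so that the two suprema can be taken one after the other. *)
have key d d' : (0 < d)%R -> (0 < d')%R ->
    hausdorff2_delta d A + hausdorff2_delta d' B <= H2 (A `|` B).
  move=> d0 d'0; pose m : R := (Num.min (Num.min d d') (s / 2))%R.
  have m0 : (0 < m)%R by rewrite !lt_min d0 d'0 divr_gt0.
  have ms : (m < s)%R by rewrite /m !gt_min; apply/orP; right; lra.
  apply: le_trans (hausdorff2_delta_le _ m0).
  apply: le_trans (hausdorff2_delta_separated ms sAB).
  by apply: leeD; apply: hausdorff2_delta_anti; rewrite /m !ge_min lexx ?orbT.
have finB d : (0 < d)%R -> hausdorff2_delta d B \is a fin_num.
  move=> d0; rewrite ge0_fin_numE ?hausdorff2_delta_ge0//.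
  apply: le_lt_trans fin; apply: le_trans (hausdorff2_delta_le _ d0) _.
  by apply: le_hausdorff2 => x; right.
have keyA d : (0 < d)%R -> H2 A + hausdorff2_delta d B <= H2 (A `|` B).
  move=> d0; rewrite -leeBrDr ?finB//; apply: hausdorff2_leP => d' d'0.
  by rewrite leeBrDr ?finB//; exact: key.
have finA : H2 A \is a fin_num.
  rewrite ge0_fin_numE ?hausdorff2_ge0//; apply: le_lt_trans fin.
  by apply: le_hausdorff2 => x; left.
by rewrite -leeBrDl//; apply: hausdorff2_leP => d d0; rewrite leeBrDl// keyA.
Qed.

(** Caratheodory's criterion. [A j] is the part of [X] at distance at least 1 / (j + 1) from [F],
    and [D j] is the layer between [A j] and [A j.+1]. Layers of equal parity are separated, so the
    measures of all layers have a finite sum. The part of [X] off [F] exceeds [A j] by a tail of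
    this sum, and [A j] is separated from the part of [X] in [F]. *)
Lemma closed_caratheodory F : closed F -> (H2).-caratheodory F.
Proof.
move=> clF; apply: le_caratheodory_measurable => X.
change (H2 (X `&` F) + H2 (X `&` ~` F) <= H2 X).
have [->|] := eqVneq (H2 X) +oo; first by rewrite leey.
rewrite -ltey => fin.
pose A j := [set x | X x /\ forall y, F y -> (j.+1%:R^-1 <= enorm (x - y))%R].
have ndA i j : (i <= j)%N -> A i `<=` A j.
  move=> ij x [Xx h]; split=> // y Fy; apply: le_trans (h _ Fy).
  by rewrite lef_pV2 ?posrE// ler_nat ltnS.
have sepA i Y : Y `<=` ~` A i.+1 -> Y `<=` X -> H2 (A i) + H2 Y <= H2 (A i `|` Y).
  move=> YA YX; apply: (@hausdorff2_separated _ _ (i.+1%:R^-1 - i.+2%:R^-1)).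
    by rewrite subr_gt0 ltf_pV2 ?posrE// ltr_nat.
  move=> x y [Xx hx] Yy.
  have [z [Fz yz]] : exists z, F z /\ (enorm (y - z) < i.+2%:R^-1)%R.
    apply: contrapT => nz; apply: (YA _ Yy); split; first exact: YX.
    by move=> z Fz; rewrite leNgt; apply/negP => yz; apply: nz; exists z.
  rewrite lerBlDr (le_trans (hx _ Fz))// (le_trans (enorm_triangle y x z))//.
  by rewrite lerD2l ltW.
pose D j := A j.+1 `\` A j.
have DX j : D j `<=` X by move=> x [[]].
(* The last layer avoids [A (N.*2 + e)], hence is separated from the set one index below, which
   contains the earlier layers. The predecessor can truncate only when the sum is empty. *)
have partial e N : \sum_(i < N) H2 (D (i.*2 + e)%N) <= H2 (A (N.*2 + e).-1%N).
  elim: N => [|N IH]; first by rewrite big_ord0 hausdorff2_ge0.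
  rewrite big_ord_recr/=.
  case: N IH => [_|N IH].
    rewrite big_ord0 add0e double0 add0n; apply: le_hausdorff2.
    by move=> x [Ax _]; exact: Ax.
  apply: le_trans (leeD IH (lexx _)) _; rewrite !doubleS !addSn/=.
  apply: le_trans (sepA _ _ _ (@DX _)) _; first by move=> x [].
  by apply: le_hausdorff2 => x [Ax|[Ax _]] //; apply: ndA Ax; rewrite ltnW.
have sumD N : \sum_(0 <= j < N) H2 (D j) <= H2 X + H2 X.
  apply: (@le_trans _ _ (\sum_(0 <= j < N.*2) H2 (D j))).
    apply: lee_sum_nneg_natr => //; last by rewrite -addnn leq_addr.
    by move=> *; exact: hausdorff2_ge0.
  rewrite (sum_even_odd (fun j => H2 (D j))).
  by apply: leeD; apply: le_trans (partial _ _) _; apply: le_hausdorff2 => x [].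
have serD : \sum_(0 <= j <oo) H2 (D j) < +oo.
  apply: (@le_lt_trans _ _ (H2 X + H2 X)); last by rewrite lte_add_pinfty.
  apply: lime_le; first by apply: is_cvg_nneseries => *; exact: hausdorff2_ge0.
  by apply: nearW => N; exact: sumD.
have tail := nneseries_tail_cvg serD (fun j _ => hausdorff2_ge0 (D j)).
apply/lee_addgt0Pr => e e0.
have [j je] : exists j, \sum_(j <= i <oo) H2 (D i) <= e%:E.
  apply: contrapT => /forallNP nj.
  have : e%:E <= 0 by apply: cvge_ge tail; apply: nearW => j; rewrite leNgt; apply/negP => /ltW /nj.
  by rewrite lee_fin leNgt e0.
have Xsub : X `&` ~` F `<=` A j `|` \bigcup_(i in ~` `I_j) D i.
  move=> x [Xx nFx].
  have [N HN] : exists N, A N x.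
    have /nbhs_enormP[r r0 rF] : nbhs x (~` F).
      by apply: open_nbhs_nbhs; split => //; exact: closed_openC.
    exists (Num.truncn (r^-1)%R); split=> // y Fy.
    rewrite leNgt; apply/negP => xy; apply: (rF y) => //.
    apply: lt_trans xy _; rewrite invf_plt ?posrE//.
    exact: truncnS_gt.
  have [jN|Nj] := leqP j N; last by left; apply: ndA HN; exact: ltnW.
  move: jN HN; elim: N => [|N IH].
    by rewrite leqn0 => /eqP ->; left.
  rewrite leq_eqVlt => /predU1P[->|]; first by left.
  rewrite ltnS => jN HN; have [/(IH jN)//|nA] := pselect (A N x).
  by right; exists N => //=; apply/negP; rewrite -leqNgt.
apply: (@le_trans _ _ (H2 (X `&` F) + (H2 (A j) + e%:E))).
  rewrite leeD2l//; apply: le_trans (le_hausdorff2 Xsub) _.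
  apply: le_trans (outer_measureU2 _ _ _) _; rewrite leeD2l//.
  exact: le_trans (outer_measure_sigma_subadditive_tail _ _ _) je.
rewrite addeA leeD2r//.
apply: le_trans (hausdorff2_separated (s := j.+1%:R^-1) _ _) _ => //.
  by move=> x y [_ Fx] [_]; rewrite enormC; exact.
by apply: le_hausdorff2 => x [[]|[]].
Qed.

(** Takes covers that are optimal up to 1 / (i + 1) at scale 1 / (i + 1), and closes them, which
    does not enlarge diameters; each of them covers the intersection. Such hulls carry identities
    proved for Borel sets over to arbitrary sets, and the explicit closed family makes preimages of
    the hull visibly Borel. *)
Lemma hausdorff2_hull (K : set 'rV[R]_n.+1) :
  exists C : nat -> nat -> set 'rV[R]_n.+1,
    [/\ forall i k, closed (C i k), K `<=` \bigcap_i \bigcup_k C i k &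
      H2 (\bigcap_i \bigcup_k C i k) = H2 K].
Proof.
suff [C [clC KC CK]] : exists C : nat -> nat -> set 'rV[R]_n.+1,
    [/\ forall i k, closed (C i k), K `<=` \bigcap_i \bigcup_k C i k &
      H2 (\bigcap_i \bigcup_k C i k) <= H2 K].
  exists C; split => //; apply/eqP; rewrite eq_le CK/=.
  exact: le_hausdorff2.
have [Koo|] := eqVneq (H2 K) +oo.
  exists (fun _ _ => setT); split=> [i k| |].
  - exact: closedT.
  - by move=> x _ i _; exists 0%N.
  - by rewrite Koo leey.
rewrite -ltey => fin.
have [U PU] : {U : nat -> nat -> set 'rV[R]_n.+1 & forall i,
    [/\ K `<=` \bigcup_k U i k, forall k, ediameter (U i k) <= i.+1%:R^-1%:E &
    \sum_(0 <= k <oo) (pi / 4)%:E * ediameter (U i k) ^+ 2 <=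
    H2 K + i.+1%:R^-1%:E]}.
  apply: (@choice _ _ (fun i (U : nat -> set 'rV[R]_n.+1) => [/\ K `<=` \bigcup_k U k, forall k, ediameter (U k) <= i.+1%:R^-1%:E &
    \sum_(0 <= k <oo) (pi / 4)%:E * ediameter (U k) ^+ 2 <=
    H2 K + i.+1%:R^-1%:E])) => i.
  have i0 : (0 < i.+1%:R^-1 :> R)%R by rewrite invr_gt0.
  have fini : hausdorff2_delta i.+1%:R^-1 K \is a fin_num.
    rewrite ge0_fin_numE ?hausdorff2_delta_ge0//.
    exact: le_lt_trans (hausdorff2_delta_le _ i0) fin.
  have [_ [U [KU Ud] <-] lt] := lb_ereal_inf_adherent i0 fini.
  exists U; split => //; apply: le_trans (ltW lt) _.
  by rewrite leeD2r// hausdorff2_delta_le.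
exists (fun i k => closure (U i k)); split.
- by move=> i k; exact: closed_closure.
- move=> x Kx i _; have [sub _ _] := PU i; have [k _ Uk] := sub _ Kx.
  by exists k => //; exact: subset_closure.
apply: hausdorff2_leP => d d0; apply/lee_addgt0Pr => e e0.
pose i := Num.truncn ((Num.min d e)^-1)%R.
have m0 : (0 < (Num.min d e : R))%R by rewrite lt_min d0.
have im : (i.+1%:R^-1 < Num.min d e)%R.
  by rewrite invf_plt ?posrE//; exact: truncnS_gt.
have [/andP[id ie]] : (i.+1%:R^-1 < d)%R && (i.+1%:R^-1 < e)%R by rewrite -lt_min.
have [_ Ud Uc] := PU i.
apply: (@le_trans _ _ (H2 K + i.+1%:R^-1%:E)); last by rewrite leeD2l// lee_fin ltW.
apply: le_trans Uc.
apply: (@le_trans _ _ (\sum_(0 <= k <oo) (pi / 4)%:E * ediameter (closure (U i k)) ^+ 2)).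
  apply: ereal_inf_lbound; exists (fun k => closure (U i k)) => //; split.
    by move=> x /(_ i Logic.I).
  move=> k; apply: le_trans (ediameter_closure _) _; apply: le_trans (Ud k) _.
  by rewrite lee_fin ltW.
apply: lee_nneseries => k _.
  by rewrite mule_ge0 ?lee_fin ?pi4_ge0// expe_ge0// ediameter_ge0.
apply: lee_wpmul2l; first by rewrite lee_fin pi4_ge0.
by rewrite !expe2 lee_pmul ?ediameter_ge0 ?ediameter_closure.
Qed.

End Caratheodory.

(** * Planar Hausdorff measure *)

Section Boxes.
Variable R : realType.
Local Notation plane := (R * R)%type.

(** Half-open, so that adjacent boxes are disjoint and intersections of boxes are boxes. *)
Definition box (p : (R * R) * (R * R)) : set plane :=
  `]p.1.1, p.1.2] `*` `]p.2.1, p.2.2].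

Definition boxes : set (set plane) := range box.

Lemma box_measurable p : measurable (box p).
Proof. by apply: measurableX; exact: measurable_itv. Qed.

Lemma boxes_setI_closed : setI_closed boxes.
Proof.
move=> _ _ [p _ <-] [q _ <-].
exists ((Num.max p.1.1 q.1.1, Num.min p.1.2 q.1.2),
        (Num.max p.2.1 q.2.1, Num.min p.2.2 q.2.2)) => //.
apply/seteqP; split => [[x y]|[x y]]; rewrite /box/= !in_itv/= !gt_max !le_min.
  by move=> [] /andP[/andP[-> ->] /andP[-> ->]] /andP[/andP[-> ->] /andP[-> ->]].
by move=> [[] /andP[-> ->] /andP[-> ->] [] /andP[-> ->] /andP[-> ->]].
Qed.

Lemma bigcup_boxes : \bigcup_k box ((- k%:R, k%:R), (- k%:R, k%:R)) = setT.
Proof.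
apply/seteqP; split => // -[x y] _.
exists (maxn (Num.bound x) (Num.bound y)) => //.
have h z N : (Num.bound z <= N)%N -> (- N%:R < z) && (z <= N%:R :> R).
  move=> zN; have zN' : (Num.bound z)%:R <= N%:R :> R by rewrite ler_nat.
  by rewrite ltrNl (lt_le_trans (unstable.ltrNbound _) zN') (ltW (lt_le_trans (unstable.ltr_bound _) zN')).
by split; rewrite /= in_itv/= h// ?leq_maxl ?leq_maxr.
Qed.

Lemma measurable_boxes : @measurable _ plane = <<s boxes >>.
Proof.
apply/seteqP; split; last first.
  apply: smallest_sub; first exact: sigma_algebra_measurable.
  by move=> _ [p _ <-]; exact: box_measurable.
rewrite measurable_prod_measurableType.
apply: smallest_sub; first exact: smallest_sigma_algebra.
move=> _ [A mA [B mB <-]].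
have cover (x : plane) : exists k : nat, [/\ - k%:R < x.1, x.1 <= k%:R, - k%:R < x.2 & x.2 <= k%:R].
  have : (\bigcup_k box ((- k%:R, k%:R), (- k%:R, k%:R))) x by rewrite bigcup_boxes.
  by case=> k _ [/=]; rewrite !in_itv/= => /andP[? ?] /andP[? ?]; exists k.
have m1 : measurable_fun setT (fst : g_sigma_algebraType boxes -> R).
  apply: (@measurability _ _ _ _ _ _ (@ocitv R)) => //.
  move=> _ [_ [[a b] _ <-] <-]; rewrite setTI.
  rewrite (_ : _ @^-1` _ = \bigcup_k box ((a, b), (- k%:R, k%:R))).
    by apply: bigcupT_measurable => k; apply: sub_sigma_algebra; exists ((a, b), (- k%:R, k%:R)).
  apply/seteqP; split => [x /= xab|x [k _ []//]].
  by have [k [_ _ k1 k2]] := cover x; exists k => //; split => //=; rewrite in_itv/= k1.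
have m2 : measurable_fun setT (snd : g_sigma_algebraType boxes -> R).
  apply: (@measurability _ _ _ _ _ _ (@ocitv R)) => //.
  move=> _ [_ [[a b] _ <-] <-]; rewrite setTI.
  rewrite (_ : _ @^-1` _ = \bigcup_k box ((- k%:R, k%:R), (a, b))).
    by apply: bigcupT_measurable => k; apply: sub_sigma_algebra; exists ((- k%:R, k%:R), (a, b)).
  apply/seteqP; split => [x /= xab|x [k _ []//]].
  by have [k [k1 k2 _ _]] := cover x; exists k => //; split => //=; rewrite in_itv/= k1.
have -> : A `*` B = (fst @^-1` A) `&` (snd @^-1` B) by [].
have := m1 measurableT A mA; have := m2 measurableT B mB; rewrite !setTI => mB' mA'.
exact: (@measurableI _ (g_sigma_algebraType boxes)).
Qed.

Lemma open_measurable_plane (U : set plane) : open U -> measurable U.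
Proof.
move=> oU.
pose c (q : rat) : R := ratr q.
pose V (a b c' d : rat) : set plane :=
  if pselect (box ((c a, c b), (c c', c d)) `<=` U) then box ((c a, c b), (c c', c d)) else set0.
have -> : U = \bigcup_a \bigcup_b \bigcup_c' \bigcup_d V a b c' d.
  apply/seteqP; split; last first.
    move=> x [a _ [b _ [c' _ [d _]]]]; rewrite /V; case: pselect => //= h; exact: h.
  move=> [x y] Uxy.
  have /nbhs_ballP[e /= e0 eU] : nbhs (x, y) U by apply: open_nbhs_nbhs; split.
  have ratin (u v : R) : u < v -> exists q : rat, u < c q < v.
    by move=> uv; have [q /= ] := rat_in_itvoo uv; rewrite in_itv/= => ?; exists q.
  have [a /andP[a1 a2]] := ratin (x - e) x ltac:(lra).
  have [b /andP[b1 b2]] := ratin x (x + e) ltac:(lra).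
  have [c' /andP[c1 c2]] := ratin (y - e) y ltac:(lra).
  have [d /andP[d1 d2]] := ratin y (y + e) ltac:(lra).
  exists a => //; exists b => //; exists c' => //; exists d => //.
  rewrite /V; case: pselect => [?|nsub].
    by split; rewrite /= in_itv/= ?a2 ?c2 ltW.
  exfalso; apply: nsub => -[u v] [/=]; rewrite !in_itv/= => /andP[u1 u2] /andP[v1 v2].
  by apply: eU; split; rewrite /ball/= ltr_norml; apply/andP; split; lra.
do 4! apply: bigcupT_measurable_rat => ?.
rewrite /V; case: pselect => [?|?]; [exact: box_measurable|exact: measurable0].
Qed.

Lemma closed_measurable_plane (C : set plane) : closed C -> measurable C.
Proof.
move=> clC; rewrite -[C]setCK; apply: measurableC; apply: open_measurable_plane.
exact: closed_openC.
Qed.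

End Boxes.

Section Planar_measure.
Variable R : realType.
Local Notation plane := (R * R)%type.
Local Notation H2 := (@hausdorff2 R 2).

(** Besides stretching the axes, this passes from pairs, which carry product measures, to row
    vectors, which carry [hausdorff2]; [dilate 1 1] is the bare identification. *)
Definition dilate (s t : R) (p : plane) : 'rV[R]_2 :=
  \row_(i < 2) (if i == 0 then s * p.1 else t * p.2).

Lemma sqr_enorm_dilate s t p q : enorm (dilate s t p - dilate s t q) ^+ 2 =
  s ^+ 2 * (p.1 - q.1) ^+ 2 + t ^+ 2 * (p.2 - q.2) ^+ 2.
Proof.
by rewrite sqr_enorm !big_ord_recl big_ord0 !mxE/=; ring.
Qed.

Variables s t : {posnum R}.

Definition undilate (y : 'rV[R]_2) : plane := (y 0 0 / s%:num, y 0 1 / t%:num).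

Lemma dilateK : cancel (dilate s%:num t%:num) undilate.
Proof.
by move=> [x y]; rewrite /undilate !mxE/= ![_ * _ / _]mulrAC !divff ?mul1r.
Qed.

Lemma undilateK : cancel undilate (dilate s%:num t%:num).
Proof.
move=> y; apply/rowP => i; rewrite mxE/=; case: eqP => [->|/eqP i0].
  by rewrite mulrC divfK.
rewrite mulrC divfK//; congr (y _ _); apply: val_inj => /=.
by case: i i0 => -[|[|]].
Qed.

Lemma image_dilate G : dilate s%:num t%:num @` G = undilate @^-1` G.
Proof.
apply/seteqP; split => [_ [p Gp <-]|y Gy]; first by rewrite /preimage/= dilateK.
by exists (undilate y) => //; rewrite undilateK.
Qed.

(** Preimages of closed half-lines under the coordinates are closed, hence Caratheodory measurable.
    This makes the measure transported to pairs countably additive on Borel sets. *)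
Lemma undilate_measurable :
  measurable_fun setT (undilate : caratheodory_type H2 -> plane).
Proof.
have key i (c : {posnum R}) : measurable_fun setT
    (fun y : caratheodory_type H2 => (y : 'rV[R]_2) 0 i / c%:num).
  apply: (@measurability _ _ _ _ _ _ (@RGenCInfty.G R)).
    exact: RGenCInfty.measurableE.
  move=> _ [_ [a ->] <-]; rewrite setTI; apply: closed_caratheodory.
  rewrite (_ : _ @^-1` _ = (fun y : 'rV[R]_2 => y 0 i) @^-1` [set z | a * c%:num <= z]).
    apply: preimage_closed; last exact: closed_ge.
    by move=> y _; exact: coord_continuous.
  by apply/seteqP; split => y /=; rewrite in_itv/= andbT ler_pdivlMr.
exact: measurable_fun_pair (key _ s) (key _ t).
Qed.

Definition planar_measure (A : set plane) : \bar R :=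
  H2 (dilate s%:num t%:num @` A).

Let planar0 : planar_measure set0 = 0%E.
Proof. by rewrite /planar_measure image_set0 hausdorff20. Qed.

Let planar_ge0 A : (0 <= planar_measure A)%E.
Proof. exact: hausdorff2_ge0. Qed.

Let planar_sigma_additive : semi_sigma_additive planar_measure.
Proof.
move=> F mF tF mUF; rewrite /planar_measure image_dilate preimage_bigcup.
rewrite [X in X @ _ --> _](_ : _ = fun n =>
    (\sum_(0 <= i < n) H2 (undilate @^-1` F i))%E); last first.
  by apply/funext => n; apply: eq_bigr => i _; rewrite image_dilate.
have mU A : measurable A -> (H2).-cara.-measurable (undilate @^-1` A).
  by move=> mA; have := undilate_measurable measurableT mA; rewrite setTI.
apply: (@caratheodory_measure_sigma_additive R _ H2).
- by move=> i; exact: mU.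
- apply/trivIsetP => /= i j _ _ ij; rewrite -preimage_setI.
  by move/trivIsetP : tF => /(_ _ _ _ _ ij) ->//; rewrite preimage_set0.
- by rewrite -preimage_bigcup; exact: mU.
Qed.

HB.instance Definition _ := isMeasure.Build _ _ _ planar_measure
  planar0 planar_ge0 planar_sigma_additive.

End Planar_measure.

(** Nonnegativity makes an additive [F] monotone. If k is the integer part of N x, then N F(x) lies
    between k F(1) and (k + 1) F(1), so the error is at most F(1) / N. *)
Lemma additive_nonneg_linear (R : realType) (F : R -> R) :
  (forall x, 0 <= x -> 0 <= F x) ->
  (forall x y, 0 <= x -> 0 <= y -> F (x + y) = F x + F y) ->
  forall x, 0 <= x -> F x = x * F 1.
Proof.
move=> F0 FD x x0.
have Fmul n y : 0 <= y -> F (n%:R * y) = n%:R * F y.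
  move=> y0; elim: n => [|n IH].
    by rewrite !mul0r; apply: (@addrI _ (F 0)); rewrite -FD// !addr0.
  by rewrite -natr1 !mulrDl !mul1r FD ?mulr_ge0// IH.
have mono u v : 0 <= u -> u <= v -> F u <= F v.
  by move=> u0 uv; rewrite -[v](subrKC u) FD ?subr_ge0// lerDl F0 ?subr_ge0.
have key n : `|F x - x * F 1| <= F 1 / n.+1%:R.
  set N := n.+1%:R; have N0 : 0 < N by rewrite /N.
  rewrite ler_pdivlMr// -[N in _ * N]gtr0_norm// -normrM.
  have Nx0 : 0 <= N * x by rewrite mulr_ge0// ltW.
  have /andP[k1 k2] := truncn_itv Nx0.
  set k := Num.truncn _ in k1 k2.
  have F1 : 0 <= F 1 by exact: F0.
  have e1 : k%:R * F 1 <= N * F x.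
    by rewrite -!Fmul// mulr1 mono.
  have e2 : N * F x <= k.+1%:R * F 1.
    by rewrite -!Fmul// mulr1 mono// ltW.
  rewrite -natr1 in k2 e2.
  rewrite ler_norml; apply/andP; split; nra.
apply/eqP; rewrite -subr_eq0 -normr_le0; apply/ler_addgt0Pr => e e0; rewrite add0r.
apply: le_trans (key (Num.truncn (F 1 / e))) _.
rewrite ler_pdivrMr// mulrC -ler_pdivrMr//; exact/ltW/truncnS_gt.
Qed.

Definition l1dist (R : realType) (u v : R * R) : R :=
  `|u.1 - v.1| + `|u.2 - v.2|.

Lemma l1_lipschitz_continuous (R : realType) n (f : R * R -> 'rV[R]_n.+1) (C : R) :
  (forall u v, enorm (f u - f v) <= C * l1dist u v) -> continuous f.
Proof.
move=> fC u A /nbhs_enormP[e e0 eA]; apply/nbhs_ballP.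
have C0 : 0 < 2 * (`|C| + 1) by rewrite mulr_gt0// ltr_pwDr.
exists (e / (2 * (`|C| + 1))); first by rewrite /= divr_gt0.
move=> v [/= uv1 uv2]; apply: eA.
have h : l1dist u v < e / (`|C| + 1).
  have -> : e / (`|C| + 1) = e / (2 * (`|C| + 1)) + e / (2 * (`|C| + 1)).
    by field; rewrite gt_eqF// ltr_pwDr.
  exact: ltrD uv1 uv2.
apply: le_lt_trans (fC _ _) _.
have l0 : 0 <= l1dist u v by rewrite addr_ge0.
apply: (@le_lt_trans _ _ ((`|C| + 1) * l1dist u v)).
  by rewrite ler_wpM2r// (le_trans (ler_norm _))// lerDl.
by rewrite mulrC -ltr_pdivlMr// ltr_pwDr.
Qed.

Section Box_values.
Variable R : realType.
Local Notation plane := (R * R)%type.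
Local Notation H2 := (@hausdorff2 R 2).
Local Open Scope ereal_scope.
Let mu (A : set plane) : \bar R := H2 (@dilate R 1 1 @` A).

Lemma hausdorff2_translate v (A : set plane) :
  mu [set (p.1 + v.1, p.2 + v.2)%R | p in A] = mu A.
Proof.
have le w B : mu [set (p.1 + w.1, p.2 + w.2)%R | p in B] <= mu B.
  rewrite /mu image_comp -[leRHS]mul1e -(expr1n R 2).
  apply: hausdorff2_comparison => // p q _ _; rewrite mul1r.
  rewrite -(ler_pXn2r (n := 2))// ?nnegrE ?enorm_ge0// !sqr_enorm_dilate/=; nra.
apply/eqP; rewrite eq_le le/=.
rewrite -[in leLHS](_ : [set (p.1 + (- v.1), p.2 + (- v.2))%R | p in
   [set (p.1 + v.1, p.2 + v.2)%R | p in A]] = A); first exact: (le (- v.1, - v.2)%R).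
rewrite image_comp -[RHS]image_id; apply: eq_imagel => -[x y] _ /=.
by rewrite !addrK.
Qed.

(** A grid of (n + 1)^2 cells of diameter at most 2 / n costs at most pi ((n + 1) / n)^2, which is
    at most 4 pi. *)
Lemma hausdorff2_unit_box : mu (box ((0, 1), (0, 1))%R) < +oo.
Proof.
apply: (@le_lt_trans _ _ (4 * pi)%:E); last by rewrite ltry.
apply: hausdorff2_leP => d d0.
pose n := (Num.truncn (2 / d)).+1.
have n0 : (0 < n%:R :> R)%R by [].
have nd : (2 / n%:R <= d)%R.
  by rewrite ler_pdivrMr// mulrC -ler_pdivrMr// ltW// truncnS_gt.
have n1 : (1 <= n)%N by [].
clearbody n.
(* The integer part of n z takes the values 0, ..., n, the last one at z = 1; hence n + 1 cells
   along each axis. *)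
pose cell i (z : R) := (0 <= z)%R /\ Num.truncn (n%:R * z)%R = i.
pose U k := if (k < n.+1 * n.+1)%N then
   @dilate R 1 1 @` [set p | cell (k %/ n.+1)%N p.1 /\ cell (k %% n.+1)%N p.2] else set0.
have cell_close i z z' : cell i z -> cell i z' -> ((z - z') ^+ 2 <= n%:R^-1 ^+ 2)%R.
  move=> [z0 zi] [z'0 zi'].
  have /andP[] := truncn_itv (mulr_ge0 (ltW n0) z0); rewrite zi => u1 u2.
  have /andP[] := truncn_itv (mulr_ge0 (ltW n0) z'0); rewrite zi' => v1 v2.
  rewrite -natr1 in u2 v2.
  rewrite exprVn -[leRHS]mul1r ler_pdivlMr ?exprn_gt0// -exprMn.
  rewrite -[leLHS]real_normK ?num_real// -[leRHS](expr1n R 2) ler_pXn2r ?nnegrE//.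
  by rewrite mulrBl ![(_ * n%:R)%R]mulrC ler_norml; apply/andP; split; lra.
have dU k : ediameter (U k) <= (2 / n%:R)%:E.
  rewrite /U; case: ifP => _; last by rewrite ediameter0 lee_fin divr_ge0.
  apply: ediameter_le; first by rewrite lee_fin divr_ge0.
  move=> _ _ [p [p1 p2] <-] [q [q1 q2] <-]; rewrite lee_fin.
  rewrite -(ler_pXn2r (n := 2))// ?nnegrE ?enorm_ge0 ?divr_ge0// sqr_enorm_dilate/=.
  have := cell_close _ _ _ p1 q1; have := cell_close _ _ _ p2 q2.
  rewrite expr1n !mul1r exprMn; have := sqr_ge0 (n%:R^-1 : R); lra.
apply: (@le_trans _ _ (\sum_(0 <= k <oo) (pi / 4)%:E * ediameter (U k) ^+ 2)).
  apply: ereal_inf_lbound; exists U => //; split; last first.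
    by move=> k; apply: le_trans (dU k) _; rewrite lee_fin.
  move=> _ [[x y] [/= hx hy] <-].
  have part z : (z \in `]0%R, 1%R]) -> exists2 i, (i < n.+1)%N & cell i z.
    rewrite in_itv/= => /andP[z0 z1]; exists (Num.truncn (n%:R * z)%R).
      rewrite ltnS truncn_le_nat -natr1; apply: (@le_lt_trans _ _ n%:R); last by rewrite ltrDl.
      by rewrite ger_pMr.
    by split => //; exact: ltW.
  have [i iN ix] := part _ hx; have [j jN jy] := part _ hy.
  exists (i * n.+1 + j)%N => //; rewrite /U ifT.
    by exists (x, y) => //=; rewrite divnMDl// modnMDl divn_small// modn_small// addn0.
  by apply: (@leq_trans (i * n.+1 + n.+1)); rewrite ?ltn_add2l// -mulSnr leq_mul.
have c0 k : 0 <= (pi / 4)%:E * ediameter (U k) ^+ 2.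
  by rewrite mule_ge0 ?lee_fin ?pi4_ge0// expe_ge0// ediameter_ge0.
rewrite (nneseries_split 0 (n.+1 * n.+1)%N)// add0n [X in _ + X]eseries0 ?adde0; last first.
  move=> k kn _; rewrite /U ifF; first by rewrite ediameter0 expe2 !mule0.
  by apply/negbTE; rewrite -leqNgt.
apply: (@le_trans _ _ (\sum_(0 <= k < n.+1 * n.+1) (pi / 4 * (2 / n%:R) ^+ 2)%:E)).
  apply: lee_sum => k _; rewrite [leRHS]EFinM; apply: lee_wpmul2l; first by rewrite lee_fin pi4_ge0.
  by rewrite expe2 expr2 [leRHS]EFinM lee_pmul ?ediameter_ge0.
rewrite sumEFin lee_fin sumr_const_nat subn0 -[leLHS]mulr_natr natrM -[n.+1%:R](natr1 n).
rewrite [leLHS](_ : _ = pi * ((n%:R + 1) / n%:R) ^+ 2)%R; last by field; rewrite gt_eqF.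
rewrite mulrC ler_wpM2r ?pi_ge0// -[leRHS](_ : 2 ^+ 2 = 4)%R; last by ring.
rewrite ler_pXn2r ?nnegrE ?divr_ge0//.
by rewrite ler_pdivrMr// mulr_natl mulr2n lerD2l ler1n.
Qed.

Let mu_ge0 A : 0 <= mu A. Proof. exact: hausdorff2_ge0. Qed.

Let one : {posnum R} := PosNum (@ltr01 R).

Let mu_split A B : measurable A -> measurable B -> A `&` B = set0 ->
  mu (A `|` B) = mu A + mu B.
Proof.
by move=> mA mB AB; exact: (@measureU _ _ _ (planar_measure one one)).
Qed.

Let F w h : \bar R := mu (box ((0, w), (0, h))%R).

Let boxF a b c d : mu (box ((a, b), (c, d))) = F (b - a) (d - c).
Proof.
rewrite /F -[RHS](hausdorff2_translate (a, c)%R); apply: (congr1 mu).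
apply/seteqP; split => [[x y]|_ [[x y] + <-]]; rewrite /box/= !in_itv/=.
  move=> [/andP[x1 x2] /andP[y1 y2]]; exists (x - a, y - c)%R; last by rewrite !subrK.
  by rewrite /= !in_itv/= !subr_gt0 x1 y1 !lerB.
move=> [/andP[x1 x2] /andP[y1 y2]].
by rewrite !ltrDr x1 y1 -!lerBrDr.
Qed.

Let FDl w w' h : (0 <= w)%R -> (0 <= w')%R -> F (w + w')%R h = F w h + F w' h.
Proof.
move=> w0 w'0.
have -> : F w' h = mu (box ((w, w + w'), (0, h))%R) by rewrite boxF addrC addKr subr0.
rewrite -mu_split; [|exact: box_measurable..|].
  apply: (congr1 mu); apply/seteqP; split => [[x y]|[x y]]; rewrite /box/= !in_itv/=.
    move=> [/andP[x1 x2] ->]; have [xw|xw] := leP x w; [left|right] => //.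
    by rewrite x1.
  move=> [] [/andP[x1 x2] ->]; split => //; apply/andP; split; lra.
apply/seteqP; split => // -[x y]; rewrite /box/= !in_itv/=.
by move=> [[/andP[_ x1] _] [/andP[x2 _] _]]; move: x2; rewrite ltNge x1.
Qed.

Let FDr w h h' : (0 <= h)%R -> (0 <= h')%R -> F w (h + h')%R = F w h + F w h'.
Proof.
move=> w0 w'0.
have -> : F w h' = mu (box ((0, w), (h, h + h'))%R) by rewrite boxF [(h + h')%R]addrC addrK subr0.
rewrite -mu_split; [|exact: box_measurable..|].
  apply: (congr1 mu); apply/seteqP; split => [[x y]|[x y]]; rewrite /box/= !in_itv/=.
    move=> [-> /andP[x1 x2]]; have [xw|xw] := leP y h; [left|right] => //.
    by rewrite x1.
  move=> [] [-> /andP[x1 x2]]; split => //; apply/andP; split; lra.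
apply/seteqP; split => // -[x y]; rewrite /box/= !in_itv/=.
by move=> [[_ /andP[_ x1]] [_ /andP[x2 _]]]; move: x2; rewrite ltNge x1.
Qed.

Let F_fin w h : F w h \is a fin_num.
Proof.
rewrite ge0_fin_numE ?mu_ge0//.
have F1 n : F n.+1%:R 1 < +oo.
  elim: n => [|n IH]; first exact: hausdorff2_unit_box.
  by rewrite -natr1 FDl// lte_add_pinfty//; exact: hausdorff2_unit_box.
have Fn n m : F n.+1%:R m.+1%:R < +oo.
  by elim: m => [|m IH]; [exact: F1|rewrite -[m.+2%:R]natr1 FDr// lte_add_pinfty].
apply: le_lt_trans (Fn (Num.truncn w) (Num.truncn h)).
apply/le_hausdorff2/image_subset => -[x y]; rewrite /box/= !in_itv/=.
move=> [/andP[-> x2] /andP[-> y2]].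
by rewrite (le_trans x2 (ltW (truncnS_gt _))) (le_trans y2 (ltW (truncnS_gt _))).
Qed.

(** Cutting a box into adjacent boxes makes its measure additive in each side length, hence linear
    in each. The constant is the measure of the unit box; it cancels from the stretch formula. *)
Lemma hausdorff2_box : exists2 kappa : R, (0 <= kappa)%R & forall a b c d : R,
  (a <= b)%R -> (c <= d)%R ->
  H2 (@dilate R 1 1 @` box ((a, b), (c, d))) = (kappa * ((b - a) * (d - c)))%:E.
Proof.
pose f w h := fine (F w h).
have f0 w h : (0 <= f w h)%R by rewrite fine_ge0// mu_ge0.
exists (f 1 1)%R; first exact: f0.
move=> a b c d ab cd; rewrite -/(mu _) boxF -[LHS]fineK// -/(f _ _); congr EFin.
rewrite (@additive_nonneg_linear _ (fun w => f w (d - c)%R)) ?subr_ge0//; last first.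
  by move=> x y x0 y0; rewrite /f FDl// fineD.
rewrite (@additive_nonneg_linear _ (fun h => f 1%R h)) ?subr_ge0//; last first.
  by move=> x y x0 y0; rewrite /f FDr// fineD.
ring.
Qed.

End Box_values.

Section Stretch.
Variable R : realType.
Local Notation plane := (R * R)%type.
Local Notation H2 := (@hausdorff2 R 2).
Local Open Scope ereal_scope.
Let one : {posnum R} := PosNum (@ltr01 R).

Lemma boxes_measure_unique (m1 m2 : {measure set plane -> \bar R}) :
  (forall a b c d, (a <= b)%R -> (c <= d)%R ->
     m1 (box ((a, b), (c, d))) = m2 (box ((a, b), (c, d)))) ->
  (forall a b c d, (a <= b)%R -> (c <= d)%R -> m1 (box ((a, b), (c, d))) < +oo) ->
  forall A, measurable A -> m1 A = m2 A.
Proof.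
move=> m12 m1oo A mA.
have le k : (- k%:R <= k%:R :> R)%R by rewrite lerNl (le_trans _ (ler0n _ _))// oppr_le0.
apply: (measure_unique (@boxes R) (fun k => box ((- k%:R, k%:R), (- k%:R, k%:R))%R)).
- exact: measurable_boxes.
- exact: boxes_setI_closed.
- by move=> k; exists ((- k%:R, k%:R), (- k%:R, k%:R))%R.
- exact: bigcup_boxes.
- move=> _ [[[a b] [c d]] _ <-].
  have [ab|ba] := leP a b; last first.
    by rewrite /box/= set_itv_ge ?bnd_simp -?leNgt ?(ltW ba)// set0X !measure0.
  have [cd|dc] := leP c d; last first.
    by rewrite /box/= [X in _ `*` X]set_itv_ge ?bnd_simp -?leNgt ?(ltW dc)// setX0 !measure0.
  exact: m12.
- by move=> k; apply: m1oo.
- exact: mA.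
Qed.

Let dilate_box (s t : R) (s0 : (0 < s)%R) (t0 : (0 < t)%R) a b c d :
  dilate s t @` box ((a, b), (c, d)) =
  dilate 1 1 @` box ((s * a, s * b), (t * c, t * d))%R.
Proof.
have E x y : dilate s t (x, y) = dilate 1 1 (s * x, t * y)%R.
  by apply/rowP => i; rewrite !mxE/= !mul1r.
apply/seteqP; split => _ [[x y] + <-]; rewrite /box/= !in_itv/= => -[/andP[x1 x2] /andP[y1 y2]].
  by exists (s * x, t * y)%R => //=; rewrite !in_itv/= !ltr_pM2l// !ler_pM2l// x1 x2 y1.
exists (s^-1 * x, t^-1 * y)%R; last by rewrite E !mulVKf// gt_eqF.
by rewrite /= !in_itv/= !ltr_pdivlMl// !ler_pdivrMl// x1 x2 y1.
Qed.

(** Both sides are Borel measures in [A] with equal finite values on boxes. *)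
Lemma hausdorff2_dilate_measurable (s t : R) (A : set plane) :
  (0 < s)%R -> (0 < t)%R -> measurable A ->
  H2 (dilate s t @` A) = (s * t)%:E * H2 (dilate 1 1 @` A).
Proof.
move=> s0 t0 mA; have [kappa k0 kE] := hausdorff2_box R.
have st0 : (0 <= s * t)%R by rewrite mulr_ge0// ltW.
have boxE a b c d : (a <= b)%R -> (c <= d)%R ->
    H2 (dilate s t @` box ((a, b), (c, d))) = (s * t * (kappa * ((b - a) * (d - c))))%:E.
  move=> ab cd; rewrite dilate_box// kE ?ler_pM2l//; congr EFin; ring.
apply: (@boxes_measure_unique (planar_measure (PosNum s0) (PosNum t0))
  (mscale (NngNum st0) (planar_measure one one))) => //.
  move=> a b c d ab cd; rewrite /mscale/= [RHS](congr1 _ (kE _ _ _ _ ab cd)).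
  by rewrite -EFinM; exact: boxE.
by move=> a b c d ab cd; rewrite [X in X < _](boxE _ _ _ _ ab cd) ltry.
Qed.

(** Replaces the unstretched image of [K] by a Borel hull of the same measure and applies the exact
    formula to the hull. *)
Lemma hausdorff2_dilate_le (s t : R) (K : set plane) : (0 < s)%R -> (0 < t)%R ->
  H2 (dilate s t @` K) <= (s * t)%:E * H2 (dilate 1 1 @` K).
Proof.
move=> s0 t0.
have [C [clC KC <-]] := hausdorff2_hull (dilate 1 1 @` K).
pose G := \bigcap_i \bigcup_k C i k; rewrite -/G.
have GE : G = dilate one%:num one%:num @` (dilate 1 1 @^-1` G).
  rewrite image_dilate; apply/seteqP; split => y; rewrite /preimage/= (@undilateK _ one one)//.
rewrite [in leRHS]GE -hausdorff2_dilate_measurable//.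
  by apply: le_hausdorff2; apply: image_subset => p Kp; apply: KC; exists p.
rewrite preimage_bigcap; apply: bigcapT_measurable => i.
rewrite preimage_bigcup; apply: bigcupT_measurable => k.
apply: closed_measurable_plane; apply: preimage_closed; last exact: clC.
move=> p _; apply: (@l1_lipschitz_continuous _ _ _ 1) => u v; rewrite mul1r.
apply: le_trans (enorm_le_sum _) _.
by rewrite !big_ord_recl big_ord0 !mxE/= !mul1r addr0.
Qed.

(* The library states the Lebesgue measure on [measurableTypeR R], whose display
   differs from that of [R]; products are taken on [R * R]. *)
Definition lebesgue1 (A : set R) : \bar R := @lebesgue_measure R A.

Let lebesgue1_0 : lebesgue1 set0 = 0.
Proof. exact: measure0. Qed.

Let lebesgue1_ge0 A : 0 <= lebesgue1 A.
Proof. exact: measure_ge0. Qed.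

Let lebesgue1_sigma_additive : semi_sigma_additive lebesgue1.
Proof. by move=> F mF tF mU; exact: (@measure_semi_sigma_additive _ _ _ (@lebesgue_measure R)). Qed.

HB.instance Definition _ := isMeasure.Build _ R R lebesgue1
  lebesgue1_0 lebesgue1_ge0 lebesgue1_sigma_additive.

Let lebesgue1_sigma_finite : sigma_finite setT lebesgue1.
Proof. by have [F TF Foo] := sigma_finiteT (@lebesgue_measure R); exists F. Qed.

HB.instance Definition _ := Measure_isSigmaFinite.Build _ R R lebesgue1
  lebesgue1_sigma_finite.

(** Agreement on boxes makes the planar Hausdorff measure [kappa] times the product Lebesgue
    measure. *)
Lemma hausdorff2_null (A : set plane) : measurable A ->
  (lebesgue1 \x lebesgue1) A = 0 -> H2 (dilate 1 1 @` A) = 0.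
Proof.
move=> mA A0; have [kappa k0 kE] := hausdorff2_box R.
transitivity (mscale (NngNum k0) (lebesgue1 \x lebesgue1) A); last first.
  by rewrite /mscale/= A0 mule0.
apply: (@boxes_measure_unique (planar_measure one one)
  (mscale (NngNum k0) (lebesgue1 \x lebesgue1))) => //.
- move=> a b c d ab cd; rewrite [LHS](kE _ _ _ _ ab cd).
  transitivity (kappa%:E * (lebesgue1 `]a, b] * lebesgue1 `]c, d])); last first.
    by congr (_ * _); rewrite /box/= product_measure1E.
  rewrite /lebesgue1 !lebesgue_measure_itv/= !lte_fin.
  have len x y : (x <= y)%R -> (if (x < y)%R then y%:E - x%:E else 0%E) = (y - x)%:E :> \bar R.
    by rewrite le_eqVlt => /predU1P[->|->//]; rewrite ltxx subrr.
  by rewrite !len// -!EFinM.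
- by move=> a b c d ab cd; rewrite [X in X < _](kE _ _ _ _ ab cd) ltry.
Qed.

End Stretch.

(** * Rademacher's theorem *)

Section Rademacher_monotone.
Variables (R : realType) (G : R -> R) (L : R).
Hypothesis ndG : {homo G : x y / x <= y}.
Hypothesis lipG : forall x y, x <= y -> G y - G x <= L * (y - x).
Local Notation leb := (@lebesgue_measure R).

Let L0 : 0 <= L.
Proof.
have := lipG (@ler01 R); have := ndG (@ler01 R); lra.
Qed.

Let rcG : forall x, G x @[x --> x^'+] --> G x.
Proof.
apply: right_continuousW => x; apply/cvgrPdist_le => e e0.
have d0 : 0 < e / (L + 1) by rewrite divr_gt0// ltr_pwDr.
near=> y.
have xy : `|x - y| <= e / (L + 1).
  by near: y; apply/nbhs_ballP; exists (e / (L + 1)) => //= y /= /ltW.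
apply: (@le_trans _ _ ((L + 1) * `|x - y|)); last by rewrite mulrC -ler_pdivlMr// ltr_pwDr.
have [xy'|/ltW yx] := leP x y.
  rewrite distrC [`|x - y|]distrC !ger0_norm ?subr_ge0 ?ndG//.
  by apply: le_trans (lipG xy') _; rewrite ler_wpM2r ?subr_ge0// lerDl.
rewrite !ger0_norm ?subr_ge0 ?ndG//.
by apply: le_trans (lipG yx) _; rewrite ler_wpM2r ?subr_ge0// lerDl.
Unshelve. all: by end_near. Qed.

HB.instance Definition _ := isCumulative.Build R _ R G ndG rcG.

Let nu := lebesgue_stieltjes_measure G.

Let nu_itv (a b : R) : a <= b -> nu `]a, b] = (G b - G a)%:E.
Proof.
move=> ab; rewrite /nu /lebesgue_stieltjes_measure /measure_extension.
by rewrite measurable_mu_extE/= ?wlength_itv_bnd//; exact: is_ocitv.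
Qed.

(** Both measures are infima over covers by half-open intervals, and on one interval the increment
    of [G] is at most [L] times the length. The factor [L + 1] is positive even when [L] is 0. *)
Let nu_le A : (nu A <= (L + 1)%:E * leb A)%E.
Proof.
have L1 : 0 < L + 1 by rewrite ltr_pwDr.
rewrite -lee_pdivrMl//.
apply: le_ereal_inf_tmp => _ [F [mF AF] <-]; rewrite lee_pdivrMl//.
rewrite -nneseriesZl; last by move=> k _; exact: (@wlength_ge0 R idfun _).
apply: (@le_trans _ _ (\sum_(0 <= k <oo) wlength G (F k))%E).
  by apply: ereal_inf_lbound; exists F.
apply: lee_nneseries => [k _ _|k _]; first exact: (@wlength_ge0 R G _).
have /ocitvP[->|[[a b]/= ab ->]] : ocitv (F k) by exact: mF.
  rewrite wlength0; apply: mule_ge0; first by rewrite lee_fin ltW.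
  exact: (@wlength_ge0 R idfun _).
rewrite !wlength_itv_bnd ?(ltW ab)//= -EFinM lee_fin.
apply: le_trans (lipG (ltW ab)) _; rewrite ler_wpM2r// ?subr_ge0 ?(ltW ab)//.
by rewrite lerDl.
Qed.

(* The Stieltjes measure of G is absolutely continuous; G is, up to a constant, the
   primitive of its Radon-Nikodym density, to which Lebesgue differentiation applies. *)
Lemma derivable_ae_monotone : {ae leb, forall x, derivable G x 1}.
Proof.
(* Restriction to a bounded interval makes the Stieltjes measure finite, and its density integrable
   on the line. *)
pose D (N : nat) : set R := `](- N%:R), N%:R]%classic.
suff H N : {ae leb, forall x, - N%:R < x -> x < N%:R -> derivable G x 1}.
  apply: (@filterS _ _ (ae_filter_ringOfSetsType leb) (fun x : R => forall N : nat, - N%:R < x -> x < N%:R -> derivable G x 1)).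
    move=> x /(_ (Num.bound x)); apply.
      by rewrite ltrNl unstable.ltrNbound.
    exact: unstable.ltr_bound.
  exact: (@ae_foralln).
have mD : measurable (D N) by exact: measurable_itv.
have NN : (- N%:R <= N%:R :> R) by rewrite lerNl (le_trans _ (ler0n _ _))// oppr_le0.
have nuoo : (nu (D N) < +oo)%E by rewrite nu_itv// ltry.
pose nuN := mfrestr (f := nu) mD nuoo.
have dom : nuN `<< leb.
  move=> A A0 B mB BA; apply/eqP; rewrite eq_le measure_ge0 andbT.
  rewrite /nuN /mfrestr /mrestr; apply: le_trans (nu_le _) _.
  have /eqP := A0 B mB BA; rewrite eq_le => /andP[B0 _].
  have leB : (leb (B `&` D N) <= 0)%E.
    apply: le_trans B0; apply: le_measure; rewrite ?inE//; exact: measurableI.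
  apply: (@le_trans _ _ ((L + 1)%:E * 0)%E); last by rewrite mule0.
  by apply: lee_wpmul2l leB; rewrite lee_fin addr_ge0.
have [f [f0 ffin fint fE]] := @radon_nikodym_sigma_finite _ _ _ leb nuN dom.
pose g x := fine (f x).
have fg : f = EFin \o g by apply/funext => x; rewrite /g/= fineK.
have gint A : measurable A -> leb.-integrable A (EFin \o g).
  by move=> mA; rewrite -fg; apply: integrableS fint.
have gloc : locally_integrable setT g.
  by apply: open_integrable_locally; [exact: openT|exact: gint].
have := FTC1Ny (fun y => gint _ (measurable_itv _)) gloc.
apply: (@filterS _ _ (ae_filter_ringOfSetsType leb)) => x [+ _] xN Nx.
set F := (X in derivable X) => dF.
have FG y : - N%:R < y -> y < N%:R -> F y = G y - G (- N%:R).
  move=> Ny yN; rewrite /F /Rintegral [X in fine X](_ : _ = nuN `]-oo, y]%classic); last first.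
    by have h := fE `]-oo, y]%classic (measurable_itv _); rewrite fg in h; exact: (esym h).
  rewrite /nuN /mfrestr /mrestr (_ : _ `&` _ = `](- N%:R), y]%classic).
    by rewrite nu_itv// ltW.
  apply/seteqP; split => z; rewrite /D/= !in_itv/=; first by move=> [-> /andP[->]].
  by move=> /andP[-> zy]; rewrite zy/= (le_trans zy)// ltW.
have -> : G = (fun y => G y - G (- N%:R)) + cst (G (- N%:R)).
  by apply/funext => y; rewrite /cst/= fctE subrK.
apply: derivableD; last exact: derivable_cst.
apply: near_eq_derivable dF.
near=> y; apply: FG; near: y.
  exact: lt_nbhsr.
exact: lt_nbhsl.
Unshelve. all: by end_near. Qed.

End Rademacher_monotone.

(** Adding [L * x] makes the function nondecreasing with slopes at most [2 * L], and subtracting it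
    preserves derivability. *)
Lemma lipschitz_derivable_ae (R : realType) (g : R -> R) (L : R) :
  (forall x y, `|g x - g y| <= L * `|x - y|) ->
  {ae @lebesgue_measure R, forall x, derivable g x 1}.
Proof.
move=> gL.
have nd : {homo (fun x => g x + L * x) : x y / x <= y}.
  move=> x y xy; have := gL y x; rewrite [`|y - x|]ger0_norm ?subr_ge0//.
  by rewrite ler_norml => /andP[]; rewrite /=; lra.
have lip x y : x <= y -> (g y + L * y) - (g x + L * x) <= 2 * L * (y - x).
  move=> xy; have := gL y x; rewrite [`|y - x|]ger0_norm ?subr_ge0//.
  by rewrite ler_norml => /andP[]; rewrite /=; lra.
have := derivable_ae_monotone nd lip.
apply: (@filterS _ _ (ae_filter_ringOfSetsType _)) => x dx.
have -> : g = (fun x => g x + L * x) - (fun x => L * x).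
  by apply/funext => y; rewrite !fctE addrK.
apply: derivableB => //.
Qed.

Lemma derivable_1P (R : realType) (g : R -> R) x : derivable g x 1 ->
  exists c, forall e, 0 < e -> exists2 d, 0 < d &
    forall t, `|t| <= d -> `|g (x + t) - g x - c * t| <= e * `|t|.
Proof.
move=> /cvg_ex[c /cvgrPdist_le gc]; exists c => e e0.
have /nbhs_ballP[d /= d0 dh] := gc e e0.
exists (d / 2); first by rewrite divr_gt0.
move=> t td; have [->|t0] := eqVneq t 0.
  by rewrite addr0 subrr mulr0 subr0 normr0 mulr0.
have tt : `|0 - t| < d by rewrite sub0r normrN; lra.
have := dh t tt t0; rewrite /= distrC.
rewrite (_ : _ - c = t^-1 * (g (x + t) - g x - c * t)).
  by rewrite normrM normfV mulrC ler_pdivrMr ?normr_gt0.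
by rewrite /GRing.scale/= mulr1 [t + x]addrC; field.
Qed.

Section Null_slices.
Variable R : realType.
Local Notation plane := (R * R)%type.
Local Notation leb2 := (@lebesgue1 R \x @lebesgue1 R)%E.

Lemma null_of_ae (S : set R) (P : R -> Prop) : measurable S ->
  {ae @lebesgue_measure R, forall x, P x} -> (forall x, S x -> ~ P x) ->
  lebesgue1 S = 0%E.
Proof.
move=> mS aeP SP; apply: (@measure_negligible _ _ _ (@lebesgue_measure R)) => //.
by apply: negligibleS aeP => x /SP.
Qed.

Lemma null_xsections (N : set plane) : measurable N ->
  (forall a, lebesgue1 [set b | N (a, b)] = 0%E) -> leb2 N = 0%E.
Proof.
move=> mN N0; rewrite /product_measure1 integral0_eq// => a _.
rewrite -[RHS](N0 a)/=; congr (lebesgue1 _).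
by apply/seteqP; split => b /=; rewrite /xsection/= inE.
Qed.

(** The product measure is defined by integrating sections in the other direction; its uniqueness
    exchanges the order. *)
Lemma null_ysections (N : set plane) : measurable N ->
  (forall b, lebesgue1 [set a | N (a, b)] = 0%E) -> leb2 N = 0%E.
Proof.
move=> mN N0; rewrite (product_measure_unique (m' := (@lebesgue1 R \x^ @lebesgue1 R)%E))//; last first.
  by move=> A B mA mB; exact: product_measure2E.
rewrite /= /product_measure2 integral0_eq// => b _.
rewrite -[RHS](N0 b)/=; congr (lebesgue1 _).
by apply/seteqP; split => a /=; rewrite /ysection/= inE.
Qed.

End Null_slices.

(** * Porous sets *)

Section Porosity.
Variable R : realType.
Local Notation plane := (R * R)%type.

(** An interval near [b] whose length is not small relative to the distances of its ends from [b]. A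
    set that misses one at every scale [n] is porous at [b]. *)
Definition gap (e : R) n (b c d : R) : Prop :=
  [/\ `|c - b| <= n.+1%:R^-1, `|d - b| <= n.+1%:R^-1, c < d &
      e * (`|c - b| + `|d - b|) <= d - c].

(* The distance to K is Lipschitz; where it is derivable and K is porous, it is both
   o(t) and at least of order t along the midpoints of the gaps. *)
Lemma porous_null (K : set R) (e : R) : 0 < e ->
  {ae @lebesgue_measure R, forall b, ~ (K b /\ forall n, exists c d : R,
     gap e n b c d /\ K `&` `[c, d] = set0)}.
Proof.
move=> e0.
have [[y0 Ky0]|K0] := pselect (K !=set0); last first.
  by apply: aeW => b [Kb _]; apply: K0; exists b.
pose dist b := inf [set `|b - y| | y in K].
have S0 b : [set `|b - y| | y in K] !=set0 by exists `|b - y0|, y0.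
have lb b : lbound [set `|b - y| | y in K] 0 by move=> _ [y _ <-].
have dist_ge0 b : 0 <= dist b by apply: lb_le_inf.
have dist_le b y : K y -> dist b <= `|b - y|.
  by move=> Ky; apply: ge_inf; [exists 0; exact: lb|exists y].
have distD x y : dist x <= dist y + 1 * `|x - y|.
  rewrite mul1r -lerBlDr; apply: lb_le_inf => // _ [z Kz <-].
  rewrite lerBlDr; apply: le_trans (dist_le x z Kz) _.
  by rewrite [leRHS]addrC ler_distD.
have distL x y : `|dist x - dist y| <= 1 * `|x - y|.
  rewrite ler_norml lerNl opprB !lerBlDl distD.
  by rewrite andbT distrC distD.
have := lipschitz_derivable_ae distL.
apply: (@filterS _ _ (ae_filter_ringOfSetsType _)) => b /derivable_1P[c dc].
move=> [Kb por].
have db : dist b = 0.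
  by apply/eqP; rewrite eq_le dist_ge0 andbT (le_trans (dist_le b b Kb))// subrr normr0.
have [r r0 hr] := dc (e / 4) ltac:(by rewrite divr_gt0).
(* Distances are nonnegative, so adding the estimates at t and -t eliminates the slope [c]. *)
have small t : `|t| <= r -> dist (b + t) <= e / 2 * `|t|.
  move=> tr; have h1 := hr t tr; have := hr (- t); rewrite normrN => /(_ tr).
  move: h1; rewrite db !subr0 !ler_norml => /andP[h1 h2] /andP[h3 h4].
  have := dist_ge0 (b + t); have := dist_ge0 (b - t); lra.
have [c' [d [[cb db' cd ecd] Kcd]]] := por (Num.truncn r^-1).
pose t := (c' + d) / 2 - b.
have tle : `|t| <= (`|c' - b| + `|d - b|) / 2.
  have -> : t = (c' - b) / 2 + (d - b) / 2 by rewrite /t; field.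
  have h2 : `|2^-1| = 2^-1 :> R by rewrite ger0_norm ?invr_ge0.
  by rewrite (le_trans (ler_normD _ _))// !normrM h2 -mulrDl.
have rn : (Num.truncn r^-1).+1%:R^-1 <= r.
  by rewrite ltW// invf_plt ?posrE//; exact: truncnS_gt.
have tr : `|t| <= r.
  apply: le_trans tle _; apply: le_trans rn.
  by rewrite ler_pdivrMr// mulr_natr mulr2n lerD.
have far : (d - c') / 2 <= dist (b + t).
  apply: lb_le_inf => // _ [y Ky <-].
  rewrite leNgt; apply/negP => near.
  have : (K `&` `[c', d]) y.
    split => //=; rewrite in_itv/=; move: near; rewrite /t addrCA subrr addr0.
    by rewrite ltr_norml => /andP[h1 h2]; apply/andP; split; lra.
  by rewrite Kcd.
(* The midpoint of the gap would have distance at least half the gap, and at most a quarter of it,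
   from [K]. *)
have := small _ tr; nra.
Qed.

(** The projection of a closed set need not be closed, but restricting the first coordinate to
    [-n, n] makes it the projection of a compact set. *)
Lemma measurable_slab_projection (K : set plane) (c d : R) : closed K ->
  measurable [set a | exists2 y, c <= y <= d & K (a, y)].
Proof.
move=> clK.
have -> : [set a | exists2 y, c <= y <= d & K (a, y)] =
    \bigcup_n (fst @` (K `&` (`[- n%:R, n%:R] `*` `[c, d]))).
  apply/seteqP; split => [a [y yc Ky]|a [n _ [[a' y] [Ky [_ yc]] <-]]].
    exists (Num.bound a) => //; exists (a, y) => //; split => //; split => /=.
      rewrite in_itv/= lerNl !ltW//; first exact: unstable.ltr_bound.
      exact: unstable.ltrNbound.
    by rewrite in_itv.
  by move: yc; rewrite /= in_itv/= => yc; exists y.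
apply: bigcupT_measurable => n; apply: closed_measurable.
apply: compact_closed; first exact: Rhausdorff.
apply: continuous_compact.
  by apply: continuous_subspaceT => x; exact: cvg_fst.
rewrite setIC; apply: compact_closedI => //.
by apply: compact_setX; exact: segment_compact.
Qed.

(** The points (a, b) of [K] at which the slice of [K] over [a] is porous at [b]. With rational ends
    of the gaps this is a countable combination of product sets: the first factor says that the
    slice misses [c, d], the second that [c, d] is a gap at [b]. *)
Definition porous_part (K : set plane) (e : R) : set plane :=
  K `&` \bigcap_(n in setT) \bigcup_(c : rat) \bigcup_(d : rat)
    ((~` [set a | exists2 y, ratr c <= y <= ratr d & K (a, y)]) `*`
     [set b | gap e n b (ratr c) (ratr d)]).

Lemma porous_part_null K e : closed K -> 0 < e -> 
  measurable (porous_part K e) /\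
  (@lebesgue1 R \x @lebesgue1 R)%E (porous_part K e) = 0%E.
Proof.
move=> clK e0.
have mgap n (c d : R) : measurable [set b | gap e n b c d].
  have cont (z : R) : continuous (fun b : R => `|z - b|).
    by move=> b; apply: cvg_norm; apply: cvgB; [exact: cvg_cst|exact: cvg_id].
  have [cd|ncd] := pselect (c < d); last first.
    by rewrite (_ : mkset _ = set0)//; apply/seteqP; split => // b [].
  rewrite (_ : mkset _ = ((fun b => `|c - b|) @^-1` [set z | z <= n.+1%:R^-1]) `&`
    (((fun b => `|d - b|) @^-1` [set z | z <= n.+1%:R^-1]) `&`
    ((fun b => e * (`|c - b| + `|d - b|)) @^-1` [set z | z <= d - c]))); last first.
    by apply/seteqP; split => b [] // ? [].
  apply: closed_measurable; apply: closedI; [|apply: closedI].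
  - by apply: preimage_closed; [move=> b _; exact: cont|exact: closed_le].
  - by apply: preimage_closed; [move=> b _; exact: cont|exact: closed_le].
  - apply: preimage_closed; [move=> b _|exact: closed_le].
    apply: cvgM; first exact: cvg_cst.
    by apply: cvgD; exact: cont.
have mP : measurable (porous_part K e).
  apply: measurableI; first exact: closed_measurable_plane.
  apply: bigcapT_measurable => n; apply: bigcupT_measurable_rat => c.
  apply: bigcupT_measurable_rat => d; apply: measurableX => //.
  by apply: measurableC; exact: measurable_slab_projection.
split => //; apply: null_xsections => // a.
apply: (null_of_ae _ (porous_null [set b | K (a, b)] e0)).
  have := measurable_xsection a mP; rewrite (_ : xsection _ _ = [set b | porous_part K e (a, b)])//.
  by apply/seteqP; split => b /=; rewrite /xsection/= inE.
move=> b [Kab por]; apply; split => // n.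
have [c _ [d _ [/= nK g]]] := por n Logic.I.
exists (ratr c), (ratr d); split => //.
apply/seteqP; split => // y [/= Ky]; rewrite in_itv/= => cy.
by apply: nK; exists y.
Qed.

End Porosity.

Lemma l1_lipschitz_continuous_real (R : realType) (f : R * R -> R) (C : R) :
  (forall u v, `|f u - f v| <= C * l1dist u v) -> continuous f.
Proof.
move=> fC u; apply/cvgrPdist_le => e e0.
have C0 : 0 < `|C| + 1 by rewrite ltr_pwDr.
have d0 : 0 < e / (2 * (`|C| + 1)) by rewrite divr_gt0// mulr_gt0.
change (nbhs u [set v | `|f u - f v| <= e]).
apply/nbhs_ballP; exists (e / (2 * (`|C| + 1))) => //= v [/= uv1 uv2].
apply: le_trans (fC _ _) _.
have h : l1dist u v <= e / (`|C| + 1).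
  have -> : e / (`|C| + 1) = e / (2 * (`|C| + 1)) + e / (2 * (`|C| + 1)).
    by field; rewrite gt_eqF.
  exact: ltW (ltrD uv1 uv2).
have l0 : 0 <= l1dist u v by rewrite addr_ge0.
apply: (@le_trans _ _ ((`|C| + 1) * l1dist u v)).
  by rewrite ler_wpM2r// (le_trans (ler_norm _))// lerDl.
by rewrite mulrC -ler_pdivlMr.
Qed.

(** * Differentiability of Lipschitz functions of the plane *)

Section Rademacher_plane.
Variables (R : realType) (f : R * R -> R) (L : R).
Local Notation plane := (R * R)%type.
Local Notation leb2 := (@lebesgue1 R \x @lebesgue1 R)%E.
Hypothesis fL : forall u v, `|f u - f v| <= L * l1dist u v.

Let L0 : 0 <= L.
Proof.
have := fL (0, 0) (1, 0); rewrite /l1dist/= !sub0r normrN normr1 oppr0 normr0 addr0 mulr1.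
exact: le_trans.
Qed.

Let cf : continuous f. Proof. exact: l1_lipschitz_continuous_real fL. Qed.

Let K1 (e c d : R) : set plane :=
  [set u | forall t, `|t| <= d -> `|f (u.1 + t, u.2) - f u - c * t| <= e * `|t|].

Let K2 (e c d : R) : set plane :=
  [set u | forall t, `|t| <= d -> `|f (u.1, u.2 + t) - f u - c * t| <= e * `|t|].

Let closedK1 e c d : closed (K1 e c d).
Proof.
rewrite (_ : K1 e c d = \bigcap_(t in [set t | `|t| <= d])
   [set u : plane | `|f (u.1 + t, u.2) - f u - c * t| <= e * `|t|])//.
apply: closed_bigI => t _.
apply: (@preimage_closed _ _ (fun u => `|f (u.1 + t, u.2) - f u - c * t|) [set z | z <= e * `|t|]);
  last exact: closed_le.
move=> u _; apply: cvg_norm; apply: cvgB; last exact: cvg_cst.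
apply: cvgB; last exact: cf.
apply: (@l1_lipschitz_continuous_real _ (fun u => f (u.1 + t, u.2)) L) => v w.
apply: le_trans (fL _ _) _; rewrite /l1dist/=.
by rewrite (_ : v.1 + t - _ = v.1 - w.1)//; ring.
Qed.

Let closedK2 e c d : closed (K2 e c d).
Proof.
rewrite (_ : K2 e c d = \bigcap_(t in [set t | `|t| <= d])
   [set u : plane | `|f (u.1, u.2 + t) - f u - c * t| <= e * `|t|])//.
apply: closed_bigI => t _.
apply: (@preimage_closed _ _ (fun u => `|f (u.1, u.2 + t) - f u - c * t|) [set z | z <= e * `|t|]);
  last exact: closed_le.
move=> u _; apply: cvg_norm; apply: cvgB; last exact: cvg_cst.
apply: cvgB; last exact: cf.
apply: (@l1_lipschitz_continuous_real _ (fun u => f (u.1, u.2 + t)) L) => v w.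
apply: le_trans (fL _ _) _; rewrite /l1dist/=.
by rewrite (_ : v.2 + t - _ = v.2 - w.2)//; ring.
Qed.

Let rat_approx (g : R -> R) : derivable g 0 1 -> forall e, 0 < e ->
  exists (q : rat) (j : nat), forall t, `|t| <= j.+1%:R^-1 ->
    `|g t - g 0 - ratr q * t| <= e * `|t|.
Proof.
move=> /derivable_1P[c gc] e e0; have [d d0 dt] := gc (e / 2) ltac:(by rewrite divr_gt0).
have [q] := rat_in_itvoo (ltac:(lra) : c - e / 2 < c + e / 2).
rewrite in_itv/= => /andP[q1 q2]; exists q, (Num.truncn d^-1) => t tj.
have td : `|t| <= d.
  by apply: le_trans tj _; rewrite ltW// invf_plt ?posrE//; exact: truncnS_gt.
have := dt t td; rewrite add0r => h.
have -> : g t - g 0 - ratr q * t = (g t - g 0 - c * t) + (c - ratr q) * t by ring.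
apply: le_trans (ler_normD _ _) _; rewrite normrM.
have : `|c - ratr q| <= e / 2 by rewrite ler_norml; apply/andP; split; lra.
have := normr_ge0 t; nra.
Qed.

Let inv k : R := k.+1%:R^-1.

(** Contains the points with a partial derivative in the first variable; rational slopes and closed
    sets [K1] make it Borel. *)
Let D1 : set plane := \bigcap_k \bigcup_(q : rat) \bigcup_j K1 (inv k) (ratr q) (inv j).
Let D2 : set plane := \bigcap_k \bigcup_(q : rat) \bigcup_j K2 (inv k) (ratr q) (inv j).

Let mD1 : measurable D1.
Proof.
apply: bigcapT_measurable => k; apply: bigcupT_measurable_rat => q.
apply: bigcupT_measurable => j; exact: closed_measurable_plane.
Qed.

Let mD2 : measurable D2.
Proof.
apply: bigcapT_measurable => k; apply: bigcupT_measurable_rat => q.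
apply: bigcupT_measurable => j; exact: closed_measurable_plane.
Qed.

Let derivable_shift (g : R -> R) a : derivable g a 1 -> derivable (fun t => g (a + t)) 0 1.
Proof.
move=> /derivable_1P[c gc]; apply/cvg_ex; exists c; apply/cvgrPdist_le => e e0.
have [d d0 dt] := gc e e0.
apply/nbhs_ballP; exists d => //= t; rewrite /ball/= sub0r normrN => td t0.
rewrite distrC /GRing.scale/= mulr1 !addr0.
rewrite (_ : _ - c = t^-1 * (g (a + t) - g a - c * t)); last by field.
by rewrite normrM normfV mulrC ler_pdivrMr ?normr_gt0//; exact: dt (ltW td).
Qed.

Let nullD1 : leb2 (~` D1) = 0%E.
Proof.
apply: null_ysections => [|b]; first exact: measurableC.
have Lf x y : `|f (x, b) - f (y, b)| <= L * `|x - y|.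
  by apply: le_trans (fL _ _) _; rewrite /l1dist/= subrr normr0 addr0.
apply: (null_of_ae _ (lipschitz_derivable_ae Lf)).
  have := measurable_ysection b (measurableC mD1).
  rewrite (_ : ysection _ _ = [set a | (~` D1) (a, b)])//.
  by apply/seteqP; split => a /=; rewrite /ysection/= inE.
move=> a /= nD d; apply: nD => k _.
have [q [j h]] := rat_approx (derivable_shift d) (ltac:(by rewrite /inv) : 0 < inv k).
by exists q => //; exists j => // t tj; have := h t tj; rewrite addr0.
Qed.

Let nullD2 : leb2 (~` D2) = 0%E.
Proof.
apply: null_xsections => [|a]; first exact: measurableC.
have Lf x y : `|f (a, x) - f (a, y)| <= L * `|x - y|.
  by apply: le_trans (fL _ _) _; rewrite /l1dist/= subrr normr0 add0r.
apply: (null_of_ae _ (lipschitz_derivable_ae Lf)).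
  have := measurable_xsection a (measurableC mD2).
  rewrite (_ : xsection _ _ = [set b | (~` D2) (a, b)])//.
  by apply/seteqP; split => b /=; rewrite /xsection/= inE.
move=> b /= nD d; apply: nD => k _.
have [q [j h]] := rat_approx (derivable_shift d) (ltac:(by rewrite /inv) : 0 < inv k).
by exists q => //; exists j => // t tj; have := h t tj; rewrite addr0.
Qed.

(** The ratio [inv k / 4] fits the gaps used below: their ends lie within 2 |t| of [b] and their
    length is at least [inv k] times |t|. *)
Let Por_at (i : nat * rat * nat) : set plane :=
  porous_part (K1 (inv i.1.1) (ratr i.1.2) (inv i.2)) (inv i.1.1 / 4).

Let Por : set plane := \bigcup_m if unpickle m is Some i then Por_at i else set0.

(* At almost every (a, b) both partial derivatives exist, and the points (a, y) at which
   the x-difference quotients are uniformly close to those at (a, b) are not porous at b: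
   to estimate f at (a + s, b + t), move first from (a, b) to such a point (a, z) with
   |b + t - z| small compared to |t|, then in the x direction. *)
Lemma Rademacher_plane : exists N : set plane,
  [/\ measurable N, leb2 N = 0%E & forall u, ~ N u -> forall e, 0 < e ->
    exists (q1 q2 : rat) (j : nat), forall v, l1dist v u <= j.+1%:R^-1 ->
      `|f v - f u - (ratr q1 * (v.1 - u.1) + ratr q2 * (v.2 - u.2))| <=
        e * l1dist v u].
Proof.
have inv4 k : 0 < inv k / 4 by rewrite divr_gt0// /inv.
have PorP m : measurable (if unpickle m is Some i then Por_at i else set0) /\
    leb2 (if unpickle m is Some i then Por_at i else set0) = 0%E.
  case: (unpickle m) => [i|]; last by rewrite measure0.
  exact: porous_part_null.
have mPor : measurable Por by apply: bigcupT_measurable => m; have [] := PorP m.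
have nPor : leb2.-negligible Por.
  by apply: negligible_bigcup => m; have [mP nP] := PorP m; apply/negligibleP.
have mD12 := measurableU _ _ (measurableC mD1) (measurableC mD2).
have nD1 := negligibleP leb2 (measurableC mD1).
have nD2 := negligibleP leb2 (measurableC mD2).
exists (~` D1 `|` ~` D2 `|` Por); split.
- exact: (measurableU _ _ mD12 mPor).
- apply: (measure_negligible (measurableU _ _ mD12 mPor)).
  exact: (negligibleU (negligibleU (nD1.2 nullD1) (nD2.2 nullD2)) nPor).
move=> [a b] nN e e0; have Lpos := L0.
have D1u : D1 (a, b) by apply: contrapT => h; apply: nN; left; left.
have D2u : D2 (a, b) by apply: contrapT => h; apply: nN; left; right.
have Pu : ~ Por (a, b) by move=> h; apply: nN; right.
(* The four errors in the final decomposition add up to at most [inv k] times |s| + (2 L + 3)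
   |t|. *)
pose k := Num.truncn ((2 * L + 3) / e).
have C0 : 0 < 2 * L + 3 by rewrite ltr_wpDl// mulr_ge0.
have ke : inv k * (2 * L + 3) <= e.
  rewrite /inv [leLHS]mulrC ler_pdivrMr// [leRHS]mulrC -ler_pdivrMr//.
  exact/ltW/truncnS_gt.
have k0 : 0 < inv k by rewrite /inv.
have k1 : inv k <= 1 by rewrite /inv invf_le1// ler1n.
have [q1 _ [j1 _ Ku1]] := D1u k Logic.I.
have [q2 _ [j2 _ Ku2]] := D2u k Logic.I.
(* The negation of porosity: at some scale [n] every rational gap at [b] meets the slice. *)
have [n Hn] : exists n, forall c d : rat, gap (inv k / 4) n b (ratr c) (ratr d) ->
   exists2 y, ratr c <= y <= ratr d & K1 (inv k) (ratr q1) (inv j1) (a, y).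
  apply: contrapT => nh; apply: Pu; exists (pickle (k, q1, j1)) => //; rewrite pickleK.
  split => // n _; apply: contrapT => nh'; apply: nh; exists n => c d g.
  apply: contrapT => ny; apply: nh'; exists c => //; exists d => //; split => //=.
set kk := inv k in ke k0 k1 Ku1 Ku2 Hn.
(* Doubling the indices turns |t| <= 1 / (J + 1) into 2 |t| <= [inv j2] and 2 |t| <= [inv n], as
   needed for points within 2 |t| of [b]. *)
pose J := maxn j1 (maxn (2 * j2.+1) (2 * n.+1)).
exists q1, q2, J => -[x y] /=.
rewrite /l1dist/=; set s := x - a; set t := y - b => st.
have -> : x = a + s by rewrite /s addrC subrK.
have -> : y = b + t by rewrite /t addrC subrK.
have st_le m : (m <= J)%N -> `|s| + `|t| <= m.+1%:R^-1.
  by move=> mj; apply: le_trans st _; rewrite lef_pV2 ?posrE// ler_nat.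
have s0 := normr_ge0 s; have t0 := normr_ge0 t.
have sj1 : `|s| <= inv j1.
  by apply: le_trans (st_le j1 _); rewrite ?lerDl// leq_maxl.
have [t00|tn0] := eqVneq t 0.
  rewrite t00 addr0 mulr0 addr0 normr0 addr0.
  apply: le_trans (Ku1 s sj1) _; rewrite /= ler_wpM2r//.
  by apply: le_trans ke; rewrite ler_peMr ?(ltW k0)//; have := L0; lra.
have tp : 0 < `|t| by rewrite normr_gt0.
have st2 m : (2 * m.+1 <= J)%N -> 2 * `|t| <= inv m.
  move=> mJ; have h := st_le _ mJ.
  rewrite /inv mulrC -ler_pdivlMr// -invfM -natrM mulnC.
  apply: (@le_trans _ _ (2 * m.+1).+1%:R^-1); first by apply: le_trans h; rewrite lerDr.
  by rewrite lef_pV2 ?posrE// ler_nat.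
have st2n := st2 n; rewrite !leq_max leqnn !orbT in st2n; have {}st2n := st2n isT.
have st2j := st2 j2; rewrite !leq_max leqnn !orbT in st2j; have {}st2j := st2j isT.
have kt : 0 < kk * `|t| by rewrite mulr_gt0.
have [c] := rat_in_itvoo (ltac:(lra) : b + t - kk * `|t| < b + t - kk * `|t| / 2).
rewrite in_itv/= => /andP[c1 c2].
have [d] := rat_in_itvoo (ltac:(lra) : b + t + kk * `|t| / 2 < b + t + kk * `|t|).
rewrite in_itv/= => /andP[d1 d2].
have ktt : kk * `|t| <= `|t| by rewrite ler_piMl.
have [ta tb] : - `|t| <= t /\ t <= `|t| by split; [rewrite lerNl -normrN|]; exact: ler_norm.
have cb : `|ratr c - b| <= 2 * `|t| by rewrite ler_norml; apply/andP; split; lra.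
have db : `|ratr d - b| <= 2 * `|t| by rewrite ler_norml; apply/andP; split; lra.
have [|z /andP[cz zd] Kz] := Hn c d.
  split; [exact: le_trans cb st2n|exact: le_trans db st2n|lra|].
  by have := normr_ge0 (ratr c - b); have := normr_ge0 (ratr d - b); nra.
have zt : `|(b + t) - z| <= kk * `|t| by rewrite ler_norml; apply/andP; split; lra.
have zb : `|z - b| <= 2 * `|t|.
  have -> : z - b = t - (b + t - z) by ring.
  by apply: le_trans (ler_normB _ _) _; lra.
have tj2 : `|z - b| <= inv j2 by exact: le_trans st2j.
have h1 : `|f (a + s, b + t) - f (a + s, z)| <= L * (kk * `|t|).
  apply: le_trans (fL _ _) _; rewrite ler_wpM2l// /l1dist/= subrr normr0 add0r//.
have h2 := Kz s sj1.
have h3 := Ku2 (z - b) tj2.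
rewrite /= in h2; rewrite /= subrKC in h3.
(* An approximate slope of an L-Lipschitz function with accuracy [inv k <= 1] is at most [L + 1],
   tested at the increment [inv j2]. *)
have q2L : `|ratr q2| <= L + 1.
  have i0 : 0 < inv j2 by rewrite /inv.
  have := Ku2 (inv j2); rewrite /= gtr0_norm// => /(_ (lexx _)).
  have := fL (a, b + inv j2) (a, b); rewrite /l1dist/= subrr normr0 add0r addrAC subrr add0r (gtr0_norm i0).
  set D := f _ - _ => DL DQ.
  rewrite -(ler_pM2r i0) -[X in _ * X <= _]gtr0_norm// -normrM.
  have -> : ratr q2 * inv j2 = D - (D - ratr q2 * inv j2) by ring.
  apply: le_trans (ler_normB _ _) _; have := ler_wpM2r (ltW i0) k1; lra.
have -> : f (a + s, b + t) - f (a, b) - (ratr q1 * s + ratr q2 * t) =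
  (f (a + s, b + t) - f (a + s, z)) + (f (a + s, z) - f (a, z) - ratr q1 * s) +
  (f (a, z) - f (a, b) - ratr q2 * (z - b)) - ratr q2 * ((b + t) - z) by ring.
have h4 : `|ratr q2 * (b + t - z)| <= (L + 1) * (kk * `|t|).
  by rewrite normrM ler_pM.
apply: le_trans (ler_normB _ _) _.
apply: le_trans (lerD (le_trans (ler_normD _ _) (lerD (le_trans (ler_normD _ _) (lerD h1 h2)) h3)) h4) _.
have := ler_wpM2l (ltW k0) zb; have := ler_wpM2r (addr_ge0 s0 t0) ke.
have : 0 <= L * (kk * `|s|) by rewrite !mulr_ge0// ltW.
have : 0 <= kk * `|s| by rewrite mulr_ge0// ltW.
lra.
Qed.

End Rademacher_plane.

(** * Stretched images of rectifiable sets *)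

(* The splitting is Lagrange's identity
   Q(w) S = D (m . w)^2 + (w1 (A m2 - B m1) + w2 (B m2 - C m1))^2
   with D = A C - B^2 and S = C m1^2 - 2 B m1 m2 + A m2^2. *)
Lemma quadratic_form_split (R : realType) (A B C m1 m2 tau : R) :
  0 < A -> 0 < A * C - B ^+ 2 -> 0 <= tau ->
  (forall w1 w2, (m1 * w1 + m2 * w2) ^+ 2 <=
     tau ^+ 2 * (A * w1 ^+ 2 + 2 * B * w1 * w2 + C * w2 ^+ 2)) ->
  exists a1 a2 b1 b2 : R, forall w1 w2,
    A * w1 ^+ 2 + 2 * B * w1 * w2 + C * w2 ^+ 2 =
      (a1 * w1 + a2 * w2) ^+ 2 + (b1 * w1 + b2 * w2) ^+ 2 /\
    (m1 * w1 + m2 * w2) ^+ 2 <= tau ^+ 2 * (b1 * w1 + b2 * w2) ^+ 2.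
Proof.
move=> A0; set D := A * C - B ^+ 2 => D0 tau0 mQ.
(* Stated for any nonzero covector, since (1, 0) replaces (m1, m2) when the latter vanishes. *)
have split (k1 k2 : R) : (k1 != 0) || (k2 != 0) ->
    let S := C * k1 ^+ 2 - 2 * B * k1 * k2 + A * k2 ^+ 2 in
    0 < S /\ forall w1 w2, A * w1 ^+ 2 + 2 * B * w1 * w2 + C * w2 ^+ 2 =
      ((A * k2 - B * k1) / Num.sqrt S * w1 + (B * k2 - C * k1) / Num.sqrt S * w2) ^+ 2 +
      (Num.sqrt (D / S) * k1 * w1 + Num.sqrt (D / S) * k2 * w2) ^+ 2.
  move=> k0 S.
  have AS : A * S = (A * k2 - B * k1) ^+ 2 + D * k1 ^+ 2 by rewrite /S /D; ring.
  have S0 : 0 < S.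
    rewrite -(pmulr_rgt0 _ A0) AS.
    have [k10|k10] := eqVneq k1 0; last first.
      by rewrite ltr_wpDl ?sqr_ge0// mulr_gt0// lt_def sqr_ge0 sqrf_eq0 k10.
    move: k0; rewrite k10 eqxx/= => k20.
    rewrite mulr0 subr0 expr0n/= mulr0 addr0 lt_def sqr_ge0 sqrf_eq0 mulf_neq0//.
    by rewrite gt_eqF.
  split => // w1 w2.
  rewrite (_ : Num.sqrt (D / S) * k1 * w1 + _ = Num.sqrt (D / S) * (k1 * w1 + k2 * w2)); last by ring.
  rewrite (_ : _ + (B * k2 - C * k1) / _ * w2 =
    (w1 * (A * k2 - B * k1) + w2 * (B * k2 - C * k1)) / Num.sqrt S); last by ring.
  rewrite !exprMn exprVn !sqr_sqrtr ?(ltW S0) ?divr_ge0 ?(ltW D0) ?(ltW S0)//.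
  have F N M z : z != 0 -> (N / z + D / z * M) * z = N + D * M by move=> z0; field.
  apply: (mulIf (lt0r_neq0 S0)); rewrite F ?gt_eqF//.
  by rewrite /S /D; ring.
have [m0|m0] := boolP ((m1 != 0) || (m2 != 0)); last first.
  move: m0; rewrite negb_or !negbK => /andP[/eqP m10 /eqP m20].
  have [_ h] := split 1 0 ltac:(by rewrite oner_neq0).
  do 4! eexists; move=> w1 w2; split; first exact: h.
  by rewrite m10 m20 !mul0r addr0 expr0n/= mulr_ge0 ?sqr_ge0.
have [S0 h] := split _ _ m0; move: S0 h; set S := (X in 0 < X) => S0 h.
do 4! eexists; move=> w1 w2; split; first exact: h.
rewrite (_ : Num.sqrt (D / S) * m1 * w1 + _ = Num.sqrt (D / S) * (m1 * w1 + m2 * w2)); last by ring.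
rewrite exprMn sqr_sqrtr ?divr_ge0 ?(ltW D0) ?(ltW S0)//.
rewrite mulrA -[leLHS]mul1r ler_wpM2r ?sqr_ge0//.
rewrite mulrA ler_pdivlMr// mul1r.
(* The slope hypothesis at the vector dual to m, where the linear form equals S and the quadratic
   form equals D S; it yields S <= tau^2 D. *)
have := mQ (C * m1 - B * m2) (A * m2 - B * m1).
have -> : m1 * (C * m1 - B * m2) + m2 * (A * m2 - B * m1) = S by rewrite /S; ring.
rewrite (_ : A * _ + _ + _ = D * S); last by rewrite /S /D; ring.
by rewrite expr2 mulrA ler_pM2r.
Qed.

(** [X1] and [X2] are the coordinates of an increment across and along the gradient of the distance,
    [q] is the length of its linear image, [F] and [Ds] are the true increments of chart and
    distance. The left-hand form is (P - kap) Ds^2 + kap F^2. Its errors involve P |X2| q and P q^2,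
    which [P <= Lam ^+ 2 * kap] bounds by Lam Y and Lam^2 Y, with Y the form on the right. *)
Lemma stretched_form_bound (R : realType) (P kap Lam eta X1 X2 q F Ds : R) :
  0 < kap -> kap <= P -> P <= Lam ^+ 2 * kap -> 0 < Lam -> 0 < eta ->
  0 <= q -> q ^+ 2 = X1 ^+ 2 + X2 ^+ 2 -> 0 <= F -> F <= (1 + eta) * q ->
  `|Ds| <= (1 + 2 * eta) * `|X2| + eta * q ->
  (1 + eta) * (P * Ds ^+ 2 + kap * (F ^+ 2 - Ds ^+ 2)) <=
  ((1 + eta) * (1 + 2 * eta + eta * Lam)) ^+ 2 * (kap * X1 ^+ 2 + P * X2 ^+ 2).
Proof.
move=> k0 kP PL Lam0 eta0 q0 qX F0 Fq Dsle.
have P0 : 0 < P by exact: lt_le_trans kP.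
rewrite -[X2 ^+ 2]real_normK ?num_real// in qX *.
move: (normr_ge0 X2) Dsle qX; set x := `|X2| => x0 Dsle qX.
set Y := kap * X1 ^+ 2 + P * x ^+ 2.
have Pk : 0 <= P - kap by rewrite subr_ge0.
have Y0 : 0 <= Y by rewrite addr_ge0// mulr_ge0 ?sqr_ge0// ltW.
have kq : kap * q ^+ 2 <= Y by rewrite qX mulrDr lerD2l ler_wpM2r ?sqr_ge0.
have Pq : P * q ^+ 2 <= Lam ^+ 2 * Y.
  apply: (@le_trans _ _ (Lam ^+ 2 * (kap * q ^+ 2))).
    by rewrite mulrA ler_wpM2r ?sqr_ge0.
  by rewrite ler_wpM2l ?sqr_ge0.
have Pxq : P * (x * q) <= Lam * Y.
  have l0 : 0 <= P * (x * q) by rewrite mulr_ge0 ?(ltW P0)// mulr_ge0.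
  have r0 : 0 <= Lam * Y by rewrite mulr_ge0// ltW.
  rewrite -(ler_pXn2r (n := 2))// ?nnegrE//.
  rewrite (_ : _ ^+ 2 = (P * x ^+ 2) * (P * q ^+ 2)); last by ring.
  rewrite [leRHS](_ : _ = Y * (Lam ^+ 2 * Y)); last by ring.
  apply: ler_pM => //; rewrite ?mulr_ge0 ?sqr_ge0 ?(ltW P0)//.
  by rewrite lerDr mulr_ge0 ?sqr_ge0// ltW.
have Ds2 : Ds ^+ 2 <= ((1 + 2 * eta) * x + eta * q) ^+ 2.
  rewrite -[leLHS]real_normK ?num_real// ler_pXn2r ?nnegrE//.
  by rewrite addr_ge0// mulr_ge0 ?(ltW eta0)// addr_ge0// mulr_ge0// ltW.
have F2 : F ^+ 2 <= (1 + 2 * eta) ^+ 2 * q ^+ 2.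
  rewrite -exprMn ler_pXn2r ?nnegrE// ?mulr_ge0 ?addr_ge0 ?mulr_ge0 ?(ltW eta0)//.
  by apply: le_trans Fq _; rewrite ler_wpM2r//; lra.
rewrite (_ : P * Ds ^+ 2 + _ = (P - kap) * Ds ^+ 2 + kap * F ^+ 2); last by ring.
have key : (P - kap) * Ds ^+ 2 + kap * F ^+ 2 <= (1 + 2 * eta + eta * Lam) ^+ 2 * Y.
  apply: (@le_trans _ _ ((P - kap) * ((1 + 2 * eta) * x + eta * q) ^+ 2 +
      kap * ((1 + 2 * eta) ^+ 2 * q ^+ 2))).
    by rewrite lerD// ler_wpM2l// ltW.
  rewrite qX.
  rewrite [leLHS](_ : _ = (1 + 2 * eta) ^+ 2 * Y +
    2 * (1 + 2 * eta) * eta * (P * (x * q)) + eta ^+ 2 * (P * q ^+ 2) -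
    kap * (2 * (1 + 2 * eta) * eta * (x * q) + eta ^+ 2 * q ^+ 2)); last first.
    by rewrite /Y; ring.
  have e1 : 0 <= 2 * (1 + 2 * eta) * eta by rewrite !mulr_ge0 ?addr_ge0 ?mulr_ge0// ltW.
  have h1 := ler_wpM2l e1 Pxq; have h2 := ler_wpM2l (sqr_ge0 eta) Pq.
  have h3 : 0 <= kap * (2 * (1 + 2 * eta) * eta * (x * q) + eta ^+ 2 * q ^+ 2).
    rewrite mulr_ge0 ?(ltW k0)// addr_ge0//; first by rewrite mulr_ge0// mulr_ge0.
    by rewrite mulr_ge0 ?sqr_ge0.
  rewrite (_ : (1 + 2 * eta + eta * Lam) ^+ 2 * Y = (1 + 2 * eta) ^+ 2 * Y +
    2 * (1 + 2 * eta) * eta * (Lam * Y) + eta ^+ 2 * (Lam ^+ 2 * Y)); last by ring.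
  rewrite lerBlDr; apply: (le_trans (lerD (lerD (lexx _) h1) h2)).
  by rewrite lerDl.
rewrite [((1 + eta) * _) ^+ 2]exprMn -mulrA.
apply: (@le_trans _ _ ((1 + eta) * ((1 + 2 * eta + eta * Lam) ^+ 2 * Y))).
  by rewrite ler_wpM2l// addr_ge0// ltW.
apply: ler_wpM2r; first by rewrite mulr_ge0 ?sqr_ge0.
by rewrite expr2 ler_peMl//; lra.
Qed.

Section Pieces.
Variable R : realType.
Local Notation plane := (R * R)%type.
Local Notation H2 := (@hausdorff2 R _).

Definition linpart (p1 p2 : 'rV[R]_3) (w : plane) : 'rV[R]_3 :=
  w.1 *: p1 + w.2 *: p2.

Lemma sqr_enorm_linpart p1 p2 w : enorm (linpart p1 p2 w) ^+ 2 =
  enorm p1 ^+ 2 * w.1 ^+ 2 + 2 * (\sum_(i < 3) p1 0 i * p2 0 i) * w.1 * w.2 +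
  enorm p2 ^+ 2 * w.2 ^+ 2.
Proof.
rewrite !sqr_enorm !big_ord_recl !big_ord0 !mxE; ring.
Qed.

(** In suitable linear coordinates the linear part of [f] is an isometry and [sigma] varies
    essentially with the second one. A diagonal stretch of determinant [alpha] then dominates [Phi],
    and undoing it leads back to [f]. *)
Lemma nondegenerate_piece (K : set plane) (f Phi : plane -> 'rV[R]_3)
    (sigma : plane -> R) p1 p2 m1 m2 (c eta alpha kappa Lam : R) :
  0 < c -> 0 < eta -> eta < 1 -> 0 < kappa -> kappa <= alpha -> alpha <= Lam * kappa ->
  (forall w : plane, c * (`|w.1| + `|w.2|) <= enorm (linpart p1 p2 w)) ->
  (forall w : plane, `|m1 * w.1 + m2 * w.2| <= (1 + 2 * eta) * enorm (linpart p1 p2 w)) ->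
  (forall u v, K u -> K v -> enorm (f u - f v - linpart p1 p2 (u - v)) <=
     eta * enorm (linpart p1 p2 (u - v))) ->
  (forall u v, K u -> K v ->
     `|sigma u - sigma v - (m1 * (u.1 - v.1) + m2 * (u.2 - v.2))| <=
     eta * enorm (linpart p1 p2 (u - v))) ->
  (forall u v, K u -> K v -> enorm (Phi u - Phi v) ^+ 2 <= (1 + eta) *
     (alpha ^+ 2 / kappa * (sigma u - sigma v) ^+ 2 +
      kappa * (enorm (f u - f v) ^+ 2 - (sigma u - sigma v) ^+ 2))) ->
  (H2 (Phi @` K) <= (((1 + eta) * (1 + 2 * eta + eta * Lam) / (1 - eta)) ^+ 2 * alpha)%:E
     * H2 (f @` K))%E.
Proof.
move=> c0 eta0 eta1 k0 kal alk nondeg slope lin_f lin_s PhiK.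
set A := enorm p1 ^+ 2; set B := \sum_(i < 3) p1 0 i * p2 0 i; set C := enorm p2 ^+ 2.
have QE w : enorm (linpart p1 p2 w) ^+ 2 = A * w.1 ^+ 2 + 2 * B * w.1 * w.2 + C * w.2 ^+ 2.
  exact: sqr_enorm_linpart.
have Qpos (w : plane) : w != 0 -> 0 < enorm (linpart p1 p2 w) ^+ 2.
  move=> w0; rewrite exprn_gt0//; apply: lt_le_trans (nondeg w).
  rewrite mulr_gt0// lt_def addr_ge0// andbT paddr_eq0// !normr_eq0.
  by apply: contra w0; case: w => a b /=; rewrite xpair_eqE.
have A0 : 0 < A.
  have := Qpos (1, 0); rewrite QE/= expr1n expr0n/= !mulr0 !addr0 mulr1; apply.
  by rewrite xpair_eqE oner_eq0.
have D0 : 0 < A * C - B ^+ 2.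
  rewrite -(pmulr_rgt0 _ A0).
  have := Qpos (- B, A); rewrite QE/= (_ : _ + _ + _ = A * (A * C - B ^+ 2)); last by ring.
  by apply; rewrite xpair_eqE negb_and (gt_eqF A0) orbT.
have tau0 : 0 <= 1 + 2 * eta by lra.
have slope2 w1 w2 : (m1 * w1 + m2 * w2) ^+ 2 <= (1 + 2 * eta) ^+ 2 *
    (A * w1 ^+ 2 + 2 * B * w1 * w2 + C * w2 ^+ 2).
  rewrite -(QE (w1, w2)) -exprMn -[leLHS]real_normK ?num_real//.
  rewrite ler_pXn2r ?nnegrE ?mulr_ge0 ?enorm_ge0//.
  exact: (slope (w1, w2)).
have [a1 [a2 [b1 [b2 ab]]]] := quadratic_form_split A0 D0 tau0 slope2.
pose t (u : plane) : plane := (a1 * u.1 + a2 * u.2, b1 * u.1 + b2 * u.2).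
(* [b0] acts across the gradient and [a0] along it: their squares are [kappa] and
   [alpha ^+ 2 / kappa], their product is [alpha]. *)
pose b0 := Num.sqrt kappa; pose a0 := alpha / b0.
have b00 : 0 < b0 by rewrite sqrtr_gt0.
have al0 : 0 < alpha by exact: lt_le_trans kal.
have a00 : 0 < a0 by rewrite divr_gt0.
have b02 : b0 ^+ 2 = kappa by rewrite sqr_sqrtr// ltW.
have a02 : a0 ^+ 2 = alpha ^+ 2 / kappa by rewrite /a0 exprMn exprVn b02.
have ba : b0 * a0 = alpha by rewrite mulrCA divff ?mulr1// gt_eqF.
have tE u v : [/\ (t u).1 - (t v).1 = a1 * (u - v).1 + a2 * (u - v).2 &
    (t u).2 - (t v).2 = b1 * (u - v).1 + b2 * (u - v).2].
  by split; rewrite /t/=; ring.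
set C1 := (1 + eta) * (1 + 2 * eta + eta * Lam).
have Lam0 : 0 < Lam by rewrite -(pmulr_lgt0 _ k0); exact: lt_le_trans alk.
have C10 : 0 < C1 by rewrite mulr_gt0// ?addr_gt0// mulr_gt0.
have e10 : 0 < 1 - eta by lra.
(* The factor splits in three: [C1 ^+ 2] compares [Phi] with the stretched coordinates, [alpha] is
   the stretch itself, and the inverse square of 1 - eta compares the coordinates with [f]. *)
apply: (@le_trans _ _ ((C1 ^+ 2)%:E * H2 (dilate b0 a0 @` (t @` K)))%E).
  rewrite image_comp; apply: hausdorff2_comparison => // u v Ku Kv /=.
  rewrite -(ler_pXn2r (n := 2))// ?nnegrE ?enorm_ge0//; last first.
    by rewrite (mulr_ge0 (ltW C10))// enorm_ge0.
  apply: le_trans (PhiK u v Ku Kv) _.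
  rewrite [leRHS]exprMn sqr_enorm_dilate.
  have [-> ->] := tE u v; have [Qw mw] := ab (u - v).1 (u - v).2.
  rewrite -QE in Qw.
  have := lin_f u v Ku Kv; have := lin_s u v Ku Kv.
  rewrite b02 a02.
  set w := u - v in Qw mw * => sw fw; rewrite -[u.1 - v.1]/w.1 -[u.2 - v.2]/w.2 in sw.
  have q0 := enorm_ge0 (linpart p1 p2 w).
  apply: (stretched_form_bound (q := enorm (linpart p1 p2 w))) => //.
  - by rewrite ler_pdivlMr// -expr2 ler_pXn2r ?nnegrE ?(ltW k0)// ltW.
  - rewrite ler_pdivrMr// -mulrA -expr2 -exprMn ler_pXn2r ?nnegrE ?(ltW al0)//.
    by rewrite mulr_ge0// ltW.
  - exact: enorm_ge0.
  - have := enorm_triangle (f u - f v) (linpart p1 p2 w) 0.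
    have := enorm_triangle (linpart p1 p2 w) (f u - f v) 0.
    rewrite !subr0; lra.
  - have mx : `|m1 * w.1 + m2 * w.2| <= (1 + 2 * eta) * `|b1 * w.1 + b2 * w.2|.
      rewrite -(ler_pXn2r (n := 2))// ?nnegrE ?mulr_ge0//.
      by rewrite exprMn !real_normK ?num_real.
    have := ler_normD (sigma u - sigma v - (m1 * w.1 + m2 * w.2)) (m1 * w.1 + m2 * w.2).
    rewrite subrK; lra.
apply: (@le_trans _ _ ((C1 ^+ 2 * alpha)%:E * H2 (dilate 1 1 @` (t @` K)))%E).
  rewrite [(C1 ^+ 2 * alpha)%:E]EFinM -muleA; apply: lee_wpmul2l; first by rewrite lee_fin sqr_ge0.
  by rewrite -ba; exact: hausdorff2_dilate_le.
rewrite (_ : (C1 / (1 - eta)) ^+ 2 * alpha = C1 ^+ 2 * alpha * (1 - eta)^-1 ^+ 2); last first.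
  by rewrite expr_div_n exprVn; ring.
rewrite [(C1 ^+ 2 * alpha * _)%:E]EFinM -muleA; apply: lee_wpmul2l.
  by rewrite lee_fin mulr_ge0 ?sqr_ge0// ltW.
rewrite image_comp; apply: hausdorff2_comparison; first by rewrite invr_gt0.
move=> u v Ku Kv /=; rewrite mulrC ler_pdivlMr//.
have -> : enorm (dilate 1 1 (t u) - dilate 1 1 (t v)) = enorm (linpart p1 p2 (u - v)).
  apply/eqP; rewrite -(eqrXn2 (n := 2))// ?enorm_ge0// sqr_enorm_dilate.
  have [-> ->] := tE u v; have [Qw _] := ab (u - v).1 (u - v).2.
  by rewrite QE Qw !expr1n !mul1r.
have := lin_f u v Ku Kv; set w := linpart _ _ _.
have := enorm_triangle (f u - f v) w 0; rewrite !subr0 [enorm (w - _)]enormC; lra.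
Qed.

(** After a rotation the image of [f] is dominated by a thin stretch: since the l1 distance is at
    most 2 (|X| + |Y|), the factors are eta + 2 eta and 2 Lam + 2 eta. Passing from a sum of two
    terms to a Euclidean norm costs another 2, squared; in total 4 * 3 * 2 = 24. *)
Lemma degenerate_piece (K : set plane) (f : plane -> 'rV[R]_3) p1 p2 (c s eta Lam : R) :
  c ^+ 2 + s ^+ 2 = 1 -> 0 < eta -> 0 <= Lam ->
  enorm (linpart p1 p2 (c, s)) <= eta ->
  (forall w : plane, enorm (linpart p1 p2 w) <= Lam * (`|w.1| + `|w.2|)) ->
  (forall u v, K u -> K v -> enorm (f u - f v - linpart p1 p2 (u - v)) <=
     eta * l1dist u v) ->
  (H2 (f @` K) <= (24 * eta * (Lam + eta))%:E * H2 (dilate 1 1 @` K))%E.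
Proof.
move=> cs eta0 Lam0 w0 qL lin_f.
pose rot (u : plane) : plane := (c * u.1 + s * u.2, c * u.2 - s * u.1).
have c1 : `|c| <= 1.
  by rewrite -(ler_pXn2r (n := 2))// ?nnegrE// real_normK ?num_real// expr1n -cs lerDl sqr_ge0.
have s1 : `|s| <= 1.
  by rewrite -(ler_pXn2r (n := 2))// ?nnegrE// real_normK ?num_real// expr1n -cs lerDr sqr_ge0.
have e3 : 0 < 3 * eta by rewrite mulr_gt0.
have l2 : 0 < 2 * (Lam + eta) by rewrite mulr_gt0// ltr_wpDl.
apply: (@le_trans _ _ ((2 ^+ 2)%:E * H2 (dilate (3 * eta) (2 * (Lam + eta)) @` (rot @` K)))%E).
  rewrite image_comp; apply: hausdorff2_comparison => // u v Ku Kv /=.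
  set w := u - v.
  pose X := c * w.1 + s * w.2; pose Y := c * w.2 - s * w.1.
  have wX : w.1 = X * c - Y * s.
    by rewrite -[LHS]mul1r -cs /X /Y; ring.
  have wY : w.2 = X * s + Y * c.
    by rewrite -[LHS]mul1r -cs /X /Y; ring.
  have lw : l1dist u v <= 2 * (`|X| + `|Y|).
    rewrite /l1dist -[u.1 - v.1]/w.1 -[u.2 - v.2]/w.2 wX wY.
    have n1 := ler_normB (X * c) (Y * s); have n2 := ler_normD (X * s) (Y * c).
    rewrite !normrM in n1 n2; have X0 := normr_ge0 X; have Y0 := normr_ge0 Y.
    have := ler_wpM2l X0 c1; have := ler_wpM2l X0 s1.
    have := ler_wpM2l Y0 c1; have := ler_wpM2l Y0 s1; lra.
  have qw : enorm (linpart p1 p2 w) <= eta * `|X| + 2 * Lam * `|Y|.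
    have -> : linpart p1 p2 w = X *: linpart p1 p2 (c, s) + Y *: linpart p1 p2 (- s, c).
      rewrite /linpart wX wY /= !scalerDr !scalerA addrACA -!scalerDl.
      by congr (_ *: _ + _ *: _); ring.
    apply: le_trans (ler_enormD _ _) _; rewrite !enormZ lerD//.
      by rewrite mulrC ler_wpM2r.
    rewrite mulrC ler_wpM2r// (le_trans (qL _))//= mulrC ler_wpM2r// normrN; lra.
  have fuv : enorm (f u - f v) <= 3 * eta * `|X| + 2 * (Lam + eta) * `|Y|.
    have := enorm_triangle (f u - f v) (linpart p1 p2 w) 0.
    have := enorm_triangle (linpart p1 p2 w) (f u - f v) 0.
    rewrite !subr0; have := lin_f u v Ku Kv; have := ler_wpM2l (ltW eta0) lw.
    rewrite -/w; lra.
  apply: le_trans fuv _.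
  have X0 := mulr_ge0 (ltW e3) (normr_ge0 X); have Y0 := mulr_ge0 (ltW l2) (normr_ge0 Y).
  rewrite -(ler_pXn2r (n := 2))// ?nnegrE ?mulr_ge0 ?enorm_ge0 ?addr_ge0//.
  rewrite exprMn sqr_enorm_dilate/=.
  rewrite (_ : c * u.1 + s * u.2 - _ = X); last by rewrite /X /w/=; ring.
  rewrite (_ : c * u.2 - s * u.1 - _ = Y); last by rewrite /Y /w/=; ring.
  rewrite -[X ^+ 2]real_normK ?num_real// -[Y ^+ 2]real_normK ?num_real//.
  rewrite -![_ ^+ 2 * `|_| ^+ 2]exprMn.
  set a := 3 * eta * _; set b := 2 * (Lam + eta) * _.
  have := sqr_ge0 (a - b); have := sqr_ge0 a; have := sqr_ge0 b; nra.
rewrite (_ : 24 * eta * (Lam + eta) = 2 ^+ 2 * (3 * eta * (2 * (Lam + eta)))); last by ring.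
rewrite [(2 ^+ 2 * _)%:E]EFinM -muleA; apply: lee_wpmul2l; first by rewrite lee_fin sqr_ge0.
apply: le_trans (hausdorff2_dilate_le _ e3 l2) _.
apply: lee_wpmul2l; first by rewrite lee_fin mulr_ge0// ltW.
rewrite -[leRHS]mul1e -(expr1n R 2) image_comp; apply: hausdorff2_comparison => // u v _ _ /=.
rewrite mul1r -(ler_pXn2r (n := 2))// ?nnegrE ?enorm_ge0// !sqr_enorm_dilate/=.
rewrite !expr1n !mul1r.
rewrite (_ : _ + _ = (c ^+ 2 + s ^+ 2) * ((u.1 - v.1) ^+ 2 + (u.2 - v.2) ^+ 2)); last by ring.
by rewrite cs mul1r.
Qed.

End Pieces.

(** * Decomposition of a chart into almost linear pieces *)

Section Linearization.
Variable R : realType.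
Local Notation plane := (R * R)%type.
Local Notation H2 := (@hausdorff2 R _).
Local Notation leb2 := (@lebesgue1 R \x @lebesgue1 R)%E.

Definition l1norm (w : plane) : R := `|w.1| + `|w.2|.

Lemma l1norm_ge0 w : 0 <= l1norm w.
Proof. by rewrite addr_ge0. Qed.

(** Carries inequalities from small increments, where the chart controls its linear part, to all
    increments, where only homogeneity is available. *)
Lemma homogeneous_small (P : plane -> Prop) (d : R) : 0 < d ->
  (forall w, l1norm w <= d -> P w) ->
  (forall t w, 0 < t -> P (t * w.1, t * w.2) -> P w) -> forall w, P w.
Proof.
move=> d0 Pd Pt w; have w0 := l1norm_ge0 w.
have wd : 0 < l1norm w + d by rewrite ltr_wpDl.
have t0 : 0 < d / (l1norm w + d) by rewrite divr_gt0.
apply: (Pt (d / (l1norm w + d))) => //; apply: Pd.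
rewrite {1}/l1norm !(normrM (d / _)) (gtr0_norm t0) -mulrDr -/(l1norm w).
by rewrite mulrAC ler_pdivrMr// ler_wpM2l ?(ltW d0)// lerDl ltW.
Qed.

Lemma linpart_scale p1 p2 (t : R) (w : plane) :
  linpart p1 p2 (t * w.1, t * w.2) = t *: linpart p1 p2 w.
Proof. by rewrite /linpart/= scalerDr !scalerA. Qed.

Definition cell (a b d : R) : set plane := [set u | l1dist u (a, b) <= d].

Lemma cell_compact a b d : compact (cell a b d).
Proof.
have cl : closed (cell a b d).
  apply: (@preimage_closed _ _ (fun u => l1dist u (a, b)) [set z | z <= d]); last exact: closed_le.
  move=> u _; apply: (@l1_lipschitz_continuous_real _ _ 1) => v w; rewrite mul1r /l1dist/=.
  apply: (@le_trans _ _ (Num.norm (`|v.1 - a| - `|w.1 - a|) + Num.norm (`|v.2 - b| - `|w.2 - b|))).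
    by rewrite opprD addrACA ler_normD.
  apply: lerD; apply: le_trans (ler_dist_dist _ _) _; rewrite le_eqVlt; apply/orP; left; apply/eqP; congr `|_|; ring.
apply: (subclosed_compact cl (compact_setX (@segment_compact _ (a - d) (a + d))
  (@segment_compact _ (b - d) (b + d)))).
move=> [x y]; rewrite /cell/l1dist/= => h; rewrite !in_itv/=.
have := normr_ge0 (x - a); have := normr_ge0 (y - b) => y0 x0.
have : `|x - a| <= d by lra.
have : `|y - b| <= d by lra.
by rewrite !ler_norml => /andP[? ?] /andP[? ?]; split; apply/andP; split; lra.
Qed.

Lemma compact_image_closed (f : plane -> 'rV[R]_3) (L : R) (K : set plane) :
  (forall u v, enorm (f u - f v) <= L * l1dist u v) -> compact K -> closed (f @` K).
Proof.
move=> fL cK; apply: compact_closed; first exact: norm_hausdorff.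
apply: continuous_compact => //; apply: continuous_subspaceT.
exact: l1_lipschitz_continuous fL.
Qed.

Section Pieces_of_a_chart.
Variables (f : plane -> 'rV[R]_3) (L : R) (x : 'rV[R]_3).
Hypothesis L0 : 0 < L.
Hypothesis fL : forall u v, enorm (f u - f v) <= L * l1dist u v.
Let sigma (u : plane) : R := enorm (f u - x).

Let sigmaL u v : `|sigma u - sigma v| <= enorm (f u - f v).
Proof.
apply: le_trans (ler_dist_enorm _ _) _.
by rewrite opprB addrA subrK.
Qed.

(** The chart and the distance to [x] along it are linearized at the same scale, since the gradient
    of the latter is the direction of the stretch. *)
Definition linear_near (p1 p2 : 'rV[R]_3) (m1 m2 e d : R) : set plane :=
  [set u | forall w, l1norm w <= d ->
    enorm (f (u + w) - f u - linpart p1 p2 w) <= e * l1norm w /\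
    `|sigma (u + w) - sigma u - (m1 * w.1 + m2 * w.2)| <= e * l1norm w].

Lemma linear_near_closed p1 p2 m1 m2 e d : closed (linear_near p1 p2 m1 m2 e d).
Proof.
rewrite (_ : linear_near p1 p2 m1 m2 e d = \bigcap_(w in [set w | l1norm w <= d])
   ([set u | enorm (f (u + w) - f u - linpart p1 p2 w) <= e * l1norm w] `&`
    [set u | `|sigma (u + w) - sigma u - (m1 * w.1 + m2 * w.2)| <= e * l1norm w]))//.
have dD (u v w : plane) : l1dist (u + w) (v + w) = l1dist u v.
  have E (z z' t : R) : z + t - (z' + t) = z - z' by ring.
  by rewrite /l1dist/= !E.
apply: closed_bigI => w _; apply: closedI.
  apply: (@preimage_closed plane R (fun u : plane => enorm (f (u + w) - f u - linpart p1 p2 w))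
    [set z | z <= e * l1norm w]); last exact: closed_le.
  move=> u _; apply: (@l1_lipschitz_continuous_real _ _ (L + L)) => v v'.
  apply: le_trans (ler_dist_enorm _ _) _.
  rewrite (_ : _ - _ = (f (v + w) - f (v' + w)) + (f v' - f v)); last first.
    by apply/rowP => i; rewrite !mxE; ring.
  apply: le_trans (ler_enormD _ _) _; rewrite mulrDl lerD//.
    by rewrite -(dD v v' w).
  by rewrite enormC.
apply: (@preimage_closed plane R (fun u : plane => `|sigma (u + w) - sigma u - (m1 * w.1 + m2 * w.2)|)
    [set z | z <= e * l1norm w]); last exact: closed_le.
move=> u _; apply: (@l1_lipschitz_continuous_real _ _ (L + L)) => v v'.
apply: le_trans (ler_dist_dist _ _) _.
rewrite (_ : _ - _ = (sigma (v + w) - sigma (v' + w)) + (sigma v' - sigma v)); last by ring.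
apply: le_trans (ler_normD _ _) _; rewrite mulrDl lerD//; apply: le_trans (sigmaL _ _) _.
  by rewrite -(dD v v' w).
by rewrite enormC.
Qed.

Definition row3 (r : rat * rat * rat) : 'rV[R]_3 :=
  \row_(i < 3) ratr (if i == 0 then r.1.1 else if i == 1 then r.1.2 else r.2).

Definition chart_index := ((rat * rat * rat) * (rat * rat * rat) * (rat * rat) * nat * (rat * rat))%type.

(** The coefficients are rational, so the pieces form a countable family. The cell has half the
    radius of linearization, so that any two points of a piece can be compared. *)
Definition piece (e : R) (i : chart_index) : set plane :=
  let: (p1, p2, m, j, c) := i in
  linear_near (row3 p1) (row3 p2) (ratr m.1) (ratr m.2) e j.+1%:R^-1 `&`
  cell (ratr c.1) (ratr c.2) (j.+1%:R^-1 / 2).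

Lemma piece_compact e i : compact (piece e i).
Proof.
case: i => [[[[p1 p2] m] j] c]; rewrite /piece setIC; apply: compact_closedI.
  exact: cell_compact.
exact: linear_near_closed.
Qed.

(** Rademacher's theorem for the three coordinates, each with accuracy e / 3, and for the distance
    [sigma], at the finest of the four scales. *)
Lemma linear_approx_ae : exists N : set plane,
  [/\ measurable N, leb2 N = 0%E & forall u, ~ N u -> forall e, 0 < e ->
    exists i, piece e i u].
Proof.
have coordL i u v : `|f u 0 i - f v 0 i| <= L * l1dist u v.
  by apply: le_trans (fL u v); have := ler_coord_enorm (f u - f v) i; rewrite !mxE.
have sL u v : `|sigma u - sigma v| <= L * l1dist u v by exact: le_trans (sigmaL _ _) _.
have [N0 [mN0 nN0 h0]] := Rademacher_plane (coordL 0).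
have [N1 [mN1 nN1 h1]] := Rademacher_plane (coordL 1).
have [N2 [mN2 nN2 h2]] := Rademacher_plane (coordL ord_max).
have [N3 [mN3 nN3 h3]] := Rademacher_plane sL.
exists ((N0 `|` N1) `|` (N2 `|` N3)); split.
- by apply: measurableU; exact: measurableU.
- have m01 := measurableU _ _ mN0 mN1; have m23 := measurableU _ _ mN2 mN3.
  apply: (measure_negligible (measurableU _ _ m01 m23)).
  apply: negligibleU; apply: negligibleU; exact/(negligibleP leb2).
move=> u nN e e0.
have [n0 n1 n2 n3] : [/\ ~ N0 u, ~ N1 u, ~ N2 u & ~ N3 u].
  by split => nu; apply: nN; [left; left|left; right|right; left|right; right].
have e3 : 0 < e / 3 by rewrite divr_gt0.
have [a0 [b0 [j0 H0]]] := h0 u n0 _ e3.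
have [a1 [b1 [j1 H1]]] := h1 u n1 _ e3.
have [a2 [b2 [j2 H2]]] := h2 u n2 _ e3.
have [a3 [b3 [j3 H3]]] := h3 u n3 _ e0.
pose j := maxn (maxn j0 j1) (maxn j2 j3).
have ratclose (z d : R) : 0 < d -> exists q : rat, `|z - ratr q| <= d.
  move=> d0; have [q] := rat_in_itvoo (ltac:(lra) : z - d < z + d).
  by rewrite in_itv/= => /andP[q1 q2]; exists q; rewrite ler_norml; apply/andP; split; lra.
have d0 : 0 < j.+1%:R^-1 / 4 :> R by rewrite divr_gt0.
have [c1 hc1] := ratclose u.1 _ d0; have [c2 hc2] := ratclose u.2 _ d0.
exists ((a0, a1, a2), (b0, b1, b2), (a3, b3), j, (c1, c2)); split; last first.
  rewrite /cell/l1dist/=; apply: le_trans (lerD hc1 hc2) _.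
  by move: (j.+1%:R^-1 : R) => z; lra.
move=> w wj /=.
have wm k : (k <= j)%N -> l1norm w <= k.+1%:R^-1.
  by move=> kj; apply: le_trans wj _; rewrite lef_pV2 ?posrE// ler_nat.
have dw : l1dist (u + w) u = l1norm w by rewrite /l1dist/l1norm/= addrAC subrr add0r addrAC subrr add0r.
have uw1 : (u + w).1 - u.1 = w.1 by rewrite /=; ring.
have uw2 : (u + w).2 - u.2 = w.2 by rewrite /=; ring.
have := H0 (u + w); have := H1 (u + w); have := H2 (u + w); have := H3 (u + w).
rewrite dw uw1 uw2.
move=> /(_ (wm _ _)); rewrite !leq_max leqnn !orbT => /(_ isT) K3.
move=> /(_ (wm _ _)); rewrite !leq_max leqnn !orbT => /(_ isT) K2.
move=> /(_ (wm _ _)); rewrite !leq_max leqnn !orbT => /(_ isT) K1.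
move=> /(_ (wm _ _)); rewrite !leq_max leqnn => /(_ isT) K0.
split; last exact: K3.
apply: le_trans (enorm_le_sum _) _.
rewrite !big_ord_recl big_ord0 !mxE/= addr0.
have -> : lift ord0 ord0 = 1 :> 'I_3 by apply: val_inj.
have -> : lift ord0 (lift ord0 ord0) = ord_max :> 'I_3 by apply: val_inj.
rewrite ![w.1 * _]mulrC ![w.2 * _]mulrC.
apply: le_trans (lerD K0 (lerD K1 K2)) _.
lra.
Qed.

Lemma null_image (N : set plane) : measurable N -> leb2 N = 0%E -> H2 (f @` N) = 0%E.
Proof.
move=> mN nN; apply/eqP; rewrite eq_le hausdorff2_ge0 andbT.
apply: (@le_trans _ _ (((2 * L) ^+ 2)%:E * H2 (dilate 1 1 @` N))%E); last first.
  by rewrite hausdorff2_null// mule0.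
apply: hausdorff2_comparison; first by rewrite mulr_gt0.
move=> u v _ _; apply: le_trans (fL u v) _; rewrite [2 * L]mulrC -mulrA.
rewrite ler_wpM2l ?(ltW L0)// /l1dist mulr_natl mulr2n.
have := ler_coord_enorm (dilate 1 1 u - dilate 1 1 v) 0.
have := ler_coord_enorm (dilate 1 1 u - dilate 1 1 v) ord_max.
rewrite !mxE/= !mul1r => h1 h2; exact: lerD.
Qed.

(** Injectivity of the derivative, in quantitative form and without naming the derivative; countably
    many constants suffice. *)
Definition regular_point (u : plane) := exists n j : nat,
  forall w, l1norm w <= j.+1%:R^-1 -> n.+1%:R^-1 * l1norm w <= enorm (f (u + w) - f u).

Let linear_near_small p1 p2 m1 m2 e d u : 0 < d -> linear_near p1 p2 m1 m2 e d u ->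
  forall (P : plane -> Prop),
  (forall w, enorm (f (u + w) - f u - linpart p1 p2 w) <= e * l1norm w ->
    `|sigma (u + w) - sigma u - (m1 * w.1 + m2 * w.2)| <= e * l1norm w -> l1norm w <= d -> P w) ->
  (forall t w, 0 < t -> P (t * w.1, t * w.2) -> P w) -> forall w, P w.
Proof.
move=> d0 lu P h; apply: (homogeneous_small d0) => w wd.
by have [h1 h2] := lu w wd; exact: h.
Qed.

Let l1norm_scale t (w : plane) : 0 < t -> l1norm (t * w.1, t * w.2) = t * l1norm w.
Proof. by move=> t0; rewrite /l1norm/= !normrM gtr0_norm// mulrDr. Qed.

Let enorm_linpart_scale p1 p2 t (w : plane) : 0 < t ->
  enorm (linpart p1 p2 (t * w.1, t * w.2)) = t * enorm (linpart p1 p2 w).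
Proof. by move=> t0; rewrite linpart_scale enormZ gtr0_norm. Qed.

Let piece_pair e i u v : piece e i u -> piece e i v ->
  let: (p1, p2, m, j, c) := i in
  enorm (f u - f v - linpart (row3 p1) (row3 p2) (u - v)) <= e * l1norm (u - v) /\
  `|sigma u - sigma v - (ratr m.1 * (u.1 - v.1) + ratr m.2 * (u.2 - v.2))| <= e * l1norm (u - v).
Proof.
case: i => [[[[p1 p2] m] j] c] [_ cu] [lv cv].
have uv : l1norm (u - v) <= j.+1%:R^-1.
  move: cu cv; rewrite /cell/l1dist/l1norm/= => cu cv.
  have := ler_distD (ratr c.1) u.1 v.1; have := ler_distD (ratr c.2) u.2 v.2.
  rewrite [`|ratr c.1 - v.1|]distrC [`|ratr c.2 - v.2|]distrC.
  move: (j.+1%:R^-1 : R) cu cv => z; lra.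
by have := lv (u - v) uv; rewrite subrKC.
Qed.

(** The sets [C k] enumerate the images of pieces with a nondegenerate linear part, each cut by one
    [W l]. Images of pieces are compact, so the [C k] are closed. *)
Lemma good_pieces (phi : 'rV[R]_3 -> 'rV[R]_3) (W : nat -> set 'rV[R]_3)
    (kappa : nat -> R) (alpha eta Lam : R) :
  0 < eta -> eta < 1 -> (forall k, closed (W k)) ->
  (forall k, [/\ 0 < kappa k, kappa k <= alpha & alpha <= Lam * kappa k]) ->
  (forall k y z, W k y -> W k z -> enorm (phi y - phi z) ^+ 2 <= (1 + eta) *
     (alpha ^+ 2 / kappa k * (enorm (y - x) - enorm (z - x)) ^+ 2 +
      kappa k * (enorm (y - z) ^+ 2 - (enorm (y - x) - enorm (z - x)) ^+ 2))) ->
  exists C : nat -> set 'rV[R]_3, [/\ forall k, closed (C k),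
    forall k A, A `<=` C k -> (H2 (phi @` A) <=
      (((1 + eta) * (1 + 2 * eta + eta * Lam) / (1 - eta)) ^+ 2 * alpha)%:E * H2 A)%E &
    forall u, (forall e, 0 < e -> exists i, piece e i u) -> regular_point u ->
      (exists k, W k (f u)) -> exists k, C k (f u)].
Proof.
move=> eta0 eta1 clW kap phiW.
(* With the lower bound 1 / (2 (n + 1)) on the linear part, an error [en n] is at most [eta] times
   the length of the linear image. *)
pose en n : R := eta / (2 * n.+1%:R).
have en0 n : 0 < en n by rewrite divr_gt0// mulr_gt0.
pose good n (i : chart_index) := let: (p1, p2, m, j, c) := i in
  forall w, (2 * n.+1%:R)^-1 * l1norm w <= enorm (linpart (row3 p1) (row3 p2) w).
pose C' (i : chart_index * nat * nat) : set 'rV[R]_3 :=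
  if pselect (good i.1.2 i.1.1) then (f @` piece (en i.1.2) i.1.1) `&` W i.2 else set0.
pose C k := if unpickle k is Some i then C' i else set0.
exists C; split.
- move=> k; rewrite /C; case: (unpickle k) => [i|]; last exact: closed0.
  rewrite /C'; case: pselect => [?|?]; last exact: closed0.
  apply: closedI => //; apply: (compact_image_closed fL); exact: piece_compact.
- move=> k A; rewrite /C; case: (unpickle k) => [[[i n] l]|]; last first.
    by rewrite subset0 => ->; rewrite image_set0 hausdorff20 mule0.
  rewrite /C'/=; case: pselect => [gi|?]; last first.
    by rewrite subset0 => ->; rewrite image_set0 hausdorff20 mule0.
  move=> AC; pose K := piece (en n) i `&` f @^-1` A.
  have AK : A = f @` K.
    apply/seteqP; split => [y Ay|_ [u [_ Au] <-]//].
    by have [[u pu uy] _] := AC y Ay; exists u => //; split => //; rewrite /preimage/= uy.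
  have [[u0 [pu0 _]]|K0] := pselect (K !=set0); last first.
    have -> : A = set0 by rewrite AK; apply/seteqP; split => // y [u Ku _]; apply: K0; exists u.
    by rewrite image_set0 hausdorff20 mule0.
  have [k0 kal alk] := kap l.
  have enle w z : (2 * n.+1%:R)^-1 * z <= w -> en n * z <= eta * w.
    by move=> h; rewrite /en -mulrA ler_wpM2l// ltW.
  have pair u v := @piece_pair (en n) i u v.
  move: i gi pu0 pair @K AK AC => [[[[p1 p2] m] j] c] gi pu0 pair K AK AC.
  rewrite {1}AK [in leRHS]AK image_comp.
  have c0 : 0 < (2 * n.+1%:R)^-1 :> R by rewrite invr_gt0 mulr_gt0.
  apply: (nondegenerate_piece (f := f) (Phi := phi \o f) (sigma := sigma)
    (p1 := row3 p1) (p2 := row3 p2) (m1 := ratr m.1) (m2 := ratr m.2) c0 eta0 eta1 k0 kal alk gi) => //.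
  (* [sigma] varies at most as much as [f]; the approximation errors of both give the slope bound 1
     + 2 eta for small increments, and homogeneity gives it for all. *)
  + have [lu0 _] := pu0; have d0 : 0 < j.+1%:R^-1 :> R by rewrite invr_gt0.
    apply: (linear_near_small d0 lu0) => [w h1 h2 _|t w t0]; last first.
      rewrite enorm_linpart_scale// [leRHS]mulrCA/=.
      have -> : ratr m.1 * (t * w.1) + ratr m.2 * (t * w.2) = t * (ratr m.1 * w.1 + ratr m.2 * w.2) by ring.
      by rewrite normrM gtr0_norm// ler_pM2l.
    have := enle _ _ (gi w) => ew.
    have s1 := sigmaL (u0 + w) u0.
    have s2 := enorm_triangle (f (u0 + w) - f u0) (linpart (row3 p1) (row3 p2) w) 0.
    have s3 := ler_normB (sigma (u0 + w) - sigma u0) (sigma (u0 + w) - sigma u0 - (ratr m.1 * w.1 + ratr m.2 * w.2)).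
    have e3 : sigma (u0 + w) - sigma u0 - (sigma (u0 + w) - sigma u0 - (ratr m.1 * w.1 + ratr m.2 * w.2)) = ratr m.1 * w.1 + ratr m.2 * w.2 by ring.
    rewrite e3 in s3; rewrite !subr0 in s2.
    have s4 := ler_enormD (f (u0 + w) - f u0 - linpart (row3 p1) (row3 p2) w) (linpart (row3 p1) (row3 p2) w).
    rewrite subrK in s4; lra.
  + by move=> u v [pu _] [pv _]; have [h _] := pair u v pu pv; apply: le_trans h _; apply: enle; exact: gi.
  + by move=> u v [pu _] [pv _]; have [_ h] := pair u v pu pv; apply: le_trans h _; apply: enle; exact: gi.
  + move=> u v [_ Au] [_ Av]; apply: phiW.
      by have [_] := AC _ Au.
    by have [_] := AC _ Av.
move=> u apx [n [j1 reg]] [l Wl].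
have [i pi] := apx _ (en0 n).
exists (pickle (i, n, l)); rewrite /C pickleK /C'/=.
case: pselect => [gi|[]]; first by split => //; exists u.
move: i pi => [[[[p1 p2] m] j] c] [lu _]; rewrite /good.
(* Half of the regularity constant 1 / (n + 1) absorbs the error [en n]; the other half is the bound
   required by [good]. *)
have d0 : 0 < Num.min j.+1%:R^-1 j1.+1%:R^-1 :> R by rewrite lt_min !invr_gt0 !ltr0n.
apply: (homogeneous_small d0) => [w|t w t0]; last first.
  by rewrite l1norm_scale// enorm_linpart_scale// mulrCA ler_pM2l.
rewrite le_min => /andP[wj wj1].
have [h1 _] := lu w wj; have h2 := reg w wj1.
have h3 := enorm_triangle (linpart (row3 p1) (row3 p2) w) (f (u + w) - f u) 0.
rewrite !subr0 in h3.
have h4 : en n * l1norm w <= (2 * n.+1%:R)^-1 * l1norm w.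
  rewrite ler_wpM2r ?l1norm_ge0// /en -[leRHS]mul1r ler_wpM2r ?invr_ge0 ?mulr_ge0//.
  exact: ltW.
have h5 z : z != 0 -> z^-1 * l1norm w = (2 * z)^-1 * l1norm w + (2 * z)^-1 * l1norm w.
  by move=> z0; rewrite -mulrDl; congr (_ * _); field.
rewrite (h5 n.+1%:R) ?pnatr_eq0// in h2.
by move: ((2 * n.+1%:R)^-1 * l1norm w) h2 h4 => z h2 h4; lra.
Qed.

(** At accuracy [eta] such points lie in pieces whose linear part nearly kills a unit vector, and
    their images have measure O(eta) times the planar measure. Summed over disjoint pieces in a
    bounded box this tends to 0 with [eta]. *)
Lemma singular_image_null :
  H2 (f @` [set u | (forall e, 0 < e -> exists i, piece e i u) /\ ~ regular_point u]) = 0%E.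
Proof.
set B := [set u | _].
suff BS n : H2 (f @` (B `&` box ((- n%:R, n%:R), (- n%:R, n%:R)))) = 0%E.
  apply/eqP; rewrite eq_le hausdorff2_ge0 andbT.
  have -> : f @` B = \bigcup_n (f @` (B `&` box ((- n%:R, n%:R), (- n%:R, n%:R)))).
    rewrite -image_bigcup -setI_bigcupr bigcup_boxes setIT//.
  apply: le_trans (hausdorff2_sigma_subadditive _) _.
  by rewrite eseries0.
set S := box _.
have [kappa kap0 kapE] := hausdorff2_box R.
have Sfin : (H2 (dilate 1 1 @` S) < +oo)%E.
  rewrite kapE ?ltry// lerNl (le_trans _ (ler0n _ _))// oppr_le0//.
pose mu : {measure set plane -> \bar R} := planar_measure (PosNum (@ltr01 R)) (PosNum (@ltr01 R)).
(* The degenerate bound with 4 eta in place of eta and L + 1 as bound on the linear part, which is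
   at most L + eta. *)
pose c0 eta : R := 24 * (4 * eta) * (L + 1 + 4 * eta).
have key eta : 0 < eta -> eta < 1 -> (H2 (f @` (B `&` S)) <= (c0 eta)%:E * mu S)%E.
  move=> eta0 eta1.
  pose sing (i : chart_index) := let: (p1, p2, m, j, c) := i in
    exists c s : R, c ^+ 2 + s ^+ 2 = 1 /\ enorm (linpart (row3 p1) (row3 p2) (c, s)) <= 4 * eta.
  pose D' i := if pselect (sing i) then piece eta i else set0.
  pose D k := if unpickle k is Some i then D' i else set0.
  have mD k : measurable (D k).
    rewrite /D; case: (unpickle k) => [i|]; last exact: measurable0.
    rewrite /D'; case: pselect => [?|?]; last exact: measurable0.
    apply: closed_measurable_plane; apply: compact_closed; last exact: piece_compact.
    exact: norm_hausdorff.
  have BD : B `<=` \bigcup_k D k.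
    move=> u [apx nreg]; have [i pi] := apx _ eta0.
    exists (pickle i); first exact: Logic.I.
    rewrite /D pickleK /D'; case: pselect => [?|[]]; first exact: pi.
    move: i pi => [[[[p1 p2] m] j] c] [lu _].
    (* Failure of regularity at 1 / (n' + 1) <= eta gives w whose increment of f is below eta times
       its l1 norm. With the linearization error this is 2 eta in the l1 norm, hence 4 eta in the
       Euclidean one. *)
    pose n' := Num.truncn eta^-1.
    have neta : n'.+1%:R^-1 <= eta.
      by rewrite ltW// invf_plt ?posrE//; exact: truncnS_gt.
    have [w wj hw] : exists2 w, l1norm w <= j.+1%:R^-1 &
        enorm (f (u + w) - f u) < n'.+1%:R^-1 * l1norm w.
      apply: contrapT => nw; apply: nreg; exists n', j => w wj.
      by rewrite leNgt; apply/negP => hw; apply: nw; exists w.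
    have [h1 _] := lu w wj.
    pose N := Num.sqrt (w.1 ^+ 2 + w.2 ^+ 2).
    have w0 : 0 < l1norm w.
      rewrite lt_def l1norm_ge0 andbT; apply/eqP => w0.
      by move: hw; rewrite w0 mulr0 ltNge enorm_ge0.
    have NN : 0 <= w.1 ^+ 2 + w.2 ^+ 2 by rewrite addr_ge0// sqr_ge0.
    have wN : l1norm w <= 2 * N.
      rewrite /l1norm mulr_natl mulr2n /N lerD// -sqrtr_sqr ler_wsqrtr//.
        by rewrite lerDl sqr_ge0.
      by rewrite lerDr sqr_ge0.
    have N0 : 0 < N by lra.
    exists (N^-1 * w.1), (N^-1 * w.2); split.
      by rewrite !exprMn -mulrDr exprVn -(sqr_sqrtr NN) -/N mulVf// expf_neq0// gt_eqF.
    rewrite (enorm_linpart_scale _ _ _ (_ : 0 < N^-1)) ?invr_gt0//.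
    rewrite mulrC ler_pdivrMr//.
    have h2 := enorm_triangle (f (u + w) - f u) (linpart (row3 p1) (row3 p2) w) 0.
    rewrite !subr0 enormC in h2.
    have h3 := lt_le_trans hw (ler_wpM2r (ltW w0) neta).
    have h4 := ler_wpM2l (ltW eta0) wN; clear hw neta wj; lra.
  (* Disjoint pieces, so that their planar measures add up to at most that of [S]. *)
  pose E := seqDU D.
  have mE k : measurable (E k) by apply: measurableD => //; exact: bigsetU_measurable.
  have mS : measurable S by exact: box_measurable.
  have ED k : E k `<=` D k by exact: subset_seqDU.
  apply: (@le_trans _ _ (\sum_(0 <= k <oo) H2 (f @` (E k `&` S)))%E).
    apply: le_trans (hausdorff2_sigma_subadditive _); apply: le_hausdorff2.
    move=> _ [u [Bu Su] <-]; have := BD u Bu.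
    rewrite seqDU_bigcup_eq => -[k _ Ek]; exists k => //; exists u => //.
  have pieceE k : (H2 (f @` (E k `&` S)) <= (c0 eta)%:E * mu (E k `&` S))%E.
    have [[u0 [Eu0 _]]|K0] := pselect ((E k `&` S) !=set0); last first.
      have -> : E k `&` S = set0 by apply/seteqP; split => // u Ku; apply: K0; exists u.
      by rewrite image_set0 hausdorff20 measure0 mule0.
    have := ED k; rewrite {1}/D; have := ED k u0 Eu0; rewrite {1}/D.
    case: (unpickle k) => [i|//]; rewrite /D'; case: pselect => [si|//].
    have pair u v := @piece_pair eta i u v.
    move: i si pair => [[[[p1 p2] m] j] c] [a [b [ab hab]]] pair pu0 Ep.
    change (H2 (f @` (E k `&` S)) <= (c0 eta)%:E * H2 (dilate 1 1 @` (E k `&` S)))%E.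
    apply: (degenerate_piece (p1 := row3 p1) (p2 := row3 p2) ab _ _ hab).
    + by rewrite mulr_gt0.
    + by rewrite addr_ge0// ltW.
    + have [lu0 _] := pu0; have d0 : 0 < j.+1%:R^-1 :> R by rewrite invr_gt0.
      apply: (linear_near_small d0 lu0) => [w h1 _ _|t w t0]; last first.
        by rewrite -/(l1norm _) l1norm_scale// enorm_linpart_scale// mulrCA ler_pM2l.
      have h2 := enorm_triangle (f (u0 + w) - f u0) (linpart (row3 p1) (row3 p2) w) 0.
      rewrite !subr0 enormC in h2.
      have h3 := fL (u0 + w) u0.
      have dw : l1dist (u0 + w) u0 = l1norm w by rewrite /l1dist/l1norm/= addrAC subrr add0r addrAC subrr add0r.
      rewrite dw in h3; rewrite -/(l1norm w).
      have := ler_wpM2r (l1norm_ge0 w) (ltW eta1); lra.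
    + move=> u v [Eu _] [Ev _]; have [h _] := pair u v (Ep _ Eu) (Ep _ Ev).
      apply: le_trans h _; rewrite -[l1dist u v]/(l1norm (u - v)) ler_wpM2r ?l1norm_ge0//; lra.
  have c00 : (0 <= (c0 eta)%:E)%E.
    by rewrite lee_fin /c0 mulr_ge0// ?mulr_ge0 ?addr_ge0 ?mulr_ge0// ltW.
  apply: (@le_trans _ _ (\sum_(0 <= k <oo) (c0 eta)%:E * mu (E k `&` S))%E).
    by apply: lee_nneseries => [k _ _|k _]; [exact: hausdorff2_ge0|exact: pieceE].
  rewrite nneseriesZl//; apply: lee_wpmul2l => //.
  have mES k : measurable (E k `&` S) by exact: measurableI.
  rewrite -(@measure_semi_bigcup _ _ _ mu (fun k => E k `&` S))//.
  - rewrite -setI_bigcupl; apply: le_measure; rewrite ?inE//.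
    by apply: measurableI => //; exact: bigcupT_measurable.
  - by apply: trivIset_setIr; exact: trivIset_seqDU.
  - exact: bigcupT_measurable.
apply/eqP; rewrite eq_le hausdorff2_ge0 andbT.
have muS : mu S \is a fin_num by rewrite ge0_fin_numE// measure_ge0.
apply/lee_addgt0Pr => e e0; rewrite add0e.
pose M := fine (mu S).
have M0 : 0 <= M by rewrite fine_ge0// measure_ge0.
(* For [eta <= 1] the factor [c0 eta] is at most 96 (L + 5) eta. *)
pose K := 96 * (L + 5) * (M + 1).
have M1 : 0 < M + 1 by rewrite ltr_wpDl.
have K0 : 0 < K by rewrite !mulr_gt0// addr_gt0.
pose eta := Num.min (1 / 2) (e / K).
have eta0 : 0 < eta by rewrite lt_min !divr_gt0.
have eta1 : eta <= 1 / 2 by rewrite ge_min lexx.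
have etae : eta * K <= e by rewrite -ler_pdivlMr// ge_min lexx orbT.
apply: (le_trans (key eta eta0 _)); first by lra.
rewrite -(fineK muS) -/M -EFinM lee_fin; apply: le_trans etae.
rewrite /c0 /K; have : 0 <= eta * M by rewrite mulr_ge0// ltW.
have : 0 <= L * (eta * M) by rewrite !mulr_ge0// ltW.
have := mulr_ge0 (ltW L0) (ltW eta0).
have : 0 <= (1 - eta) * (eta * M) by rewrite !mulr_ge0 ?(ltW eta0)//; lra.
nra.
Qed.

(** What the good pieces leave out lies in the image of a null set or in the image of the singular
    points, both of measure zero. *)
Lemma chart_pieces (phi : 'rV[R]_3 -> 'rV[R]_3) (W : nat -> set 'rV[R]_3)
    (kappa : nat -> R) (alpha eta Lam : R) :
  0 < eta -> eta < 1 -> (forall k, closed (W k)) ->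
  (forall k, [/\ 0 < kappa k, kappa k <= alpha & alpha <= Lam * kappa k]) ->
  (forall k y z, W k y -> W k z -> enorm (phi y - phi z) ^+ 2 <= (1 + eta) *
     (alpha ^+ 2 / kappa k * (enorm (y - x) - enorm (z - x)) ^+ 2 +
      kappa k * (enorm (y - z) ^+ 2 - (enorm (y - x) - enorm (z - x)) ^+ 2))) ->
  exists C : nat -> set 'rV[R]_3, [/\ forall k, closed (C k),
    forall k A, A `<=` C k -> (H2 (phi @` A) <=
      (((1 + eta) * (1 + 2 * eta + eta * Lam) / (1 - eta)) ^+ 2 * alpha)%:E * H2 A)%E &
    H2 ((range f `&` \bigcup_k W k) `\` \bigcup_k C k) = 0%E].
Proof.
move=> eta0 eta1 clW kap phiW.
have [C [clC CA Cu]] := good_pieces eta0 eta1 clW kap phiW.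
exists C; split => //.
have [N [mN nN apx]] := linear_approx_ae.
apply/eqP; rewrite eq_le hausdorff2_ge0 andbT.
apply: le_trans (le_hausdorff2 (_ : _ `<=` f @` N `|`
  f @` [set u | (forall e, 0 < e -> exists i, piece e i u) /\ ~ regular_point u])) _.
  move=> y [[[u _ <-] [k _ Wk]] nC].
  have [Nu|nNu] := pselect (N u); first by left; exists u.
  right; exists u => //; split; first exact: apx.
  move=> reg; apply: nC.
  by have [l Cl] := Cu u (apx u nNu) reg (ex_intro _ k Wk); exists l.
apply: le_trans (outer_measureU2 _ _ _) _.
by rewrite [X in (X + _)%E](null_image mN nN) [X in (_ + X)%E]singular_image_null adde0.
Qed.

End Pieces_of_a_chart.
End Linearization.

(** Made disjoint, the closed sets stay Caratheodory measurable, hence cut the arbitrary set [A]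
    additively. *)
Lemma hausdorff2_le_closed_cover (R : realType) (n m : nat)
    (phi : 'rV[R]_n.+1 -> 'rV[R]_m) (C : nat -> set 'rV[R]_n.+1) (A : set 'rV[R]_n.+1) (c : R) :
  0 <= c -> (forall k, closed (C k)) -> A `<=` \bigcup_k C k ->
  (forall k B, B `<=` C k -> (hausdorff2 (phi @` B) <= c%:E * hausdorff2 B)%E) ->
  (hausdorff2 (phi @` A) <= c%:E * hausdorff2 A)%E.
Proof.
move=> c0 clC AC phiC.
pose D := seqDU C.
have mD k : (@hausdorff2 R n.+1).-caratheodory (D k).
  apply: (@seqDU_measurable _ (caratheodory_type (@hausdorff2 R n.+1)) C) => j.
  exact: closed_caratheodory.
apply: (@le_trans _ _ (\sum_(0 <= k <oo) hausdorff2 (phi @` (A `&` D k)))%E).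
  apply: le_trans (hausdorff2_sigma_subadditive _); apply: le_hausdorff2.
  move=> _ [y Ay <-]; have := AC y Ay; rewrite seqDU_bigcup_eq => -[k _ Dk].
  by exists k => //; exists y.
apply: (@le_trans _ _ (\sum_(0 <= k <oo) c%:E * hausdorff2 (A `&` D k))%E).
  apply: lee_nneseries => [k _ _|k _]; first exact: hausdorff2_ge0.
  by apply: (phiC k) => y [_ Dy]; exact: subset_seqDU Dy.
rewrite nneseriesZl; last by move=> k _; exact: hausdorff2_ge0.
apply: lee_wpmul2l => //.
apply: le_trans (caratheodory_lime_le mD (trivIset_seqDU C) A).
by rewrite leeDl// hausdorff2_ge0.
Qed.

Lemma lipschitz_enormP (R : realType) (n m : nat) (f : 'rV[R]_n.+1 -> 'rV[R]_m.+1) :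
  lipschitz f -> exists2 L, 0 < L & forall u v, enorm (f u - f v) <= L * enorm (u - v).
Proof.
move=> [M [_ lipM]].
have fM u v : `|f u - f v| <= (`|M| + 1) * `|u - v|.
  have M1 : M < `|M| + 1 by rewrite (le_lt_trans (ler_norm _))// ltrDl.
  by have := lipM _ M1 (u, v); apply.
exists (m.+1%:R * (`|M| + 1)); first by rewrite mulr_gt0// ltr_pwDr.
move=> u v; apply: le_trans (enorm_le_norm _) _; rewrite -mulrA ler_wpM2l//.
apply: le_trans (fM u v) _.
by rewrite ler_wpM2l ?norm_le_enorm// addr_ge0.
Qed.

Lemma lipschitz_enorm_continuous (R : realType) (n m : nat)
    (f : 'rV[R]_n.+1 -> 'rV[R]_m.+1) (K : R) : 0 < K ->
  (forall u v, enorm (f u - f v) <= K * enorm (u - v)) -> continuous f.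
Proof.
move=> K0 fK u A /nbhs_enormP[e e0 eA]; apply/nbhs_enormP.
exists (e / K) => [|v uv]; first by rewrite divr_gt0.
by apply: eA; apply: le_lt_trans (fK _ _) _; rewrite mulrC -ltr_pdivlMr.
Qed.

(** The hypothesis on [W k] bounds [phi] infinitesimally by [alpha / sqrt kappa] in the direction of
    [x] and by [sqrt kappa] across it, up to [eta]. The pieces of all charts are collected in one
    closed family; the null set they miss has a null image, [phi] being Lipschitz. *)
Lemma rectifiable2_stretch (R : realType) (E A : set 'rV[R]_3) (x : 'rV[R]_3)
    (phi : 'rV[R]_3 -> 'rV[R]_3) (W : nat -> set 'rV[R]_3) (kappa : nat -> R)
    (alpha eta Lam K : R) :
  rectifiable2 E -> 0 < K -> (forall y z, enorm (phi y - phi z) <= K * enorm (y - z)) ->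
  0 < eta -> eta < 1 -> (forall k, closed (W k)) ->
  (forall k, [/\ 0 < kappa k, kappa k <= alpha & alpha <= Lam * kappa k]) ->
  (forall k y z, W k y -> W k z -> enorm (phi y - phi z) ^+ 2 <= (1 + eta) *
     (alpha ^+ 2 / kappa k * (enorm (y - x) - enorm (z - x)) ^+ 2 +
      kappa k * (enorm (y - z) ^+ 2 - (enorm (y - x) - enorm (z - x)) ^+ 2))) ->
  A `<=` E `&` \bigcup_k W k ->
  (hausdorff2 (phi @` A) <=
    (((1 + eta) * (1 + 2 * eta + eta * Lam) / (1 - eta)) ^+ 2 * alpha)%:E * hausdorff2 A)%E.
Proof.
move=> [f [lipf Ef]] K0 phiK eta0 eta1 clW kap phiW AEW.
set c := _ * alpha.
have al0 : 0 < alpha by have [k0 ka _] := kap 0%N; exact: lt_le_trans ka.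
have c0 : 0 <= c by rewrite /c mulr_ge0 ?sqr_ge0// ltW.
pose F i (p : R * R) := f i (dilate 1 1 p).
have rF i : range (F i) = range (f i).
  apply/seteqP; split => [_ [p _ <-]|_ [v _ <-]]; first by exists (dilate 1 1 p).
  exists (undilate (PosNum (@ltr01 R)) (PosNum (@ltr01 R)) v) => //.
  by rewrite /F (undilateK (PosNum (@ltr01 R)) (PosNum (@ltr01 R))).
have charts i : exists C : nat -> set 'rV[R]_3, [/\ forall k, closed (C k),
    forall k B, B `<=` C k -> (hausdorff2 (phi @` B) <= c%:E * hausdorff2 B)%E &
    hausdorff2 ((range (f i) `&` \bigcup_k W k) `\` \bigcup_k C k) = 0%E].
  have [L L0 fL] := lipschitz_enormP (lipf i).
  have FL u v : enorm (F i u - F i v) <= L * l1dist u v.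
    apply: le_trans (fL _ _) _; rewrite ler_wpM2l ?(ltW L0)//.
    apply: le_trans (enorm_le_sum _) _.
    by rewrite !big_ord_recl big_ord0 !mxE/= !mul1r addr0.
  by rewrite -rF; exact: (chart_pieces L0 FL eta0 eta1 clW kap phiW).
have [C PC] := choice charts.
pose D k := if unpickle k is Some (i, j) then C i j else set0.
have subD i : \bigcup_k C i k `<=` \bigcup_k D k.
  move=> y [k _ Cy]; exists (pickle (i, k)); first exact: Logic.I.
  by rewrite /D pickleK.
have clD k : closed (D k).
  rewrite /D; case: (unpickle k) => [[i j]|]; last exact: closed0.
  by have [] := PC i.
have DB k B : B `<=` D k -> (hausdorff2 (phi @` B) <= c%:E * hausdorff2 B)%E.
  rewrite /D; case: (unpickle k) => [[i j]|]; first by have [_ + _] := PC i; exact.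
  by rewrite subset0 => ->; rewrite image_set0 !hausdorff20 mule0.
have nullA : hausdorff2 (A `\` \bigcup_k D k) = 0%E.
  apply/eqP; rewrite eq_le hausdorff2_ge0 andbT.
  apply: le_trans (le_hausdorff2 (_ : _ `<=` (E `\` \bigcup_i range (f i)) `|`
     \bigcup_i ((range (f i) `&` \bigcup_k W k) `\` \bigcup_k C i k))) _.
    move=> y [Ay nD]; have [Ey Wy] := AEW y Ay.
    have [[i _ fy]|nf] := pselect ((\bigcup_i range (f i)) y); last by left.
    by right; exists i => //; split => // Cy; apply: nD; exact: subD Cy.
  apply: le_trans (outer_measureU2 _ _ _) _; rewrite [X in (X + _)%E]Ef add0e.
  apply: le_trans (hausdorff2_sigma_subadditive _) _; rewrite eseries0//.
  by move=> i _ _; have [] := PC i.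
have phi_null : hausdorff2 (phi @` (A `\` \bigcup_k D k)) = 0%E.
  apply/eqP; rewrite eq_le hausdorff2_ge0 andbT.
  apply: le_trans (hausdorff2_comparison (p := phi) (q := id) K0 _) _; first by move=> u v _ _; exact: phiK.
  by rewrite image_id nullA mule0.
apply: (@le_trans _ _ (hausdorff2 (phi @` (A `&` \bigcup_k D k)))).
  apply: le_trans (le_hausdorff2 (_ : _ `<=` phi @` (A `&` \bigcup_k D k) `|`
    phi @` (A `\` \bigcup_k D k))) _.
    move=> _ [y Ay <-]; have [Dy|nDy] := pselect ((\bigcup_k D k) y); last by right; exists y.
    by left; exists y.
  by apply: le_trans (outer_measureU2 _ _ _) _; rewrite [X in (_ + X)%E]phi_null adde0.
apply: le_trans (hausdorff2_le_closed_cover c0 clD (@subIsetr _ _ _) DB) _.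
apply: lee_wpmul2l; first by rewrite lee_fin.
by apply: le_hausdorff2; exact: subIsetl.
Qed.

(** * The radial deformation *)

Section Radial.
Variables (R : realType) (x : 'rV[R]_3) (rho r beta : R).
Hypotheses (rho0 : 0 < rho) (rhor : rho < r) (beta0 : 0 < beta) (beta1 : beta < 1).

(** The slope of the line from (rho^2, beta^2 rho^2) to (r^2, r^2), along which g^2 is affine in
    s^2; [alpha * S - gam] is the equation of this line. *)
Definition area_factor : R := (r ^+ 2 - beta ^+ 2 * rho ^+ 2) / (r ^+ 2 - rho ^+ 2).
Local Notation alpha := area_factor.
Let gam : R := (alpha - beta ^+ 2) * rho ^+ 2.

(* [radial_sqr S] is g(s)^2 for S = s^2, where g(s) is the radius of the image
   of the sphere of radius s; on [rho, r] the product g' g / s is the constant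
   [area_factor]. *)
Definition radial_sqr (S : R) : R :=
  Num.min S (Num.max (beta ^+ 2 * S) (alpha * S - gam)).

(** At [s = 0] the division gives 0; the centre is fixed whatever the factor is there. *)
Definition radial_factor (s : R) : R := Num.sqrt (radial_sqr (s ^+ 2)) / s.

Definition radial_map (y : 'rV[R]_3) : 'rV[R]_3 :=
  x + radial_factor (enorm (y - x)) *: (y - x).

Let g (s : R) := Num.sqrt (radial_sqr (s ^+ 2)).

Let r0 : 0 < r. Proof. exact: lt_trans rhor. Qed.

Let den0 : 0 < r ^+ 2 - rho ^+ 2.
Proof. by rewrite subr_gt0 ltr_pXn2r ?nnegrE ?ltW. Qed.

Let beta2 : 0 < beta ^+ 2 < 1.
Proof. by rewrite exprn_gt0//= expr_lt1// ltW. Qed.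

Let rho2 : 0 < rho ^+ 2. Proof. by rewrite exprn_gt0. Qed.

Lemma area_factor_ge1 : 1 <= alpha.
Proof.
have /andP[b0 b1] := beta2.
rewrite ler_pdivlMr// mul1r lerB// ler_piMl// ltW//.
Qed.

Let gam_r : alpha * r ^+ 2 - gam = r ^+ 2.
Proof. by rewrite /gam /area_factor; field; rewrite gt_eqF. Qed.

Let alpha_beta : beta ^+ 2 < alpha.
Proof. by have /andP[_ b1] := beta2; exact: lt_le_trans b1 area_factor_ge1. Qed.

Let gam0 : 0 < gam.
Proof. by rewrite mulr_gt0// subr_gt0. Qed.

Lemma radial_sqr_le S : radial_sqr S <= S.
Proof. by rewrite ge_min lexx. Qed.

Lemma radial_sqr_ge S : 0 <= S -> beta ^+ 2 * S <= radial_sqr S.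
Proof.
move=> S0; rewrite /radial_sqr le_min le_max lexx/= andbT.
by rewrite ler_piMl//; have /andP[_ /ltW] := beta2.
Qed.

Lemma radial_sqr_ge0 S : 0 <= S -> 0 <= radial_sqr S.
Proof. by move=> S0; apply: le_trans (radial_sqr_ge S0); rewrite mulr_ge0 ?sqr_ge0. Qed.

Lemma radial_sqr_out S : r ^+ 2 <= S -> radial_sqr S = S.
Proof.
move=> rS; apply/min_idPl; rewrite le_max; apply/orP; right.
have := ler_wpM2l (ltac:(by rewrite subr_ge0 area_factor_ge1) : 0 <= alpha - 1) rS.
have := gam_r; lra.
Qed.

Lemma radial_sqr_in S : 0 <= S -> S <= rho ^+ 2 -> radial_sqr S = beta ^+ 2 * S.
Proof.
move=> S0 Srho; have ab := ltW alpha_beta.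
have h : alpha * S - gam <= beta ^+ 2 * S.
  rewrite -subr_ge0 in ab; have := ler_wpM2l ab Srho; rewrite /gam; lra.
rewrite /radial_sqr; rewrite (max_idPl h); apply/min_idPr.
by rewrite ler_piMl//; have /andP[_ /ltW] := beta2.
Qed.

Lemma radial_sqr_mid S : rho ^+ 2 <= S -> S <= r ^+ 2 -> radial_sqr S = alpha * S - gam.
Proof.
move=> rhoS Sr; have ab := ltW alpha_beta; rewrite -subr_ge0 in ab.
have h : beta ^+ 2 * S <= alpha * S - gam.
  have := ler_wpM2l ab rhoS; rewrite /gam; lra.
rewrite /radial_sqr (max_idPr h); apply/min_idPr.
have := ler_wpM2l (ltac:(by rewrite subr_ge0 area_factor_ge1) : 0 <= alpha - 1) Sr.
have := gam_r; lra.
Qed.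

(** The three branches have slopes 1, [beta ^+ 2] and [alpha], all between 0 and [alpha]. *)
Lemma radial_sqr_dist S T : S <= T -> 0 <= radial_sqr T - radial_sqr S <= alpha * (T - S).
Proof.
move=> ST.
have bST : beta ^+ 2 * S <= beta ^+ 2 * T by rewrite ler_wpM2l// sqr_ge0.
have aST : alpha * S <= alpha * T.
  by rewrite ler_wpM2l// (le_trans _ area_factor_ge1).
have d1 : T - S <= alpha * (T - S) by rewrite ler_peMl ?subr_ge0 ?area_factor_ge1.
have d2 : beta ^+ 2 * (T - S) <= alpha * (T - S).
  by rewrite ler_wpM2r ?subr_ge0// ltW.
rewrite /radial_sqr /Num.min /Num.max.
by repeat case: ifPn; rewrite -?leNgt; move=> *; apply/andP; split; lra.
Qed.

Let g_ge0 s : 0 <= g s. Proof. exact: sqrtr_ge0. Qed.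

Let g_sqr s : g s ^+ 2 = radial_sqr (s ^+ 2).
Proof. by rewrite sqr_sqrtr// radial_sqr_ge0// sqr_ge0. Qed.

Let g_le s : 0 <= s -> g s <= s.
Proof.
by move=> s0; rewrite -(ler_pXn2r (n := 2))// ?nnegrE// g_sqr radial_sqr_le.
Qed.

Let g_ge s : 0 <= s -> beta * s <= g s.
Proof.
move=> s0; rewrite -(ler_pXn2r (n := 2))// ?nnegrE// ?mulr_ge0 ?(ltW beta0)//.
by rewrite exprMn g_sqr radial_sqr_ge// sqr_ge0.
Qed.

Let factorK s : radial_factor s * s = g s.
Proof.
rewrite /radial_factor -/(g s); have [->|s0] := eqVneq s 0; last by rewrite divfK.
by rewrite mulr0; apply/eqP; rewrite eq_sym eq_le g_ge0 g_le.
Qed.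

Let factor_ge0 s : 0 <= s -> 0 <= radial_factor s.
Proof. by move=> s0; rewrite /radial_factor divr_ge0. Qed.

Let factor_le1 s : 0 <= s -> radial_factor s <= 1.
Proof.
rewrite le_eqVlt => /predU1P[<-|s0]; first by rewrite /radial_factor invr0 mulr0.
by rewrite ler_pdivrMr// mul1r g_le// ltW.
Qed.

Lemma radial_factor_itv s : 0 <= s -> 0 <= radial_factor s <= 1.
Proof. by move=> s0; rewrite factor_ge0 ?factor_le1. Qed.

(** |y - z|^2 - (s - t)^2 is the angular part of the distance, 2 (s t - <y - x, z - x>), which a
    radial map multiplies by the product of its two factors. *)
Lemma sqr_enorm_radial y z :
  let s := enorm (y - x) in let t := enorm (z - x) in
  enorm (radial_map y - radial_map z) ^+ 2 =
    (g s - g t) ^+ 2 +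
    radial_factor s * radial_factor t * (enorm (y - z) ^+ 2 - (s - t) ^+ 2).
Proof.
move=> s t; rewrite /radial_map -/s -/t.
set k := radial_factor s; set l := radial_factor t.
have -> : x + k *: (y - x) - (x + l *: (z - x)) = k *: (y - x) - l *: (z - x).
  by rewrite opprD addrACA subrr add0r.
have -> : y - z = (y - x) - (z - x) by rewrite opprB addrA subrK.
rewrite (sqr_enormB (k *: (y - x))) (sqr_enormB (y - x)) !enormZ -/s -/t -!factorK -/k -/l.
have -> : \sum_(i < 3) (k *: (y - x)) 0 i * (l *: (z - x)) 0 i =
    k * l * \sum_(i < 3) (y - x) 0 i * (z - x) 0 i.
  by rewrite mulr_sumr; apply: eq_bigr => i _; rewrite !mxE; ring.
rewrite !exprMn !real_normK ?num_real//; ring.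
Qed.

Let dist_ge0 y z : 0 <= enorm (y - z) ^+ 2 - (enorm (y - x) - enorm (z - x)) ^+ 2.
Proof.
rewrite subr_ge0 -[leLHS]real_normK ?num_real// ler_pXn2r ?nnegrE ?enorm_ge0//.
by apply: le_trans (ler_dist_enorm _ _) _; rewrite opprB addrA subrK.
Qed.

(** g^2 has slope at most [alpha] in s^2, that is (g s - g t)(g s + g t) <= alpha (s - t)(s + t) for
    t <= s, and g s + g t >= c (s + t). *)
Let g_dist (c s t : R) : 0 < c -> 0 <= s -> 0 <= t -> c * s <= g s -> c * t <= g t ->
  (g s - g t) ^+ 2 <= (alpha / c) ^+ 2 * (s - t) ^+ 2.
Proof.
move=> c0 s0 t0 cs ct.
have a0 : 0 < alpha by exact: lt_le_trans area_factor_ge1.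
wlog st : s t s0 t0 cs ct / t <= s.
  by move=> H; have [/H|/ltW/H] := leP t s; [exact|rewrite -[(g t - _) ^+ 2]sqrrN opprB -[(t - s) ^+ 2]sqrrN opprB; exact].
have /andP[d0 d1] : 0 <= g s ^+ 2 - g t ^+ 2 <= alpha * (s ^+ 2 - t ^+ 2).
  by rewrite !g_sqr radial_sqr_dist// ler_pXn2r ?nnegrE.
have [st0|st0] := eqVneq (s + t) 0.
  have s00 : s = 0 by lra.
  have t00 : t = 0 by lra.
  by rewrite s00 t00 !subrr expr0n/= mulr0.
have stp : 0 < s + t by rewrite lt_def st0 addr_ge0.
rewrite -exprMn.
have gp : 0 < g s + g t by apply: lt_le_trans (lerD cs ct); rewrite -mulrDr mulr_gt0.
rewrite subr_sqr in d0 d1; rewrite subr_sqr in d1.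
have gst : 0 <= g s - g t by rewrite -(pmulr_lge0 _ gp).
have ac0 : 0 <= alpha / c * (s - t).
  by apply: mulr_ge0; rewrite ?subr_ge0// ltW// divr_gt0.
rewrite ler_pXn2r ?nnegrE//.
rewrite mulrAC ler_pdivlMr// -(ler_pM2r stp).
apply: (@le_trans _ _ ((g s - g t) * (g s + g t))).
  by rewrite -mulrA ler_wpM2l// mulrDr lerD.
by rewrite -mulrA.
Qed.

Lemma radial_lipschitz y z :
  enorm (radial_map y - radial_map z) <= (alpha / beta) * enorm (y - z).
Proof.
have a1 := area_factor_ge1.
have ab : 1 <= alpha / beta.
  by rewrite ler_pdivlMr// mul1r (le_trans (ltW beta1)).
rewrite -(ler_pXn2r (n := 2))// ?nnegrE ?enorm_ge0//; last by rewrite mulr_ge0 ?enorm_ge0// (le_trans _ ab).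
rewrite sqr_enorm_radial exprMn.
have s0 := enorm_ge0 (y - x); have t0 := enorm_ge0 (z - x).
have h1 := g_dist beta0 s0 t0 (g_ge s0) (g_ge t0).
have h2 : radial_factor (enorm (y - x)) * radial_factor (enorm (z - x)) <= 1.
  by rewrite mulr_ile1 ?factor_ge0 ?factor_le1.
have D0 := dist_ge0 y z.
have h3 : 1 <= (alpha / beta) ^+ 2 by rewrite expr_ge1// (le_trans _ ab).
have := ler_wpM2r D0 h2; have := ler_wpM2r D0 h3; rewrite !mul1r; lra.
Qed.

Lemma radial_map_out y : r <= enorm (y - x) -> radial_map y = y.
Proof.
move=> ry; have s0 : 0 < enorm (y - x) by exact: lt_le_trans ry.
rewrite /radial_map /radial_factor radial_sqr_out; last by rewrite ler_pXn2r ?nnegrE ?(ltW r0) ?(ltW s0).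
by rewrite sqrtr_sqr gtr0_norm// divff ?gt_eqF// scale1r subrKC.
Qed.

Lemma radial_map_in y z : enorm (y - x) <= rho -> enorm (z - x) <= rho ->
  enorm (radial_map y - radial_map z) <= beta * enorm (y - z).
Proof.
have fac w : enorm (w - x) <= rho -> radial_map w = x + beta *: (w - x).
  move=> wr; have s0 := enorm_ge0 (w - x); rewrite /radial_map.
  have [w0|w0] := eqVneq (enorm (w - x)) 0.
    have -> : w - x = 0.
      apply/rowP => i; apply/eqP; rewrite [X in _ == X]mxE -normr_le0.
      by have := ler_coord_enorm (w - x) i; rewrite w0.
    by rewrite !scaler0.
  rewrite /radial_factor radial_sqr_in ?sqr_ge0//; last by rewrite ler_pXn2r ?nnegrE ?(ltW rho0).
  by rewrite sqrtrM ?sqr_ge0// !sqrtr_sqr !ger0_norm ?(ltW beta0)// mulfK.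
move=> yr zr; rewrite !fac// opprD addrACA subrr add0r -scalerBr enormZ gtr0_norm//.
by rewrite opprB addrA subrK.
Qed.

(** The part of the annulus where (g / s)^2 lies between [kappa] and [kappa * (1 + eta)], with
    denominators cleared so that closedness is visible. *)
Definition radial_shell (eta : R) (k : nat) : set 'rV[R]_3 :=
  let kappa := beta ^+ 2 * (1 + eta) ^+ k in
  [set y | [/\ rho <= enorm (y - x), enorm (y - x) <= r,
     kappa * enorm (y - x) ^+ 2 <= alpha * enorm (y - x) ^+ 2 - gam &
     alpha * enorm (y - x) ^+ 2 - gam <= kappa * (1 + eta) * enorm (y - x) ^+ 2]].

Lemma radial_shell_closed eta k : closed (radial_shell eta k).
Proof.
have cs : continuous (fun y : 'rV[R]_3 => enorm (y - x)).
  move=> y A /nbhs_ballP[e /= e0 eA]; apply/nbhs_enormP; exists e => // z yz.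
  apply: eA; apply: le_lt_trans yz; apply: le_trans (ler_dist_enorm _ _) _.
  by rewrite opprB addrA subrK.
have cs2 : continuous (fun y : 'rV[R]_3 => enorm (y - x) ^+ 2).
  rewrite (_ : (fun _ => _) = fun y : 'rV[R]_3 => enorm (y - x) * enorm (y - x)).
    by move=> y; exact: (cvgM (cs y) (cs y)).
  by apply/funext => y; rewrite expr2.
set kap := beta ^+ 2 * (1 + eta) ^+ k.
rewrite (_ : radial_shell eta k =
  ((fun y => enorm (y - x)) @^-1` [set z | rho <= z] `&`
   (fun y => enorm (y - x)) @^-1` [set z | z <= r]) `&`
  ((fun y => kap * enorm (y - x) ^+ 2 - alpha * enorm (y - x) ^+ 2) @^-1` [set z | z <= - gam] `&`
   (fun y => alpha * enorm (y - x) ^+ 2 - kap * (1 + eta) * enorm (y - x) ^+ 2) @^-1` [set z | z <= gam])); last first.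
  apply/seteqP; split => y /=; rewrite /radial_shell/= -/kap.
    by move=> [h1 h2 h3 h4]; split; split => //; lra.
  by move=> [[h1 h2] [h3 h4]]; split => //; lra.
apply: closedI; apply: closedI.
- by apply: preimage_closed; [move=> y _; exact: cs|exact: closed_ge].
- by apply: preimage_closed; [move=> y _; exact: cs|exact: closed_le].
- apply: preimage_closed; last exact: closed_le.
  by move=> y _; exact: (cvgB (cvgM (cvg_cst _) (cs2 y)) (cvgM (cvg_cst _) (cs2 y))).
- apply: preimage_closed; last exact: closed_le.
  by move=> y _; exact: (cvgB (cvgM (cvg_cst _) (cs2 y)) (cvgM (cvg_cst _) (cs2 y))).
Qed.

(** On the shell g is at least [sqrt kappa] times s, which bounds the radial part by
    [alpha ^+ 2 / kappa]; the product of the two factors, at most [kappa * (1 + eta)], bounds the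
    angular part. *)
Lemma radial_shell_pinch eta k y z : 0 < eta ->
  let kappa := beta ^+ 2 * (1 + eta) ^+ k in
  radial_shell eta k y -> radial_shell eta k z ->
  enorm (radial_map y - radial_map z) ^+ 2 <= (1 + eta) *
     (alpha ^+ 2 / kappa * (enorm (y - x) - enorm (z - x)) ^+ 2 +
      kappa * (enorm (y - z) ^+ 2 - (enorm (y - x) - enorm (z - x)) ^+ 2)).
Proof.
move=> eta0 kap; rewrite /radial_shell/= -/kap => -[y1 y2 y3 y4] [z1 z2 z3 z4].
have kap0 : 0 < kap by rewrite mulr_gt0 ?exprn_gt0// addr_gt0.
rewrite sqr_enorm_radial.
have sq w : rho <= enorm (w - x) -> enorm (w - x) <= r ->
    g (enorm (w - x)) ^+ 2 = alpha * enorm (w - x) ^+ 2 - gam.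
  move=> w1 w2; rewrite g_sqr radial_sqr_mid//.
    by rewrite ler_pXn2r ?nnegrE ?(ltW rho0) ?enorm_ge0.
  by rewrite ler_pXn2r ?nnegrE ?(ltW r0) ?enorm_ge0.
have pos w : rho <= enorm (w - x) -> 0 < enorm (w - x) by exact: lt_le_trans.
have lo w : rho <= enorm (w - x) -> enorm (w - x) <= r ->
    kap * enorm (w - x) ^+ 2 <= alpha * enorm (w - x) ^+ 2 - gam ->
    Num.sqrt kap * enorm (w - x) <= g (enorm (w - x)).
  move=> w1 w2 w3; rewrite -(ler_pXn2r (n := 2))// ?nnegrE ?mulr_ge0 ?sqrtr_ge0 ?enorm_ge0//.
  by rewrite exprMn sqr_sqrtr ?(ltW kap0)// sq.
have hi w : rho <= enorm (w - x) -> enorm (w - x) <= r ->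
    alpha * enorm (w - x) ^+ 2 - gam <= kap * (1 + eta) * enorm (w - x) ^+ 2 ->
    radial_factor (enorm (w - x)) ^+ 2 <= kap * (1 + eta).
  move=> w1 w2 w4; rewrite /radial_factor -/(g _) expr_div_n sq//.
  by rewrite ler_pdivrMr// exprn_gt0// pos.
have sk0 : 0 < Num.sqrt kap by rewrite sqrtr_gt0.
have h1 := g_dist sk0 (ltW (pos _ y1)) (ltW (pos _ z1)) (lo _ y1 y2 y3) (lo _ z1 z2 z3).
rewrite expr_div_n sqr_sqrtr ?(ltW kap0)// in h1.
have h2 : radial_factor (enorm (y - x)) * radial_factor (enorm (z - x)) <= kap * (1 + eta).
  have := hi _ y1 y2 y4; have := hi _ z1 z2 z4.
  set a := radial_factor _; set b := radial_factor _; have := sqr_ge0 (a - b); lra.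
have D0 := dist_ge0 y z; have := ler_wpM2r D0 h2.
set Ds := (enorm (y - x) - enorm (z - x)) ^+ 2 in h1 D0 *; set D := _ - Ds in D0 *.
have : 0 <= eta * (alpha ^+ 2 / kap * Ds).
  by rewrite mulr_ge0 ?(ltW eta0)// mulr_ge0 ?sqr_ge0// divr_ge0 ?sqr_ge0// ltW.
lra.
Qed.

(** With q = (g / s)^2, the index precedes the least k with q < beta^2 (1 + eta)^k, which exists by
    Bernoulli's inequality; it is not 0 since q >= beta^2. *)
Lemma radial_shell_cover eta y : 0 < eta -> rho <= enorm (y - x) -> enorm (y - x) <= r ->
  exists2 k, radial_shell eta k y & beta ^+ 2 * (1 + eta) ^+ k <= alpha.
Proof.
move=> eta0 y1 y2; set s := enorm (y - x) in y1 y2 *.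
have s0 : 0 < s by exact: lt_le_trans y1.
have s2 : 0 < s ^+ 2 by rewrite exprn_gt0.
have b2 : 0 < beta ^+ 2 by rewrite exprn_gt0.
pose q := (alpha * s ^+ 2 - gam) / s ^+ 2.
have qa : q <= alpha by rewrite ler_pdivrMr// gerBl ltW.
have qb : beta ^+ 2 <= q.
  have ab : 0 <= alpha - beta ^+ 2 by rewrite subr_ge0 ltW.
  have rs : rho ^+ 2 <= s ^+ 2 by rewrite ler_pXn2r ?nnegrE ?(ltW rho0) ?(ltW s0).
  by rewrite ler_pdivlMr//; have := ler_wpM2l ab rs; rewrite /gam; lra.
have ex : exists k, q < beta ^+ 2 * (1 + eta) ^+ k.
  pose k := Num.truncn (q / beta ^+ 2 / eta).
  exists k.+1; rewrite mulrC -ltr_pdivrMr//.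
  have bern m : 1 + m%:R * eta <= (1 + eta) ^+ m.
    elim: m => [|m IH]; first by rewrite mul0r addr0 expr0.
    rewrite exprS -natr1; have : 0 <= m%:R * eta ^+ 2 by rewrite mulr_ge0 ?sqr_ge0.
    have := ler_wpM2l (ltac:(lra) : 0 <= 1 + eta) IH; lra.
  apply: lt_le_trans (bern _); apply: (@lt_trans _ _ (k.+1%:R * eta)); last by rewrite ltrDr.
  by rewrite -ltr_pdivrMr// truncnS_gt.
case: (ex_minnP ex) => -[|k] qk mink; first by move: qk; rewrite expr0 mulr1 ltNge qb.
have kq : beta ^+ 2 * (1 + eta) ^+ k <= q.
  by rewrite leNgt; apply/negP => /mink; rewrite ltnn.
exists k; last exact: le_trans qa.
rewrite /radial_shell/= -/s; split => //.
  by rewrite -ler_pdivlMr.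
by rewrite -ler_pdivrMr// -/q -mulrA -exprSr ltW.
Qed.

End Radial.

(** * Monotonicity of the density *)

Section Gauge.
Variables (R : realType) (h : R -> \bar R).
Hypothesis gh : gauge_function h.
Local Notation leb := (@lebesgue_measure R).
Local Notation integrand := (fun s : R => (h (2 * s)%R * (s^-1)%:E)%E).

(** Both factors are monotone, so their superlevel sets are intervals. *)
Lemma gauge_integrand_measurable (t : R) :
  measurable_fun (`]0, t[%classic : set R) integrand.
Proof.
have [h0 hm _] := gh.
apply: emeasurable_funM.
  apply: (@measurability _ _ _ _ _ _ (@ErealGenOInfty.G R)).
    exact: ErealGenOInfty.measurableE.
  move=> _ [_ [c ->] <-]; apply: is_interval_measurable => a b /=.
  rewrite !in_itv/= !andbT => -[/andP[a0 at_] ca] [/andP[b0 bt] cb] z /andP[az zb].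
  split; first by rewrite in_itv/= (lt_le_trans a0 az) (le_lt_trans zb bt).
  rewrite in_itv/= andbT; apply: lt_le_trans ca _; apply: hm.
    by rewrite mulr_ge0// ltW.
  by rewrite ler_pM2l.
apply/measurable_EFinP.
apply: (@measurability _ _ _ _ _ _ (@RGenOInfty.G R)).
  exact: RGenOInfty.measurableE.
move=> _ [_ [c ->] <-]; apply: is_interval_measurable => a b /=.
rewrite !in_itv/= !andbT => -[/andP[a0 at_] ca] [/andP[b0 bt] cb] z /andP[az zb].
have z0 : 0 < z := lt_le_trans a0 az.
split; first by rewrite in_itv/= z0 (le_lt_trans zb bt).
by rewrite in_itv/= andbT; apply: lt_le_trans cb _; rewrite lef_pV2.
Qed.

Lemma gauge_integral_ge0 t : (0 <= gauge_integral h t)%E.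
Proof.
have [h0 _ _] := gh; apply: integral_ge0 => s; rewrite /= in_itv/= => /andP[s0 _].
by rewrite mule_ge0 ?h0 ?lee_fin ?invr_ge0 ?mulr_ge0// ltW.
Qed.

(** Since 2 s >= r, the integrand is at least h(r) / r on [rho, r). The inequality is stated with
    sums, as the integrals may be infinite. *)
Lemma gauge_integral_step (rho r : R) : 0 < rho -> rho < r -> r <= 2 * rho ->
  (8%:E * gauge_integral h rho + h r * ((r ^+ 2 - rho ^+ 2) / rho ^+ 2)%:E <=
   8%:E * gauge_integral h r)%E.
Proof.
move=> rho0 rhor r2; have [h0 hm _] := gh.
have r0 : 0 < r by exact: lt_trans rhor.
have UE : `]0, r[%classic = `]0, rho[%classic `|` `[rho, r[%classic :> set R.
  apply/seteqP; split => s /=; rewrite !in_itv/=.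
    by move=> /andP[s0 sr]; have [|] := ltP s rho; [left; rewrite s0|right; rewrite sr].
  move=> [/andP[-> sr]|/andP[rs ->]]; first exact: lt_trans rhor.
  by rewrite (lt_le_trans rho0 rs).
rewrite /gauge_integral UE ge0_integral_setU//=; last 3 first.
- by rewrite -UE; exact: gauge_integrand_measurable.
- move=> s; rewrite !in_itv/= => sr.
  have s0 : 0 < s by case: sr => /andP[] // + _; exact: lt_le_trans.
  by rewrite mule_ge0 ?h0 ?lee_fin ?invr_ge0 ?mulr_ge0// ltW.
- apply/disj_setPRL => s /=; rewrite !in_itv/= => /andP[rs _] /andP[_].
  by rewrite ltNge rs.
have hr0 : (0 <= h r)%E by apply: h0; exact: ltW.
have Irho0 := gauge_integral_ge0 rho.
have I20 : (0 <= \int[leb]_(s in `[rho, r[) (h (2 * s)%R * (s^-1)%:E))%E.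
  apply: integral_ge0 => s; rewrite /= in_itv/= => /andP[s0 _].
  have s0' : 0 < s := lt_le_trans rho0 s0.
  by rewrite mule_ge0 ?h0 ?lee_fin ?invr_ge0 ?mulr_ge0// ltW.
rewrite (ge0_muleDr _ Irho0 I20); apply: leeD2l.
apply: (@le_trans _ _ (8%:E * \int[leb]_(s in `[rho, r[) (cst (h r * (r^-1)%:E) s))%E); last first.
  apply: lee_wpmul2l => //; apply: ge0_le_integral => //.
  - by move=> s _; rewrite mule_ge0// lee_fin invr_ge0 ltW.
  - apply: (@measurable_funS _ _ _ _ `]0, r[%classic) => //; last exact: gauge_integrand_measurable.
    by rewrite UE; exact: subsetUr.
  - move=> s; rewrite /= in_itv/= => /andP[rs sr].
    have s0 : 0 < s := lt_le_trans rho0 rs.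
    apply: lee_pmul => //.
    + by rewrite lee_fin invr_ge0 ltW.
    + by apply: hm; [exact: ltW|apply: le_trans r2 _; rewrite ler_pM2l].
    + by rewrite lee_fin lef_pV2// ltW.
rewrite integral_cst//= lebesgue_measure_itv/= lte_fin rhor -EFinD.
rewrite -muleA -EFinM muleCA -EFinM; apply: lee_wpmul2l => //; rewrite lee_fin.
rewrite ler_pdivrMr ?exprn_gt0//.
rewrite (_ : 8 * (r^-1 * (r - rho)) * rho ^+ 2 = (8 * (r - rho) * rho ^+ 2) / r); last by ring.
rewrite ler_pdivlMr// subr_sqr.
have d0 : 0 <= r - rho by rewrite subr_ge0 ltW.
rewrite -!mulrA [8 * _]mulrCA ler_wpM2l//.
(* The bound obtained is 6 rho^2, within the allowed 8 rho^2. *)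
have h1 : (r + rho) * r <= (3 * rho) * (2 * rho) by apply: ler_pM => //; rewrite ?addr_ge0 ?(ltW r0) ?(ltW rho0)//; lra.
have := sqr_ge0 rho; lra.
Qed.

End Gauge.

Lemma eball_caratheodory (R : realType) (x : 'rV[R]_3) (r : R) :
  (@hausdorff2 R 3).-caratheodory (eball x r).
Proof.
rewrite -[eball x r]setCK; apply: caratheodory_measurable_setC.
apply: closed_caratheodory; apply: open_closedC; rewrite openE => y.
rewrite /eball/= => yr; apply/nbhs_enormP; exists (r - enorm (y - x)); first by rewrite subr_gt0.
move=> z yz /=; have := enorm_triangle y z x; rewrite [enorm (z - y)]enormC; lra.
Qed.

Lemma L0E (R : realType) : @L0 R = [set x | x 0 ord_max = 0].
Proof.
have row (y : 'rV[R]_3) (t : R) : exists z : 'rV[R]_3,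
    z 0 ord_max = y 0 ord_max + t /\ enorm (y - z) <= `|t|.
  exists (y + t *: delta_mx 0 ord_max); rewrite !mxE !eqxx mulr1; split => //.
  rewrite opprD addrA subrr add0r enormN enormZ ler_piMr//.
  rewrite -(ler_pXn2r (n := 2))// ?nnegrE ?enorm_ge0// sqr_enorm !big_ord_recl big_ord0 !mxE/=.
  by rewrite expr0n/= !add0r addr0 !expr1n.
have coord (y z : 'rV[R]_3) : `|y 0 ord_max - z 0 ord_max| <= enorm (y - z).
  by have := ler_coord_enorm (y - z) ord_max; rewrite !mxE.
apply/seteqP; split => [y [cly niy]|y /= y0].
  have y0 : 0 <= y 0 ord_max.
    rewrite leNgt; apply/negP => yn.
    have [z] := (closure_enormP _ _).1 cly (- y 0 ord_max) ltac:(by rewrite oppr_gt0).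
    rewrite /Omega0/= => z0 yz; have := coord y z.
    by rewrite ler_norml => /andP[h1 h2]; lra.
  apply/eqP; rewrite eq_le y0 andbT leNgt; apply/negP => yp; apply: niy.
  apply/nbhs_enormP; exists (y 0 ord_max) => // z yz; rewrite /Omega0/=.
  by have := coord y z; rewrite ler_norml => /andP[h1 h2]; lra.
split; first by apply: subset_closure; rewrite /Omega0/= y0.
move=> /nbhs_enormP[e e0 eO].
have [z [zE yz]] := row y (- (e / 2)).
have := eO z; rewrite /Omega0/= zE y0 => H.
have : enorm (y - z) < e.
  by apply: le_lt_trans yz _; rewrite normrN gtr0_norm ?divr_gt0//; lra.
by move=> /H; lra.
Qed.

(* The bound 1 + 63 t comes from expanding (1 + t)^6 with t <= 1. *)
Lemma pinch_constant_bound (R : realType) (Lam eta : R) : 0 < Lam -> 0 < eta -> eta <= 1 / 2 ->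
  (2 + Lam) * eta <= 1 ->
  ((1 + eta) * (1 + 2 * eta + eta * Lam) / (1 - eta)) ^+ 2 <= 1 + 63 * ((2 + Lam) * eta).
Proof.
move=> Lam0 eta0 eta1; set t := (2 + Lam) * eta => t1.
have le0 : 0 < Lam * eta by rewrite mulr_gt0.
have t0 : 0 < t by rewrite mulr_gt0// addr_gt0.
have et : 2 * eta <= t by rewrite /t mulrDl; lra.
have e1 : 0 < 1 - eta by lra.
have f1 : (1 - eta)^-1 <= 1 + t.
  rewrite -[leLHS]mul1r ler_pdivrMr//.
  have : (1 + t) * (1 - eta) = 1 + t - eta - t * eta by ring.
  have : t * eta <= t * (1 / 2) by rewrite ler_wpM2l// ltW.
  lra.
have f2 : 1 + 2 * eta + eta * Lam = 1 + t by rewrite /t; ring.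
have f3 : 1 + eta <= 1 + t by lra.
have key : (1 + eta) * (1 + 2 * eta + eta * Lam) / (1 - eta) <= (1 + t) ^+ 3.
  rewrite f2 (_ : (1 + t) ^+ 3 = (1 + t) * (1 + t) * (1 + t)); last by ring.
  apply: ler_pM => //; [|by rewrite invr_ge0 ltW|by rewrite ler_wpM2r//; lra].
  by rewrite mulr_ge0//; lra.
apply: (@le_trans _ _ (((1 + t) ^+ 3) ^+ 2)).
  rewrite ler_pXn2r ?nnegrE//; first by rewrite divr_ge0 ?(ltW e1)// mulr_ge0//; lra.
  by rewrite exprn_ge0//; lra.
have t2 : t ^+ 2 <= t by rewrite expr2 ler_piMl// ltW.
have g1 : (1 + t) ^+ 2 <= 1 + 3 * t.
  by rewrite (_ : (1 + t) ^+ 2 = 1 + 2 * t + t ^+ 2); [lra|ring].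
rewrite -exprM mulnC exprM.
have g0 : 0 <= (1 + t) ^+ 2 by exact: sqr_ge0.
apply: (@le_trans _ _ ((1 + 3 * t) ^+ 3)).
  by rewrite ler_pXn2r ?nnegrE//; lra.
rewrite (_ : (1 + 3 * t) ^+ 3 = 1 + 9 * t + 27 * t ^+ 2 + 27 * (t * t ^+ 2)); last by ring.
have : t * t ^+ 2 <= t * t by rewrite ler_wpM2l// ltW.
rewrite -expr2; lra.
Qed.

Section Monotonicity.
Variables (R : realType) (h : R -> \bar R) (E : set 'rV[R]_3) (x : 'rV[R]_3).
Hypotheses (rectE : rectifiable2 E) (minE : locally_sliding_almost_minimal h E x).
Local Notation H2 := (@hausdorff2 R 3).

(** For fixed [beta] the constant [Lam] serves all shells and all [eta], so letting [eta] tend to 0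
    leaves exactly the area factor. *)
Lemma radial_map_annulus (rho r beta : R) : 0 < rho -> rho < r -> 0 < beta -> beta < 1 ->
  let A := E `&` (eball x r `\` eball x rho) in
  (H2 A < +oo)%E ->
  (H2 (radial_map x rho r beta @` A) <= (area_factor rho r beta)%:E * H2 A)%E.
Proof.
move=> rho0 rhor b0 b1 A Afin.
set alpha := area_factor _ _ _; set phi := radial_map _ _ _ _.
have a1 : 1 <= alpha by exact: area_factor_ge1.
have al0 : 0 < alpha by exact: lt_le_trans a1.
have bb : 0 < beta ^+ 2 by rewrite exprn_gt0.
pose Lam := alpha / beta ^+ 2.
have Lam0 : 0 < Lam by rewrite divr_gt0.
have bal : beta ^+ 2 <= alpha by apply: le_trans a1; rewrite expr_le1// ltW.
have bound eta : 0 < eta -> eta < 1 -> (H2 (phi @` A) <=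
    (((1 + eta) * (1 + 2 * eta + eta * Lam) / (1 - eta)) ^+ 2 * alpha)%:E * H2 A)%E.
  move=> eta0 eta1.
  pose kap k := beta ^+ 2 * (1 + eta) ^+ k.
  (* Shells of too large index are emptied and their [kappa] capped at [alpha], because the pinching
     bounds are required for every k. *)
  pose W k := if kap k <= alpha then radial_shell x rho r beta eta k else set0.
  pose kappa k := Num.min (kap k) alpha.
  have kapb k : beta ^+ 2 <= kap k by rewrite ler_peMr ?(ltW bb)// exprn_ege1//; lra.
  have K0 : 0 < alpha / beta by rewrite divr_gt0.
  apply: (@rectifiable2_stretch R E A x phi W kappa alpha eta Lam (alpha / beta)) => //.
  - by move=> y z; exact: radial_lipschitz.
  - by move=> k; rewrite /W; case: ifP => _; [exact: radial_shell_closed|exact: closed0].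
  - move=> k; rewrite /kappa; split.
    + by rewrite lt_min al0 andbT (lt_le_trans bb).
    + by rewrite ge_min lexx orbT.
    + rewrite /Lam -mulrA ler_peMr ?(ltW al0)// mulrC ler_pdivlMr// mul1r.
      by rewrite le_min kapb.
  - move=> k y z; rewrite /W /kappa; case: ifP => // ka.
    by rewrite (min_idPl ka) => Wy Wz; exact: radial_shell_pinch.
  - move=> y [Ey [yr nyr]]; split => //; rewrite /eball/= in yr nyr.
    have [|k Wk ka] := @radial_shell_cover R x rho r beta rho0 rhor b0 b1 eta y eta0 _ (ltW yr).
      by rewrite leNgt; apply/negP.
    by exists k => //; rewrite /W ka.
have Af : H2 A \is a fin_num by rewrite ge0_fin_numE// hausdorff2_ge0.
pose a := fine (H2 A); have aE : H2 A = a%:E by rewrite fineK.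
have a0 : 0 <= a by rewrite fine_ge0// hausdorff2_ge0.
rewrite aE in bound *.
apply/lee_addgt0Pr => e e0.
(* A bound for the growth in [eta] of the pinched estimate, with 1 added to make it positive. *)
pose M := 63 * (2 + Lam) * alpha * a + 1.
have L2 : 0 < 2 + Lam by rewrite addr_gt0.
have M0 : 0 < M.
  by rewrite /M ltr_wpDl// mulr_ge0// mulr_ge0 ?(ltW al0)// mulr_ge0// ltW.
pose eta := Num.min (1 / 2) (Num.min (2 + Lam)^-1 (e / M)).
have eta0 : 0 < eta by rewrite !lt_min invr_gt0 L2 !divr_gt0.
have eta1 : eta <= 1 / 2 by rewrite ge_min lexx.
have eta2 : (2 + Lam) * eta <= 1.
  by rewrite mulrC -ler_pdivlMr// mul1r !ge_min lexx !orbT.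
have eta3 : eta * M <= e by rewrite -ler_pdivlMr// !ge_min lexx !orbT.
have etalt1 : eta < 1 by lra.
apply: le_trans (bound eta eta0 etalt1) _.
rewrite -!EFinM -EFinD lee_fin.
have cb := pinch_constant_bound Lam0 eta0 eta1 eta2.
have aa0 : 0 <= alpha * a by rewrite mulr_ge0// ltW.
rewrite -(mulrA (_ ^+ 2) alpha a); apply: le_trans (ler_wpM2r aa0 cb) _.
by rewrite /M in eta3; lra.
Qed.

(** The deformation is the straight homotopy from the identity to the radial map. Each stage
    multiplies y - x by a coefficient in [0, 1], so it stays in the half-space and in the ball. *)
Lemma almost_minimal_comparison (rho r beta : R) :
  0 < rho -> rho < r -> 0 < beta -> beta < 1 ->
  (L0 x \/ forall y, L0 y -> r <= enorm (y - x)) ->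
  (H2 (E `&` eball x r) < +oo)%E ->
  (H2 (E `&` eball x r) <= (beta ^+ 2)%:E * H2 (E `&` eball x rho) +
     (area_factor rho r beta)%:E * H2 (E `&` (eball x r `\` eball x rho)) +
     h r * (r ^+ 2)%:E)%E.
Proof.
move=> rho0 rhor b0 b1 xL0 fin.
have r0 : 0 < r by exact: lt_trans rhor.
have [EO Ex _ minr] := minE.
pose phi := radial_map x rho r beta.
pose F (t : R) y := y + t *: (phi y - y).
have lipphi y z : enorm (phi y - phi z) <= area_factor rho r beta / beta * enorm (y - z).
  exact: radial_lipschitz.
have F1 y : F 1 y = phi y by rewrite /F scale1r subrKC.
have factor01 y : 0 <= radial_factor rho r beta (enorm (y - x)) <= 1.
  by apply: radial_factor_itv => //; exact: enorm_ge0.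
have FE t y : F t y = x + (1 - t + t * radial_factor rho r beta (enorm (y - x))) *: (y - x).
  rewrite /F /phi /radial_map; apply/rowP => i; rewrite !mxE; ring.
have coef01 t y : 0 <= t <= 1 -> 0 <= 1 - t + t * radial_factor rho r beta (enorm (y - x)) <= 1.
  move=> /andP[t0 t1]; have /andP[k0 k1] := factor01 y.
  have := mulr_ge0 t0 k0; have := ler_wpM2l t0 k1; move=> *; apply/andP; split; lra.
have Fout t y : ~ eball x r y -> F t y = y.
  move=> /negP; rewrite /eball/= -leNgt => ry.
  by rewrite /F /phi radial_map_out// subrr scaler0 addr0.
have Fin t y : 0 <= t <= 1 -> eball x r y -> eball x r (F t y).
  move=> t01; rewrite /eball/= => yr; rewrite FE addrAC subrr add0r enormZ.
  have /andP[c0 c1] := coef01 t y t01.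
  by rewrite ger0_norm//; apply: le_lt_trans yr; rewrite ler_piMl// enorm_ge0.
have slide : sliding_deformation E (eball x r) F.
  split.
  - split.
    + move=> t t01 y Ey; rewrite FE /Omega0/= !mxE.
      have := EO _ Ey; have := EO _ Ex; rewrite /Omega0/=.
      have /andP[c0 c1] := coef01 t y t01; set c := 1 - t + _ in c0 c1 *.
      move=> x0 y0; have := mulr_ge0 c0 y0.
      have : 0 <= (1 - c) * x 0 ord_max by rewrite mulr_ge0// subr_ge0.
      lra.
    + by move=> t _ y _; exact: Fout.
    + by move=> t t01 y _; exact: Fin.
    (* Contractions towards a point of [L0] preserve the plane; otherwise the points of [L0] are
       outside the ball and fixed. *)
    + move=> t t01 y Ey y0; have [xL|far] := xL0.
        rewrite L0E/= in xL y0 *; rewrite FE !mxE xL y0; ring.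
      by rewrite Fout// /eball/=; apply/negP; rewrite -leNgt; exact: far.
  - apply: continuous_subspaceT => p.
    have cphi : continuous phi.
      apply: lipschitz_enorm_continuous lipphi.
      by rewrite divr_gt0// (lt_le_trans _ (area_factor_ge1 rho0 rhor b0 b1)).
    apply: cvgD; first exact: cvg_snd.
    apply: cvgZ; first exact: cvg_fst.
    apply: cvgB; last exact: cvg_snd.
    by apply: (@continuous_comp _ _ _ snd phi p); [exact: cvg_snd|exact: cphi].
  - have PF : ProperFilter (globally (E `*` E)) by apply: (@globally_properfilter _ _ (x, x)).
    apply: (@klipschitzW _ _ _ (area_factor rho r beta / beta * 3%:R)) => -[y z] _ /=.
    rewrite !F1; apply: le_trans (norm_le_enorm _) _; apply: le_trans (lipphi _ _) _.
    rewrite -[leRHS]mulrA ler_wpM2l ?enorm_le_norm//.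
    by rewrite divr_ge0 ?(ltW b0)// (le_trans _ (area_factor_ge1 rho0 rhor b0 b1)).
  - by move=> y Ey; rewrite /F scale0r addr0.
have := minr r F r0 slide; move=> /le_trans; apply; apply: leeD => //.
apply: le_trans (le_hausdorff2 (_ : _ `<=` phi @` (E `&` eball x rho) `|`
  phi @` (E `&` (eball x r `\` eball x rho)))) _.
  (* Points outside the ball are fixed, so an image inside it comes from inside. *)
  move=> _ [[y Ey <-]]; rewrite F1 => phiyr.
  have yr : eball x r y.
    by apply: contrapT => nyr; move: (nyr); rewrite -[y in eball _ _ y](Fout 1)// F1.
  by have [yrho|nyrho] := pselect (eball x rho y); [left|right]; exists y.
apply: le_trans (outer_measureU2 _ _ _) _; apply: leeD.
  rewrite -[X in (_ <= _ * H2 X)%E]image_id; apply: hausdorff2_comparison => //.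
  by move=> y z [_ yr] [_ zr]; apply: radial_map_in => //; exact: ltW.
apply: radial_map_annulus => //; apply: le_lt_trans fin.
by apply: le_hausdorff2 => y [Ey [yr _]].
Qed.

(** With a and b the measures in the small ball and in the annulus, [beta] tending to 0 gives a + b
    <= r^2 / (r^2 - rho^2) b + h(r) r^2; clearing the denominator cancels r^2 b and leaves a
    comparison of densities. *)
Lemma density_step (rho r : R) : 0 < rho -> rho < r ->
  (L0 x \/ forall y, L0 y -> r <= enorm (y - x)) -> (0 <= h r)%E ->
  (density E x rho <= density E x r + h r * ((r ^+ 2 - rho ^+ 2) / rho ^+ 2)%:E)%E.
Proof.
move=> rho0 rhor xL0 hr0.
have r0 : 0 < r by exact: lt_trans rhor.
have den0 : 0 < r ^+ 2 - rho ^+ 2 by rewrite subr_gt0 ltr_pXn2r ?nnegrE ?ltW.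
have q0 : 0 < (r ^+ 2 - rho ^+ 2) / rho ^+ 2 by rewrite divr_gt0// exprn_gt0.
rewrite /density.
have nNy (z : \bar R) : (0 <= z)%E -> z != -oo%E by case: z.
(* If the measure of the large ball or h(r) is infinite, so is the right-hand side; otherwise the
   computation takes place in R. *)
have [->|] := eqVneq (H2 (E `&` eball x r)) +oo%E.
  rewrite [((r ^- 2)%:E * +oo)%E]gt0_muley ?lte_fin ?invr_gt0 ?exprn_gt0//.
  by rewrite addye ?leey// nNy// mule_ge0// lee_fin ltW.
rewrite -ltey => fin.
have [->|] := eqVneq (h r) +oo%E.
  rewrite gt0_mulye ?lte_fin// addey ?leey// nNy// mule_ge0 ?hausdorff2_ge0//.
  by rewrite lee_fin invr_ge0 exprn_ge0// ltW.
rewrite -ltey => hfin.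
have split : H2 (E `&` eball x r) =
    (H2 (E `&` eball x rho) + H2 (E `&` (eball x r `\` eball x rho)))%E.
  rewrite [LHS](eball_caratheodory x rho); congr (H2 _ + H2 _)%E.
    rewrite -setIA; congr (_ `&` _); apply/seteqP; split => [y []//|y yrho]; split => //.
    by apply: lt_trans rhor.
  by rewrite setDE setIA.
have comp beta (be0 : 0 < beta) (be1 : beta < 1) :=
  almost_minimal_comparison rho0 rhor be0 be1 xL0 fin.
have f1 : H2 (E `&` eball x rho) \is a fin_num.
  rewrite ge0_fin_numE ?hausdorff2_ge0//; apply: le_lt_trans fin.
  by rewrite split leeDl// hausdorff2_ge0.
have f2 : H2 (E `&` (eball x r `\` eball x rho)) \is a fin_num.
  rewrite ge0_fin_numE ?hausdorff2_ge0//; apply: le_lt_trans fin.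
  by rewrite split leeDr// hausdorff2_ge0.
have f3 : h r \is a fin_num by rewrite ge0_fin_numE.
rewrite split -(fineK f1) -(fineK f2) -(fineK f3) in comp *.
have a0 : 0 <= fine (H2 (E `&` eball x rho)) by rewrite fine_ge0// hausdorff2_ge0.
have b0 : 0 <= fine (H2 (E `&` (eball x r `\` eball x rho))) by rewrite fine_ge0// hausdorff2_ge0.
move: (fine (H2 (E `&` eball x rho))) (fine (H2 (E `&` (eball x r `\` eball x rho)))) (fine (h r)) a0 b0 comp => a b H a0 b0 comp.
have {}comp : a + b <= r ^+ 2 / (r ^+ 2 - rho ^+ 2) * b + H * r ^+ 2.
  apply/ler_addgt0Pr => e e0.
  (* Makes the contribution [beta ^+ 2 * a] of the small ball at most [e]; the area factor is at
     most its value at [beta = 0]. *)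
  pose beta := Num.min (1 / 2) (e / (a + 1)).
  have a1 : 0 < a + 1 by rewrite ltr_wpDl.
  have be0 : 0 < beta by rewrite lt_min !divr_gt0.
  have be1 : beta <= 1 / 2 by rewrite ge_min lexx.
  have bea : beta * (a + 1) <= e by rewrite -ler_pdivlMr// ge_min lexx orbT.
  have := comp beta be0 ltac:(lra); rewrite -!EFinM -!EFinD lee_fin => /le_trans; apply.
  have h1 : beta ^+ 2 * a <= e.
    apply: le_trans bea; rewrite expr2 -mulrA ler_wpM2l// ?(ltW be0)//.
    by rewrite (@le_trans _ _ a)//; [rewrite ler_piMl//; lra|lra].
  have h2 : area_factor rho r beta * b <= r ^+ 2 / (r ^+ 2 - rho ^+ 2) * b.
    rewrite ler_wpM2r// /area_factor ler_wpM2r ?invr_ge0 ?(ltW den0)//.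
    by rewrite gerBl mulr_ge0 ?sqr_ge0.
  lra.
change ((rho ^- 2 * a)%:E <= (r ^- 2 * (a + b) + H * ((r ^+ 2 - rho ^+ 2) / rho ^+ 2))%:E)%E.
rewrite lee_fin.
have {}comp : a * r ^+ 2 <= (a + b) * rho ^+ 2 + H * (r ^+ 2 * (r ^+ 2 - rho ^+ 2)).
  have := ler_wpM2r (ltW den0) comp.
  have -> : (r ^+ 2 / (r ^+ 2 - rho ^+ 2) * b + H * r ^+ 2) * (r ^+ 2 - rho ^+ 2) =
    r ^+ 2 * b + H * (r ^+ 2 * (r ^+ 2 - rho ^+ 2)) by field; rewrite gt_eqF.
  lra.
have rr : 0 < r ^+ 2 * rho ^+ 2 by rewrite mulr_gt0 ?exprn_gt0.
rewrite -(ler_pM2r rr).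
have -> : rho ^- 2 * a * (r ^+ 2 * rho ^+ 2) = a * r ^+ 2.
  by field; rewrite gt_eqF.
have -> : (r ^- 2 * (a + b) + H * ((r ^+ 2 - rho ^+ 2) / rho ^+ 2)) * (r ^+ 2 * rho ^+ 2) =
  (a + b) * rho ^+ 2 + H * (r ^+ 2 * (r ^+ 2 - rho ^+ 2)).
  by field; rewrite !gt_eqF.
exact: comp.
Qed.

End Monotonicity.

(** Induction on the number of halvings: while r > 2 rho, the radius r / 2 is still above rho and
    the step from r / 2 to r is allowed. *)
Lemma le_doubling_chain (R : realType) (Psi : R -> \bar R) (b : R) :
  (forall rho r, 0 < rho -> rho < r -> r < b -> r <= 2 * rho -> (Psi rho <= Psi r)%E) ->
  {in `]0, b[ &, {homo Psi : r s / r <= s >-> (r <= s)%E}}.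
Proof.
move=> step rho r; rewrite !in_itv/= => /andP[rho0 _] /andP[r0 rb] rhor.
have [n rn] : exists n, r <= 2 ^+ n * rho.
  exists (Num.bound (r / rho)); rewrite -ler_pdivrMr// ltW//.
  by apply: upper_nthrootP; exact: leqnn.
elim: n r r0 rb rhor rn => [|n IH] r r0 rb rhor rn.
  by rewrite expr0 mul1r in rn; rewrite (@le_anti _ _ rho r)// rhor.
have [r2|r2] := leP r (2 * rho).
  by move: rhor; rewrite le_eqVlt => /predU1P[->//|rhor]; exact: step.
apply: (@le_trans _ _ (Psi (r / 2))).
  by apply: IH; [lra|lra|lra|rewrite exprS in rn; lra].
by apply: step; lra.
Qed.

Theorem theorem2p3 (R : realType) (h : R -> \bar R) (rh : R)
    (E : set 'rV[R]_3) (x : 'rV[R]_3) :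
  gauge_function h ->
  0 < rh ->
  (gauge_integral h rh < +oo)%E ->
  rectifiable2 E ->
  locally_sliding_almost_minimal h E x ->
  (L0 x ->
     {in `]0, rh[ &,
        {homo (fun r => (density E x r + 8%:E * gauge_integral h r)%E) :
           r s / r <= s >-> (r <= s)%E}}) /\
  (~ L0 x ->
     {in `]0, (Num.min rh (edistance x (@L0 R)))[ &,
        {homo (fun r => (density E x r + 8%:E * gauge_integral h r)%E) :
           r s / r <= s >-> (r <= s)%E}}).
Proof.
move=> gh _ _ rectE minE; have [h0 _ _] := gh.
have step rho r : 0 < rho -> rho < r -> r <= 2 * rho ->
    (L0 x \/ forall y, L0 y -> r <= enorm (y - x)) ->
    (density E x rho + 8%:E * gauge_integral h rho <=
     density E x r + 8%:E * gauge_integral h r)%E.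
  move=> rho0 rhor r2 xL.
  have hr : (0 <= h r)%E by apply: h0; rewrite ltW// (lt_trans rho0).
  apply: le_trans (leeD (density_step rectE minE rho0 rhor xL hr) (lexx _)) _.
  rewrite -addeA; apply: leeD => //; rewrite addeC.
  exact: gauge_integral_step.
split=> [xL|_]; apply: le_doubling_chain => rho r rho0 rhor rb r2; apply: step => //.
  by left.
(* A radius below the distance to [L0] is below the distance to each of its points. *)
right=> y yL; move: rb; rewrite lt_min => /andP[_ rd]; rewrite enormC.
apply: le_trans (ltW rd) _; apply: ge_inf; last by exists y.
by exists 0 => _ [z _ <-]; exact: enorm_ge0.
Qed.
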